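(* Let $Q(T_1,\dots,T_\ell)$ be a polynomial with nonnegative real coefficients. Let $g_1,\dots,g_\ell$ be nonnegative strongly additive functions such that: (a) for each $j$ there is a constant $G_j$ with $g_j(p)\le G_j$ for all primes $p$; (b) for each $1\le j\le\ell$ the series $\sum_p g_j(p)^2/p$ diverges; (c) for all $1\le i,j\le\ell$ one has $\sigma^2(g_i)\gg\mu(g_j)$ for all sufficiently large $x$ (i.e. there is $c>0$ with $\sigma^2(g_i)\ge c\,\mu(g_j)$ for all large $x$). Define $$A_Q(x)=Q\big(\mu(g_1),\dots,\mu(g_\ell)\big),\qquad B_Q(x)^2=\sum_{i=1}^\ell\sum_{j=1}^\ell \frac{\partial Q}{\partial T_i}\big(\mu(g_1),\dots,\mu(g_\ell)\big)\frac{\partial Q}{\partial T_j}\big(\mu(g_1),\dots,\mu(g_\ell)\big)\kappa(g_i,g_j),$$ with $B_Q(x)\ge0$. Then for every real $u$, $$\lim_{x\to\infty}\frac1x\#\big\{n\le x: Q(g_1(n),\dots,g_\ell(n))<A_Q(x)+uB_Q(x)\big\}=\frac1{\sqrt{2\pi}}\int_{-\infty}^u e^{-t^2/2}\,dt.$$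
   Context: A function $g:\mathbb N\to\mathbb R$ is additive if $g(mn)=g(m)+g(n)$ whenever $\gcd(m,n)=1$, and strongly additive if moreover $g(p^\alpha)=g(p)$ for all primes $p$ and integers $\alpha\ge1$ (so $g(n)=\sum_{p\mid n}g(p)$). All quantities below depend on a real parameter $x$: $\mu(g)=\sum_{p\le x}\frac{g(p)}{p}$, $\kappa(g_i,g_j)=\sum_{p\le x}\frac{g_i(p)g_j(p)}{p}\big(1-\frac1p\big)$, $\sigma^2(g)=\kappa(g,g)$, sums over primes $p$.
   Formalization: The polynomial Q is additionally assumed to be nonconstant; for constant Q one has B_Q = 0 and the counted set is empty, so the limit is 0 and the claim as stated fails. *)

(* Defs.v *)
From Stdlib Require Import Reals Lra Lia ZArith Arith List Znumtheory.
Open Scope R_scope.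

Definition nprime (p : nat) : Prop := Znumtheory.prime (Z.of_nat p).

(* floor of a real, as a natural number (0 for x < 0) *)
Definition fl (x : R) : nat := Z.to_nat (Int_part x).

Definition psum (x : R) (f : nat -> R) : R :=
  fold_right (fun p acc =>
    (if Znumtheory.prime_dec (Z.of_nat p) then f p else 0) + acc) 0
    (seq 1 (fl x)).

Definition count_le (x : R) (P : nat -> bool) : nat :=
  length (filter P (seq 1 (fl x))).

Definition additive (g : nat -> R) : Prop :=
  forall m n, (1 <= m)%nat -> (1 <= n)%nat -> Nat.gcd m n = 1%nat ->
    g (m * n)%nat = g m + g n.

Definition strongly_additive (g : nat -> R) : Prop :=
  additive g /\
  forall p a, nprime p -> (1 <= a)%nat -> g (p ^ a)%nat = g p.

Definition mu (g : nat -> R) (x : R) : R := psum x (fun p => g p / INR p).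

Definition kappa (gi gj : nat -> R) (x : R) : R :=
  psum x (fun p => gi p * gj p / INR p * (1 - / INR p)).

Definition sigma2 (g : nat -> R) (x : R) : R := kappa g g x.

(* A polynomial in l variables T_0..T_{l-1}: a finite list of monomials
   (c, alpha) standing for c * prod_{i<l} T_i^(alpha i). *)
Definition mpoly := list (R * (nat -> nat)).

Fixpoint prodR (n : nat) (f : nat -> R) : R :=
  match n with O => 1 | S k => prodR k f * f k end.

Fixpoint sumR (n : nat) (f : nat -> R) : R :=
  match n with O => 0 | S k => sumR k f + f k end.

Definition mono_eval (l : nat) (alpha : nat -> nat) (t : nat -> R) : R :=
  prodR l (fun k => t k ^ alpha k).

Definition peval (l : nat) (Q : mpoly) (t : nat -> R) : R :=
  fold_right (fun m acc => fst m * mono_eval l (snd m) t + acc) 0 Q.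

Definition pderiv_eval (l : nat) (Q : mpoly) (i : nat) (t : nat -> R) : R :=
  fold_right (fun m acc =>
    fst m * INR (snd m i) * t i ^ (snd m i - 1) *
    prodR l (fun k => if Nat.eq_dec k i then 1 else t k ^ (snd m k)) + acc) 0 Q.

Definition nonneg_coeffs (Q : mpoly) : Prop := Forall (fun m => 0 <= fst m) Q.

Definition nonconstant (l : nat) (Q : mpoly) : Prop :=
  exists m, In m Q /\ fst m <> 0 /\ exists i, (i < l)%nat /\ (0 < snd m i)%nat.

Definition improper_lower_int (f : R -> R) (u L : R) : Prop :=
  forall eps, 0 < eps -> exists M0, forall M, M0 <= M ->
    forall pr : Riemann_integrable f (- M) u, Rabs (RiemannInt pr - L) < eps.

Definition gauss (t : R) : R := exp (- (t ^ 2) / 2).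

Definition lim_infty (F : R -> R) (L : R) : Prop :=
  forall eps, 0 < eps -> exists X, forall x, X <= x -> Rabs (F x - L) < eps.

Definition AQ (l : nat) (Q : mpoly) (g : nat -> nat -> R) (x : R) : R :=
  peval l Q (fun j => mu (g j) x).

Definition BQ (l : nat) (Q : mpoly) (g : nat -> nat -> R) (x : R) : R :=
  sqrt (sumR l (fun i => sumR l (fun j =>
    pderiv_eval l Q i (fun k => mu (g k) x) *
    pderiv_eval l Q j (fun k => mu (g k) x) * kappa (g i) (g j) x))).

(* Main.v *)
Require Import Defs.
From Stdlib Require Import Reals Lra Lia ZArith Arith List Znumtheory.
From Coquelicot Require Import Coquelicot.
Open Scope R_scope.

(** Linearising [Q] at the vector of means [mu(g_i)] reduces the theorem to a limit law
    for one strongly additive function [W] with values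
    [a_p = sum_i (dQ/dT_i)(mu) g_i(p) / B_Q], of variance one; writing
    [tau = mu(g_i)^(-1/2)], condition (c) gives [a_p = O(tau)] and mean [O(1/tau)].
    The quadratic remainder is [O(tau)] off an exceptional set which is small by the
    Turan-Kubilius inequality; nonnegativity of the coefficients is used to compare
    the second-order terms with [B_Q].

    For [W], the indicator of [W < u] is smoothed to [Phi((u - W) / sqrt v)], a solution of
    the heat equation. Expanding a smooth function of [W(n)] by inclusion-exclusion over the
    primes [p <= y = N^(1/2^J)], the coefficient of a product of [k] primes is a [k]-th order
    difference, bounded by [prod a_p] times the [k]-th derivative, that is by
    [O(1)^k sqrt(k!) prod a_p]. Rankin's trick makes the total error
    [exp(O(1/tau^2) - 2^J / 2)], so that [J = eta/tau] suffices, while the primes in [(y, N]]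
    contribute at most [O(tau) * sum 1/p = O(tau J) = O(eta)]. In the remaining model the
    divisibilities are independent, and Lindeberg's replacement, one prime at a time, is
    a step of the heat flow. *)

(** * Sums over primes and additive functions *)

(** The weights of [W] change with [x], so a limit theorem for one fixed function cannot be applied:
    every estimate has to be uniform over all weights obeying bounds in [C] and [tau] alone. The
    smoothing variance, by contrast, stays fixed while [tau] tends to 0. In the inclusion-exclusion
    the subsets of k primes contribute at most s^k / k! times the k-th derivative bound, where s is
    of order 1/tau and hence large. Derivatives of size k! would give a divergent geometric series;
    the size sqrt(k!) gives exp(O(s^2)). To sum without Stirling's formula, sqrt(k!) is replaced by
    [herm 1 k 1], which up to the factor exp(1/2) is the k-th derivative of exp(x^2 / 2) at 1, so
    that the sum over subsets becomes a Taylor expansion. The cut-off J is pulled both ways: the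
    discarded primes cost tau * J, so J may only be a small multiple of 1/tau, yet 2^J has to
    dominate 1/tau^2. An exponential faces a power here, and any small eta leaves enough room. *)

Definition sumf (f : nat -> R) (s : list nat) : R :=
  fold_right (fun n acc => f n + acc) 0 s.

Lemma sumf_cons f n s : sumf f (n :: s) = f n + sumf f s.
Proof. reflexivity. Qed.

Lemma sumf_app f s t : sumf f (s ++ t) = sumf f s + sumf f t.
Proof.
  induction s as [|n s IH]; [simpl; lra|].
  change ((n :: s) ++ t) with (n :: (s ++ t)). rewrite !sumf_cons, IH. lra.
Qed.

Lemma sumf_ext f h s : (forall n, In n s -> f n = h n) -> sumf f s = sumf h s.
Proof.
  induction s as [|n s IH]; intros H; [reflexivity|].
  rewrite !sumf_cons, H by (simpl; tauto).
  rewrite IH; [reflexivity|]. intros; apply H; simpl; tauto.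
Qed.

Lemma sumf_le f h s : (forall n, In n s -> f n <= h n) -> sumf f s <= sumf h s.
Proof.
  induction s as [|n s IH]; intros H; [simpl; lra|].
  rewrite !sumf_cons. apply Rplus_le_compat; [apply H; simpl; tauto|].
  apply IH. intros; apply H; simpl; tauto.
Qed.

Lemma sumf_plus f h s : sumf (fun n => f n + h n) s = sumf f s + sumf h s.
Proof.
  induction s as [|n s IH]; [simpl; lra|]. rewrite !sumf_cons, IH. lra.
Qed.

Lemma sumf_scal c f s : sumf (fun n => c * f n) s = c * sumf f s.
Proof.
  induction s as [|n s IH]; [simpl; lra|]. rewrite !sumf_cons, IH. lra.
Qed.

Lemma sumf_const c s : sumf (fun _ => c) s = c * INR (length s).
Proof.
  induction s as [|n s IH]; [simpl; lra|].
  rewrite sumf_cons, IH. cbn [length]. rewrite S_INR. lra.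
Qed.

Lemma sumf_nonneg f s : (forall n, In n s -> 0 <= f n) -> 0 <= sumf f s.
Proof.
  intros H. replace 0 with (sumf (fun _ => 0) s).
  - now apply sumf_le.
  - rewrite sumf_const. lra.
Qed.

Lemma sumf_abs f s : Rabs (sumf f s) <= sumf (fun n => Rabs (f n)) s.
Proof.
  induction s as [|n s IH]; [simpl; rewrite Rabs_R0; lra|].
  rewrite !sumf_cons. eapply Rle_trans; [apply Rabs_triang|]. lra.
Qed.

Lemma sumf_swap (f : nat -> nat -> R) s t :
  sumf (fun n => sumf (fun m => f n m) t) s =
  sumf (fun m => sumf (fun n => f n m) s) t.
Proof.
  induction s as [|n s IH].
  - simpl. rewrite sumf_const. lra.
  - rewrite sumf_cons, IH, <- sumf_plus. reflexivity.
Qed.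

Lemma sumf_filter f (b : nat -> bool) s :
  sumf f (filter b s) = sumf (fun n => if b n then f n else 0) s.
Proof.
  induction s as [|n s IH]; [reflexivity|].
  rewrite sumf_cons, <- IH. cbn [filter]. destruct (b n).
  - apply sumf_cons.
  - lra.
Qed.

Lemma sumf_sumR l (f : nat -> nat -> R) s :
  sumf (fun n => sumR l (fun i => f i n)) s = sumR l (fun i => sumf (f i) s).
Proof.
  induction l as [|l IH]; cbn [sumR].
  - rewrite sumf_const. lra.
  - rewrite sumf_plus, IH. reflexivity.
Qed.

Lemma length_filter_sumf (b : nat -> bool) s :
  INR (length (filter b s)) = sumf (fun n => if b n then 1 else 0) s.
Proof.
  rewrite <- (sumf_filter (fun _ => 1)), sumf_const. lra.
Qed.

Definition isprime (p : nat) : bool :=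
  if prime_dec (Z.of_nat p) then true else false.

Definition primes (N : nat) : list nat := filter isprime (seq 1 N).

Lemma isprime_spec p : isprime p = true <-> nprime p.
Proof.
  unfold isprime, nprime. destruct (prime_dec (Z.of_nat p)); split; intros; tauto || discriminate.
Qed.

Lemma nprime_ge2 p : nprime p -> (2 <= p)%nat.
Proof. intros H. apply prime_ge_2 in H. lia. Qed.

Lemma nprime_pos p : nprime p -> 0 < INR p.
Proof. intros H. apply nprime_ge2 in H. apply lt_0_INR. lia. Qed.

Lemma in_primes p N : In p (primes N) <-> nprime p /\ (p <= N)%nat.
Proof.
  unfold primes. rewrite filter_In, in_seq, isprime_spec. split.
  - intros [H1 H2]. split; [assumption | lia].
  - intros [H1 H2]. pose proof (nprime_ge2 p H1). split; [lia | assumption].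
Qed.

Lemma nodup_primes N : NoDup (primes N).
Proof. apply NoDup_filter, seq_NoDup. Qed.

Lemma psum_primes x f : psum x f = sumf f (primes (fl x)).
Proof.
  unfold psum, primes. induction (seq 1 (fl x)) as [|n s IH]; [reflexivity|].
  cbn [fold_right filter]. unfold isprime at 1.
  destruct (prime_dec (Z.of_nat n)).
  - rewrite sumf_cons, IH. reflexivity.
  - rewrite IH. lra.
Qed.

Lemma primes_split M N : (M <= N)%nat ->
  primes N = primes M ++ filter isprime (seq (S M) (N - M)).
Proof.
  intros H. unfold primes. rewrite <- filter_app.
  replace N with (M + (N - M))%nat at 1 by lia. rewrite seq_app. reflexivity.
Qed.

Lemma sumf_primes_mono f M N : (forall p, nprime p -> 0 <= f p) -> (M <= N)%nat ->
  sumf f (primes M) <= sumf f (primes N).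
Proof.
  intros Hf H. rewrite (primes_split M N H), sumf_app.
  assert (0 <= sumf f (filter isprime (seq (S M) (N - M)))).
  { apply sumf_nonneg. intros n Hn. apply filter_In in Hn. apply Hf, isprime_spec. tauto. }
  lra.
Qed.

Lemma length_primes_le N : (length (primes N) <= N)%nat.
Proof.
  unfold primes. etransitivity; [apply filter_length_le|]. rewrite length_seq. lia.
Qed.

Definition dvb (p n : nat) : bool := Nat.eqb (n mod p) 0.

Lemma dvb_spec p n : (0 < p)%nat -> dvb p n = true <-> Nat.divide p n.
Proof.
  intros Hp. unfold dvb. rewrite Nat.eqb_eq. apply Nat.Lcm0.mod_divide.
Qed.

Lemma nat_divide_Z p n : Nat.divide p n <-> (Z.of_nat p | Z.of_nat n)%Z.
Proof.
  split.
  - intros [k Hk]. exists (Z.of_nat k). subst. lia.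
  - intros [k Hk]. destruct (Nat.eq_dec p 0) as [->|Hp].
    + exists 0%nat. lia.
    + assert (0 <= k)%Z by nia. exists (Z.to_nat k). nia.
Qed.

Lemma nprime_divide_mul p m n : nprime p -> Nat.divide p (m * n) ->
  Nat.divide p m \/ Nat.divide p n.
Proof.
  rewrite !nat_divide_Z, Nat2Z.inj_mul. intros Hp. apply prime_mult, Hp.
Qed.

Lemma nprime_divide_prime p q : nprime p -> nprime q -> Nat.divide q p -> q = p.
Proof.
  intros Hp Hq. rewrite nat_divide_Z. intros H.
  apply prime_div_prime in H; try assumption. lia.
Qed.

Lemma dvb_mul_prime p q m : nprime p -> nprime q -> q <> p ->
  dvb q (p * m) = dvb q m.
Proof.
  intros Hp Hq Hne. pose proof (nprime_ge2 q Hq).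
  apply Bool.eq_iff_eq_true. rewrite !dvb_spec by lia. split; intros H1.
  - destruct (nprime_divide_mul q p m Hq H1) as [H2|H2]; [|assumption].
    now apply nprime_divide_prime in H2.
  - now apply Nat.divide_mul_r.
Qed.

(** The quotient [n / p] grows by one exactly when [n] passes a multiple of [p]. Counting multiples
    and each inclusion-exclusion step both go through this reindexing. *)
Lemma sumf_multiples p F n : (0 < p)%nat ->
  sumf (fun m => if dvb p m then F m else 0) (seq 1 n) =
  sumf (fun m => F (p * m)%nat) (seq 1 (n / p)).
Proof.
  intros Hp. induction n as [|n IH].
  - rewrite Nat.Div0.div_0_l. reflexivity.
  - rewrite seq_S, sumf_app, IH. cbn [sumf fold_right Nat.add].
    destruct (dvb p (S n)) eqn:E.
    + apply dvb_spec in E; [|assumption]. destruct E as [k Hk].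
      assert (E1 : (S n / p = k)%nat) by (rewrite Hk; apply Nat.div_mul; lia).
      assert (E2 : (n / p = k - 1)%nat).
      { symmetry. apply Nat.div_unique with (p - 1)%nat; [lia|].
        destruct k; [lia|]. nia. }
      rewrite E1, E2. destruct k as [|k]; [lia|].
      replace (S k - 1)%nat with k by lia. rewrite seq_S, sumf_app.
      cbn [sumf fold_right Nat.add]. rewrite Hk. rewrite (Nat.mul_comm p (S k)). lra.
    + assert (E2 : (S n / p = n / p)%nat).
      { unfold dvb in E. apply Nat.eqb_neq in E.
        apply Nat.div_unique with (S n mod p - 1)%nat.
        - pose proof (Nat.mod_upper_bound (S n) p). lia.
        - pose proof (Nat.div_mod_eq (S n) p). lia. }
      rewrite E2. lra.
Qed.

Lemma count_multiples p n : (0 < p)%nat ->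
  sumf (fun m => if dvb p m then 1 else 0) (seq 1 n) = INR (n / p).
Proof.
  intros Hp. rewrite (sumf_multiples p (fun _ => 1)) by assumption.
  rewrite sumf_const, length_seq. lra.
Qed.

Lemma INR_div_le n p : (0 < p)%nat -> INR (n / p) <= INR n / INR p.
Proof.
  intros Hp. apply lt_0_INR in Hp as Hp'.
  apply Rmult_le_reg_r with (INR p); [assumption|].
  replace (INR n / INR p * INR p) with (INR n) by (field; lra).
  rewrite <- mult_INR. apply le_INR. pose proof (Nat.Div0.mul_div_le n p). lia.
Qed.

Lemma INR_div_gt n p : (0 < p)%nat -> INR n / INR p < INR (n / p) + 1.
Proof.
  intros Hp. apply lt_0_INR in Hp as Hp'.
  apply Rmult_lt_reg_r with (INR p); [assumption|].
  replace (INR n / INR p * INR p) with (INR n) by (field; lra).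
  rewrite <- S_INR, <- mult_INR. apply lt_INR.
  pose proof (Nat.mul_succ_div_gt n p). lia.
Qed.

(** A strongly additive function truncated to the primes in [ps]. With a list, large primes are
    split off by concatenation and single primes by recursion. *)
Definition addf (a : nat -> R) (ps : list nat) (n : nat) : R :=
  sumf (fun p => if dvb p n then a p else 0) ps.

Lemma sumf_addf a ps n : (forall p, In p ps -> (0 < p)%nat) ->
  sumf (addf a ps) (seq 1 n) = sumf (fun p => a p * INR (n / p)) ps.
Proof.
  intros H. unfold addf. rewrite sumf_swap. apply sumf_ext. intros p Hp.
  rewrite <- count_multiples by now apply H. rewrite <- sumf_scal.
  apply sumf_ext. intros m _. destruct (dvb p m); lra.
Qed.

Lemma addf_nonneg a ps n : (forall p, In p ps -> 0 <= a p) -> 0 <= addf a ps n.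
Proof.
  intros H. apply sumf_nonneg. intros p Hp. destruct (dvb p n); [now apply H|lra].
Qed.

Lemma addf_app a ps qs n : addf a (ps ++ qs) n = addf a ps n + addf a qs n.
Proof. apply sumf_app. Qed.

Lemma addf_avg_le a ps n : (forall p, In p ps -> (0 < p)%nat /\ 0 <= a p) ->
  sumf (addf a ps) (seq 1 n) <= INR n * sumf (fun p => a p / INR p) ps.
Proof.
  intros H. rewrite sumf_addf by (intros; now apply H).
  rewrite <- sumf_scal. apply sumf_le. intros p Hp. destruct (H p Hp).
  replace (INR n * (a p / INR p)) with (a p * (INR n / INR p)) by (unfold Rdiv; ring).
  apply Rmult_le_compat_l; [assumption|]. now apply INR_div_le.
Qed.

Lemma sumf_pick f p s : NoDup s -> In p s ->
  sumf (fun q => if Nat.eq_dec q p then f q else 0) s = f p.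
Proof.
  induction s as [|q s IH]; intros Hnd Hin; [destruct Hin|].
  rewrite sumf_cons. inversion Hnd; subst.
  destruct (Nat.eq_dec q p) as [->|Hne].
  - rewrite (sumf_ext _ (fun _ => 0)), sumf_const; [lra|].
    intros n Hn. destruct (Nat.eq_dec n p); [subst; tauto|reflexivity].
  - destruct Hin as [->|Hin]; [tauto|]. rewrite IH by assumption. lra.
Qed.

Lemma exists_prime_divisor n : (2 <= n)%nat -> exists p, nprime p /\ Nat.divide p n.
Proof.
  induction n as [n IH] using lt_wf_ind. intros Hn.
  destruct (prime_dec (Z.of_nat n)) as [Hp|Hp].
  - exists n. split; [exact Hp | exists 1%nat; lia].
  - apply not_prime_divide in Hp; [|lia]. destruct Hp as [k [[H1 H2] H3]].
    destruct (IH (Z.to_nat k)) as [p [Hp1 Hp2]]; [lia|lia|].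
    exists p. split; [assumption|]. eapply Nat.divide_trans; [exact Hp2|].
    apply nat_divide_Z. now rewrite Z2Nat.id by lia.
Qed.

Lemma prime_power_split p n : nprime p -> (1 <= n)%nat ->
  exists a m, n = (p ^ a * m)%nat /\ ~ Nat.divide p m /\ (1 <= m)%nat.
Proof.
  intros Hp. apply nprime_ge2 in Hp as Hp2.
  induction n as [n IH] using lt_wf_ind. intros Hn.
  destruct (dvb p n) eqn:E.
  - apply dvb_spec in E; [|lia]. destruct E as [k ->].
    destruct (IH k) as [a [m [E1 [E2 E3]]]]; [nia|nia|].
    exists (S a), m. split; [|split; assumption]. cbn [Nat.pow]. rewrite E1. ring.
  - exists 0%nat, n. split; [cbn; lia|]. split; [|assumption].
    intros H. apply dvb_spec in H; [|lia]. congruence.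
Qed.

Lemma coprime_prime_power p a m : nprime p -> ~ Nat.divide p m ->
  Nat.gcd (p ^ a) m = 1%nat.
Proof.
  intros Hp Hm. destruct (Nat.eq_dec (Nat.gcd (p ^ a) m) 1) as [|Hne]; [assumption|].
  exfalso. assert (Hp0 := nprime_ge2 p Hp).
  assert (H0 : Nat.gcd (p ^ a) m <> 0%nat).
  { intros H. apply Nat.gcd_eq_0_l in H. apply Nat.pow_eq_0 in H; [lia|].
    intros ->. cbn in H. lia. }
  destruct (exists_prime_divisor (Nat.gcd (p ^ a) m)) as [q [Hq1 Hq2]]; [lia|].
  assert (H1 : Nat.divide q (p ^ a)) by (eapply Nat.divide_trans; [exact Hq2|apply Nat.gcd_divide_l]).
  assert (H2 : Nat.divide q m) by (eapply Nat.divide_trans; [exact Hq2|apply Nat.gcd_divide_r]).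
  assert (H3 : Nat.divide q p).
  { clear -H1 Hq1. induction a as [|a IH].
    - cbn in H1. exists p. apply Nat.divide_1_r in H1. subst. lia.
    - cbn [Nat.pow] in H1. apply nprime_divide_mul in H1; [|assumption]. tauto. }
  apply nprime_divide_prime in H3; [|assumption|assumption]. subst. tauto.
Qed.

(** The full power of one prime is removed at each step, which leaves a coprime cofactor, as
    additivity requires. *)
Lemma prime_factor_induction (P : nat -> Prop) : P 1%nat ->
  (forall p a m, nprime p -> (1 <= a)%nat -> (1 <= m)%nat -> ~ Nat.divide p m ->
     P m -> P (p ^ a * m)%nat) ->
  forall n, (1 <= n)%nat -> P n.
Proof.
  intros H1 Hstep. induction n as [n IH] using lt_wf_ind. intros Hn.
  destruct (Nat.eq_dec n 1) as [->|Hne]; [assumption|].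
  destruct (exists_prime_divisor n) as [p [Hp Hd]]; [lia|].
  destruct (prime_power_split p n Hp Hn) as [a [m [E [Hm Hm1]]]].
  apply nprime_ge2 in Hp as Hp2.
  destruct a as [|a].
  - cbn in E. exfalso. apply Hm. replace m with n by lia. assumption.
  - rewrite E. apply Hstep; try assumption; [lia|]. apply IH; [|assumption].
    rewrite E. cbn [Nat.pow]. assert (1 <= p ^ a)%nat by (apply Nat.neq_0_lt_0, Nat.pow_nonzero; lia).
    assert (2 <= p * p ^ a)%nat by nia. nia.
Qed.

Lemma dvb_prime_power_mul p a m q : nprime p -> nprime q -> (1 <= a)%nat ->
  ~ Nat.divide p m ->
  dvb q (p ^ a * m) = (if Nat.eq_dec q p then true else dvb q m).
Proof.
  intros Hp Hq Ha Hm. pose proof (nprime_ge2 q Hq) as Hq2.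
  destruct (Nat.eq_dec q p) as [->|Hne].
  - apply dvb_spec; [lia|]. apply Nat.divide_mul_l. destruct a; [lia|].
    exists (p ^ a)%nat. cbn [Nat.pow]. ring.
  - clear Ha Hm. induction a as [|a IH].
    + cbn [Nat.pow]. now rewrite Nat.mul_1_l.
    + cbn [Nat.pow]. rewrite <- Nat.mul_assoc, dvb_mul_prime; assumption.
Qed.

Lemma addf_prime_power_mul a ps p e m : NoDup ps -> (forall q, In q ps -> nprime q) ->
  In p ps -> (1 <= e)%nat -> ~ Nat.divide p m ->
  addf a ps (p ^ e * m) = a p + addf a ps m.
Proof.
  intros Hnd Hps Hin He Hm. unfold addf.
  rewrite <- (sumf_pick a p ps) by assumption. rewrite <- sumf_plus.
  apply sumf_ext. intros q Hq. apply Hps in Hq as Hq1. apply Hps in Hin as Hp1.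
  rewrite dvb_prime_power_mul by assumption.
  destruct (Nat.eq_dec q p) as [->|]; [|lra].
  destruct (dvb p m) eqn:E; [|lra].
  apply dvb_spec in E; [tauto|]. apply nprime_ge2 in Hp1. lia.
Qed.

Lemma strongly_additive_addf g N n : strongly_additive g -> (1 <= n)%nat -> (n <= N)%nat ->
  g n = addf g (primes N) n.
Proof.
  intros [Hadd Hst] Hn. revert n Hn.
  apply (prime_factor_induction (fun n => (n <= N)%nat -> g n = addf g (primes N) n)).
  - intros _. specialize (Hadd 1%nat 1%nat (le_n _) (le_n _) eq_refl). cbn in Hadd.
    unfold addf. rewrite (sumf_ext _ (fun _ => 0)), sumf_const; [lra|].
    intros p Hp. apply in_primes in Hp. destruct Hp as [Hp _]. apply nprime_ge2 in Hp.
    destruct (dvb p 1) eqn:E; [|reflexivity]. apply dvb_spec in E; [|lia].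
    apply Nat.divide_1_r in E. lia.
  - intros p a m Hp Ha Hm1 Hm IH HN. pose proof (nprime_ge2 p Hp) as Hp2.
    assert (Hpa : (p <= p ^ a)%nat).
    { destruct a; [lia|]. cbn [Nat.pow].
      assert (1 <= p ^ a)%nat by (apply Nat.neq_0_lt_0, Nat.pow_nonzero; lia). nia. }
    rewrite Hadd, Hst, IH by (assumption || nia || now apply coprime_prime_power).
    symmetry. apply addf_prime_power_mul; try assumption.
    + apply nodup_primes.
    + intros q Hq. now apply in_primes in Hq.
    + apply in_primes. split; [assumption|]. nia.
Qed.

(** The left side is the logarithm of the radical of [n], a divisor of [n]. *)
Lemma addf_ln_le N n : (1 <= n)%nat -> (n <= N)%nat ->
  addf (fun p => ln (INR p)) (primes N) n <= ln (INR n).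
Proof.
  intros Hn. revert n Hn.
  apply (prime_factor_induction
    (fun n => (n <= N)%nat -> addf (fun p => ln (INR p)) (primes N) n <= ln (INR n))).
  - intros _. replace (ln (INR 1)) with 0 by (simpl; now rewrite ln_1).
    unfold addf. rewrite (sumf_ext _ (fun _ => 0)), sumf_const; [lra|].
    intros p Hp. apply in_primes in Hp. destruct Hp as [Hp _]. apply nprime_ge2 in Hp.
    destruct (dvb p 1) eqn:E; [|reflexivity]. apply dvb_spec in E; [|lia].
    apply Nat.divide_1_r in E. lia.
  - intros p a m Hp Ha Hm1 Hm IH HN. pose proof (nprime_ge2 p Hp) as Hp2.
    assert (Hpa : (p <= p ^ a)%nat).
    { destruct a; [lia|]. cbn [Nat.pow].
      assert (1 <= p ^ a)%nat by (apply Nat.neq_0_lt_0, Nat.pow_nonzero; lia). nia. }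
    rewrite addf_prime_power_mul; try assumption.
    + specialize (IH ltac:(nia)). rewrite mult_INR, ln_mult by (apply lt_0_INR; lia).
      apply Rplus_le_compat; [|assumption].
      apply Rcomplements.ln_le; [apply lt_0_INR; lia|]. now apply le_INR.
    + apply nodup_primes.
    + intros q Hq. now apply in_primes in Hq.
    + apply in_primes. split; [assumption|]. nia.
Qed.

(** * Reciprocals of primes *)

Lemma ln_nonneg_INR n : (1 <= n)%nat -> 0 <= ln (INR n).
Proof.
  intros H. rewrite <- ln_1. apply Rcomplements.ln_le; [lra|].
  apply le_INR in H. exact H.
Qed.

(** Chebyshev's argument: the logarithms of the radicals of all [n <= Y] add up to at most
    [Y * ln Y], and exchanging the sums gives [ln p] times the integer part of [Y / p]. The factor 2
    pays for that integer part, which is at least 1 for [p <= Y]. *)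
Lemma sum_ln_div_le Y : (1 <= Y)%nat ->
  sumf (fun p => ln (INR p) / INR p) (primes Y) <= 2 * ln (INR Y).
Proof.
  intros HY. assert (HY' : 0 < INR Y) by (apply lt_0_INR; lia).
  assert (H1 : sumf (addf (fun p => ln (INR p)) (primes Y)) (seq 1 Y) <= INR Y * ln (INR Y)).
  { replace (INR Y * ln (INR Y)) with (sumf (fun _ => ln (INR Y)) (seq 1 Y)).
    - apply sumf_le. intros n Hn. apply in_seq in Hn.
      eapply Rle_trans; [apply addf_ln_le; lia|].
      apply Rcomplements.ln_le; [apply lt_0_INR; lia|]. apply le_INR. lia.
    - rewrite sumf_const, length_seq. ring. }
  rewrite sumf_addf in H1.
  2:{ intros p Hp. apply in_primes in Hp. destruct Hp as [Hp _]. apply nprime_ge2 in Hp. lia. }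
  apply Rmult_le_reg_l with (INR Y); [assumption|].
  rewrite <- sumf_scal.
  apply Rle_trans with (2 * sumf (fun p => ln (INR p) * INR (Y / p)) (primes Y)); [|lra].
  rewrite <- sumf_scal. apply sumf_le. intros p Hp. apply in_primes in Hp.
  destruct Hp as [Hp HpY]. apply nprime_ge2 in Hp as Hp2.
  assert (Hl : 0 <= ln (INR p)) by (apply ln_nonneg_INR; lia).
  assert (H2 := INR_div_gt Y p ltac:(lia)).
  assert (H3 : 1 <= INR (Y / p)).
  { apply (le_INR 1). apply Nat.div_le_lower_bound; lia. }
  replace (INR Y * (ln (INR p) / INR p)) with (ln (INR p) * (INR Y / INR p))
    by (unfold Rdiv; ring).
  replace (2 * (ln (INR p) * INR (Y / p))) with (ln (INR p) * (2 * INR (Y / p))) by ring.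
  apply Rmult_le_compat_l; lra.
Qed.

(** Above [sqrt Y] one has [ln p >= ln Y / 2], so [1 / p] is at most [2 / ln Y] times [ln p / p];
    with the bound [2 * ln Y] of [sum_ln_div_le] this makes 4. Each square root taken of the cut-off
    thus costs a bounded amount. *)
Lemma sum_inv_sqrt_block Y :
  sumf (fun p => / INR p) (primes Y) <=
  sumf (fun p => / INR p) (primes (Nat.sqrt Y)) + 4.
Proof.
  pose proof (Nat.sqrt_spec' Y) as [Hs1 Hs2].
  rewrite (primes_split (Nat.sqrt Y) Y) by (apply Nat.sqrt_le_lin). rewrite sumf_app.
  apply Rplus_le_compat_l.
  destruct (le_lt_dec Y 1) as [HY|HY].
  - rewrite (sumf_ext _ (fun _ => 0)).
    + rewrite sumf_const. lra.
    + intros p Hp. apply filter_In in Hp. destruct Hp as [Hp1 Hp2].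
      apply isprime_spec, nprime_ge2 in Hp2. apply in_seq in Hp1.
      pose proof (Nat.sqrt_le_lin Y). lia.
  - assert (HlY : 0 < ln (INR Y)).
    { rewrite <- ln_1. apply ln_increasing; [lra|]. apply (lt_INR 1). lia. }
    apply Rle_trans with
      (sumf (fun p => 2 / ln (INR Y) * (ln (INR p) / INR p))
         (filter isprime (seq (S (Nat.sqrt Y)) (Y - Nat.sqrt Y)))).
    + apply sumf_le. intros p Hp. apply filter_In in Hp. destruct Hp as [Hp1 Hp2].
      apply isprime_spec, nprime_ge2 in Hp2. apply in_seq in Hp1.
      assert (H0 : 0 < INR p) by (apply lt_0_INR; lia).
      assert (H : ln (INR Y) <= 2 * ln (INR p)).
      { replace (2 * ln (INR p)) with (ln (INR p) + ln (INR p)) by ring.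
        rewrite <- ln_mult, <- mult_INR by assumption.
        apply Rcomplements.ln_le; [apply lt_0_INR; lia|]. apply le_INR. nia. }
      replace (2 / ln (INR Y) * (ln (INR p) / INR p))
        with ((2 * ln (INR p) / ln (INR Y)) * / INR p) by (field; lra).
      rewrite <- (Rmult_1_l (/ INR p)) at 1.
      apply Rmult_le_compat_r; [left; now apply Rinv_0_lt_compat|].
      apply Rcomplements.Rle_div_r; lra.
    + rewrite sumf_scal.
      assert (H := sum_ln_div_le Y ltac:(lia)).
      rewrite (primes_split (Nat.sqrt Y) Y) in H by (apply Nat.sqrt_le_lin).
      rewrite sumf_app in H.
      assert (H' : 0 <= sumf (fun p => ln (INR p) / INR p) (primes (Nat.sqrt Y))).
      { apply sumf_nonneg. intros p Hp. apply in_primes in Hp. destruct Hp as [Hp _].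
        apply nprime_ge2 in Hp. apply Rcomplements.Rdiv_le_0_compat;
          [apply ln_nonneg_INR; lia | apply lt_0_INR; lia]. }
      replace 4 with (2 / ln (INR Y) * (2 * ln (INR Y))) by (field; lra).
      apply Rmult_le_compat_l; [|lra].
      apply Rcomplements.Rdiv_le_0_compat; lra.
Qed.

Definition root_iter (J N : nat) : nat := Nat.iter J Nat.sqrt N.

Lemma root_iter_le J N : (root_iter J N <= N)%nat.
Proof.
  induction J as [|J IH]; [apply le_n|]. cbn. etransitivity; [apply Nat.sqrt_le_lin|exact IH].
Qed.

Lemma sum_inv_root_iter J N :
  sumf (fun p => / INR p) (primes N) <=
  sumf (fun p => / INR p) (primes (root_iter J N)) + 4 * INR J.
Proof.
  induction J as [|J IH]; [change (root_iter 0 N) with N; simpl (INR 0); lra|].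
  rewrite S_INR. pose proof (sum_inv_sqrt_block (root_iter J N)) as H.
  change (Nat.sqrt (root_iter J N)) with (root_iter (S J) N) in H. lra.
Qed.

Lemma ln_root_iter J N : (1 <= root_iter J N)%nat ->
  2 ^ J * ln (INR (root_iter J N)) <= ln (INR N).
Proof.
  induction J as [|J IH]; intros H; [change (root_iter 0 N) with N; simpl; lra|].
  change (root_iter (S J) N) with (Nat.sqrt (root_iter J N)) in *.
  set (y := root_iter J N) in *.
  pose proof (Nat.sqrt_spec' y) as [Hs1 Hs2].
  assert (1 <= y)%nat by (pose proof (Nat.sqrt_le_lin y); lia). specialize (IH ltac:(assumption)).
  eapply Rle_trans; [|exact IH]. cbn [pow].
  replace (2 * 2 ^ J * ln (INR (Nat.sqrt y)))
    with (2 ^ J * (ln (INR (Nat.sqrt y)) + ln (INR (Nat.sqrt y)))) by ring.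
  apply Rmult_le_compat_l; [apply pow_le; lra|].
  rewrite <- ln_mult, <- mult_INR by (apply lt_0_INR; lia).
  apply Rcomplements.ln_le; [apply lt_0_INR; lia|]. now apply le_INR.
Qed.

(** * The Gaussian distribution function *)

Lemma mean_value (f f' : R -> R) a b :
  (forall x, Rmin a b <= x <= Rmax a b -> is_derive f x (f' x)) ->
  exists c, Rmin a b <= c <= Rmax a b /\ f b - f a = f' c * (b - a).
Proof.
  intros H. apply MVT_gen; intros x Hx; [apply H; lra|].
  apply continuity_pt_filterlim.
  apply (ex_derive_continuous (K:=R_AbsRing) (V:=R_NormedModule)). exists (f' x). now apply H.
Qed.

Lemma exp_le_mono x y : x <= y -> exp x <= exp y.
Proof. intros [H| ->]; [left; now apply exp_increasing|lra]. Qed.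

Ltac eqR := match goal with |- @eq _ ?a ?b => change (@eq R a b) end.

Lemma is_derive_gauss t : is_derive gauss t (- t * gauss t).
Proof. unfold gauss. auto_derive; [trivial|]. eqR. simpl. unfold Rdiv. field. Qed.

Lemma continuous_gauss t : continuous gauss t.
Proof. apply (ex_derive_continuous (K:=R_AbsRing) (V:=R_NormedModule)). eexists. apply is_derive_gauss. Qed.

Lemma ex_RInt_gauss a b : ex_RInt gauss a b.
Proof. apply (ex_RInt_continuous (V:=R_CompleteNormedModule)). intros; apply continuous_gauss. Qed.

Lemma gauss_pos t : 0 < gauss t.
Proof. apply exp_pos. Qed.

Definition gauss_int (x : R) : R := RInt gauss 0 x.

Lemma is_derive_gauss_int x : is_derive gauss_int x (gauss x).
Proof.
  apply (is_derive_RInt gauss gauss_int 0 x).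
  - apply filter_forall. intros b. apply (RInt_correct (V:=R_CompleteNormedModule)), ex_RInt_gauss.
  - apply continuous_gauss.
Qed.

Lemma gauss_int_opp x : gauss_int (- x) = - gauss_int x.
Proof.
  unfold gauss_int.
  assert (E := RInt_comp_lin (V:=R_CompleteNormedModule) gauss (-1) 0 0 x (ex_RInt_gauss _ _)).
  replace (-1 * 0 + 0) with 0 in E by ring. replace (-1 * x + 0) with (- x) in E by ring.
  rewrite <- E. rewrite (RInt_ext _ (fun t => scal (-1) (gauss t))).
  - rewrite (RInt_scal (V:=R_CompleteNormedModule)) by apply ex_RInt_gauss.
    unfold scal; simpl; unfold mult; simpl. ring.
  - intros t _. unfold gauss. do 3 f_equal. ring.
Qed.

Lemma gauss_int_0 : gauss_int 0 = 0.
Proof. apply (RInt_point (V:=R_CompleteNormedModule)). Qed.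

Lemma gauss_int_nonneg x : 0 <= x -> 0 <= gauss_int x.
Proof.
  intros H. apply RInt_ge_0; [assumption|apply ex_RInt_gauss|].
  intros; left; apply gauss_pos.
Qed.

(* [2 * gauss_aux x] complements [gauss_int x ^ 2] to a constant. *)
Definition gauss_aux (x : R) : R :=
  RInt (fun t => exp (- (x ^ 2 * (1 + t ^ 2)) / 2) / (1 + t ^ 2)) 0 1.

Lemma gauss_aux_integrand_derive x t :
  is_derive (fun u => exp (- (u ^ 2 * (1 + t ^ 2)) / 2) / (1 + t ^ 2)) x
    (- x * exp (- (x ^ 2 * (1 + t ^ 2)) / 2)).
Proof.
  assert (0 < 1 + t ^ 2) by nra.
  auto_derive; [lra|]. eqR. simpl. unfold Rdiv. field. simpl in *. lra.
Qed.

Lemma gauss_aux_integrand_continuous x t :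
  continuous (fun t => exp (- (x ^ 2 * (1 + t ^ 2)) / 2) / (1 + t ^ 2)) t.
Proof.
  apply (ex_derive_continuous (K:=R_AbsRing) (V:=R_NormedModule)). auto_derive. nra.
Qed.

Lemma ex_RInt_gauss_aux x :
  ex_RInt (fun t => exp (- (x ^ 2 * (1 + t ^ 2)) / 2) / (1 + t ^ 2)) 0 1.
Proof.
  apply (ex_RInt_continuous (V:=R_CompleteNormedModule)). intros; apply gauss_aux_integrand_continuous.
Qed.

(** Differentiating under the integral cancels the denominator [1 + t^2], and the substitution
    [s = x * t] turns what remains into [gauss_int x]. *)
Lemma is_derive_gauss_aux x : is_derive gauss_aux x (- gauss x * gauss_int x).
Proof.
  replace (- gauss x * gauss_int x) with
    (RInt (fun t => Derive (fun u => exp (- (u ^ 2 * (1 + t ^ 2)) / 2) / (1 + t ^ 2)) x) 0 1).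
  - apply (is_derive_RInt_param
      (fun u t => exp (- (u ^ 2 * (1 + t ^ 2)) / 2) / (1 + t ^ 2)) 0 1 x).
    + apply filter_forall. intros y t _. eexists. apply gauss_aux_integrand_derive.
    + intros t _.
      apply continuity_2d_pt_ext with
        (fun u v => - u * exp (- (u * u * (1 + v * v)) / 2)).
      { intros u v. symmetry. etransitivity;
          [apply is_derive_unique, gauss_aux_integrand_derive|].
        eqR. do 4 f_equal. simpl. ring. }
      apply continuity_2d_pt_mult.
      { apply continuity_2d_pt_opp, continuity_2d_pt_id1. }
      apply (continuity_1d_2d_pt_comp exp (fun u v => - (u * u * (1 + v * v)) / 2)).
      { apply derivable_continuous_pt, derivable_pt_exp. }
      unfold Rdiv. apply continuity_2d_pt_mult; [|apply continuity_2d_pt_const].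
      apply continuity_2d_pt_opp. apply continuity_2d_pt_mult.
      { apply continuity_2d_pt_mult; apply continuity_2d_pt_id1. }
      apply continuity_2d_pt_plus; [apply continuity_2d_pt_const|].
      apply continuity_2d_pt_mult; apply continuity_2d_pt_id2.
    + apply filter_forall. intros y. apply ex_RInt_gauss_aux.
  - assert (E := RInt_comp_lin (V:=R_CompleteNormedModule) gauss x 0 0 1 (ex_RInt_gauss _ _)).
    rewrite Rmult_0_r, Rmult_1_r, !Rplus_0_r in E.
    unfold gauss_int. rewrite <- E.
    assert (Hex : ex_RInt (fun y => scal x (gauss (x * y + 0))) 0 1).
    { apply (ex_RInt_continuous (V:=R_CompleteNormedModule)). intros z _.
      apply (ex_derive_continuous (K:=R_AbsRing) (V:=R_NormedModule)). unfold scal; simpl; unfold mult; simpl. unfold gauss.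
      auto_derive. trivial. }
    transitivity (scal (- gauss x) (RInt (fun y => scal x (gauss (x * y + 0))) 0 1));
      [|reflexivity].
    rewrite <- (RInt_scal (V:=R_CompleteNormedModule)) by exact Hex.
    apply RInt_ext. intros t _.
    etransitivity; [apply is_derive_unique, gauss_aux_integrand_derive|]. eqR.
    unfold scal; simpl; unfold mult; simpl.
    replace (exp (- (x * (x * 1) * (1 + t * (t * 1))) / 2))
      with (gauss x * gauss (x * t + 0)).
    + ring.
    + unfold gauss. rewrite <- exp_plus. f_equal. simpl. field.
Qed.

(** The derivatives of the two terms cancel, so the sum keeps its value at 0, which is
    [2 * atan 1]. *)
Lemma gauss_int_sqr x : gauss_int x ^ 2 + 2 * gauss_aux x = PI / 2.
Proof.
  assert (H : gauss_int x ^ 2 + 2 * gauss_aux x = gauss_int 0 ^ 2 + 2 * gauss_aux 0).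
  { assert (Hd : forall y, is_derive (fun x => gauss_int x ^ 2 + 2 * gauss_aux x) y 0).
    { intros y. evar_last.
      + apply (is_derive_plus (K:=R_AbsRing) (V:=R_NormedModule)
                 (fun x => gauss_int x ^ 2) (fun x => 2 * gauss_aux x)).
        * apply (is_derive_pow gauss_int 2). apply is_derive_gauss_int.
        * apply (is_derive_scal gauss_aux). apply is_derive_gauss_aux.
      + unfold plus; simpl. ring. }
    destruct (mean_value _ (fun _ => 0) 0 x (fun y _ => Hd y)) as [c [_ Hc]].
    lra. }
  rewrite H, gauss_int_0. unfold gauss_aux.
  rewrite (RInt_ext _ (fun t => / (1 + t²))).
  - rewrite (is_RInt_unique _ 0 1 (minus (atan 1) (atan 0))).
    + rewrite atan_1, atan_0. unfold minus, plus, opp; simpl. field.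
    + apply (is_RInt_derive atan).
      * intros t _. apply is_derive_atan.
      * intros t _. apply (ex_derive_continuous (K:=R_AbsRing) (V:=R_NormedModule)). unfold Rsqr. auto_derive. nra.
  - intros t _. replace (- (0 ^ 2 * (1 + t ^ 2)) / 2) with 0 by field.
    rewrite exp_0. unfold Rsqr, Rdiv. rewrite Rmult_1_l. f_equal. ring.
Qed.

Lemma gauss_aux_bounds x : 0 <= gauss_aux x <= gauss x.
Proof.
  split.
  - apply RInt_ge_0; [lra|apply ex_RInt_gauss_aux|]. intros t _.
    apply Rcomplements.Rdiv_le_0_compat; [left; apply exp_pos|nra].
  - apply Rle_trans with (RInt (fun _ => gauss x) 0 1).
    + apply RInt_le; [lra|apply ex_RInt_gauss_aux|apply ex_RInt_const|].
      intros t _. assert (H : 0 < 1 + t ^ 2) by nra.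
      apply Rcomplements.Rle_div_l; [lra|].
      apply Rle_trans with (gauss x * 1).
      * rewrite Rmult_1_r. unfold gauss. apply exp_le_mono. nra.
      * apply Rmult_le_compat_l; [left; apply gauss_pos|nra].
    + rewrite RInt_const. unfold scal; simpl; unfold mult; simpl. lra.
Qed.

Definition Phi (x : R) : R := / 2 + gauss_int x / sqrt (2 * PI).

Lemma sqrt_2PI_ge1 : 1 <= sqrt (2 * PI).
Proof.
  rewrite <- sqrt_1. apply sqrt_le_1_alt. pose proof PI2_1. lra.
Qed.

Lemma Phi_opp x : Phi (- x) = 1 - Phi x.
Proof. unfold Phi. rewrite gauss_int_opp. pose proof sqrt_2PI_ge1. field. lra. Qed.

Lemma is_derive_Phi x : is_derive Phi x (/ sqrt (2 * PI) * gauss x).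
Proof.
  unfold Phi. evar_last.
  - apply (is_derive_plus (K:=R_AbsRing) (V:=R_NormedModule) (fun _ => / 2) (fun x => gauss_int x / sqrt (2 * PI))).
    + apply is_derive_const.
    + apply (is_derive_ext (fun x => / sqrt (2 * PI) * gauss_int x)).
      * intros t. unfold Rdiv. apply Rmult_comm.
      * apply (is_derive_scal gauss_int). apply is_derive_gauss_int.
  - unfold plus, zero; simpl. ring.
Qed.

(** Factoring [s^2 - k^2 = 2 * gauss_aux x] and using [s + k >= 1] gives the limit of [gauss_int]
    together with a rate. *)
Lemma gauss_int_gap x : 0 <= x -> 0 <= sqrt (PI / 2) - gauss_int x <= 2 * gauss x.
Proof.
  intros Hx. pose proof (gauss_int_sqr x) as H. pose proof (gauss_int_nonneg x Hx) as H0.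
  pose proof (gauss_aux_bounds x) as [H1 H2]. pose proof PI2_1 as HPI.
  assert (Hs : 1 <= sqrt (PI / 2)).
  { rewrite <- sqrt_1. apply sqrt_le_1_alt. lra. }
  assert (Hq : sqrt (PI / 2) ^ 2 = PI / 2) by (apply pow2_sqrt; lra).
  set (s := sqrt (PI / 2)) in *. set (k := gauss_int x) in *.
  assert (E : (s - k) * (s + k) = 2 * gauss_aux x) by nra.
  split; nra.
Qed.

Lemma Phi_gap x : 0 <= x -> 0 <= 1 - Phi x <= 2 * gauss x.
Proof.
  intros Hx. pose proof (gauss_int_gap x Hx) as [H1 H2]. pose proof sqrt_2PI_ge1 as H3.
  assert (E : 1 - Phi x = / sqrt (2 * PI) * (sqrt (PI / 2) - gauss_int x)).
  { unfold Phi. replace (sqrt (PI / 2)) with (sqrt (2 * PI) / 2).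
    - field. lra.
    - replace (PI / 2) with (2 * PI * (/ 2)²) by (unfold Rsqr; field).
      rewrite (sqrt_mult_alt (2 * PI)), sqrt_Rsqr by (pose proof PI_RGT_0; lra). reflexivity. }
  assert (H4 : 0 < / sqrt (2 * PI) <= 1).
  { split; [apply Rinv_0_lt_compat; lra|]. rewrite <- Rinv_1. apply Rinv_le_contravar; lra. }
  rewrite E. split; [nra|]. pose proof (gauss_pos x). nra.
Qed.

Lemma gauss_small eps : 0 < eps -> exists X, 0 < X /\ forall x, X <= x -> gauss x <= eps.
Proof.
  intros He. exists (2 + 2 / eps). assert (0 < 2 / eps) by (apply Rdiv_lt_0_compat; lra).
  split; [lra|]. intros x Hx. unfold gauss.
  replace (- x ^ 2 / 2) with (- (x ^ 2 / 2)) by field. rewrite exp_Ropp.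
  rewrite <- (Rinv_inv eps). apply Rinv_le_contravar; [now apply Rinv_0_lt_compat|].
  apply Rle_trans with (1 + x ^ 2 / 2); [|apply exp_ineq1_le].
  unfold Rdiv in *. nra.
Qed.

Lemma Phi_lim eps : 0 < eps -> exists X, 0 < X /\ forall x, X <= x -> 0 <= 1 - Phi x <= eps.
Proof.
  intros He. destruct (gauss_small (eps / 2)) as [X [HX H]]; [lra|].
  exists X. split; [assumption|]. intros x Hx. specialize (H x Hx).
  pose proof (Phi_gap x ltac:(lra)). lra.
Qed.

Lemma Phi_incr x y : x <= y -> Phi x <= Phi y.
Proof.
  intros [H| ->]; [|lra].
  destruct (mean_value Phi _ x y (fun z _ => is_derive_Phi z)) as [c [_ Hc]].
  assert (0 < / sqrt (2 * PI) * gauss c).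
    { apply Rmult_lt_0_compat; [|apply gauss_pos].
      apply Rinv_0_lt_compat. pose proof sqrt_2PI_ge1. lra. }
  nra.
Qed.

Lemma Phi_bounds x : 0 <= Phi x <= 1.
Proof.
  destruct (Rle_dec 0 x) as [H|H].
  - pose proof (Phi_gap x H). pose proof (Phi_incr 0 x H). pose proof (Phi_opp 0) as E.
    rewrite Ropp_0 in E. lra.
  - pose proof (Phi_gap (- x) ltac:(lra)). pose proof (Phi_incr x 0 ltac:(lra)).
    pose proof (Phi_opp 0) as E. rewrite Ropp_0 in E. pose proof (Phi_opp x). lra.
Qed.

(** As [gauss] is even, truncation at [- M] loses exactly [sqrt (2 * PI) * (1 - Phi M)]. *)
Lemma improper_lower_int_gauss u :
  improper_lower_int gauss u (sqrt (2 * PI) * Phi u).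
Proof.
  intros eps He. pose proof sqrt_2PI_ge1 as Hs.
  destruct (Phi_lim (eps / (2 * sqrt (2 * PI)))) as [X [HX H]].
  { apply Rdiv_lt_0_compat; lra. }
  exists X. intros M HM pr. rewrite <- RInt_Reals.
  rewrite <- (RInt_Chasles (V:=R_CompleteNormedModule) gauss (- M) 0 u) by apply ex_RInt_gauss.
  rewrite <- (opp_RInt_swap (V:=R_CompleteNormedModule) gauss) by apply ex_RInt_gauss.
  fold (gauss_int (- M)) (gauss_int u). rewrite gauss_int_opp.
  unfold plus, opp; simpl. specialize (H M HM).
  replace (- - gauss_int M + gauss_int u - sqrt (2 * PI) * Phi u)
    with (- (sqrt (2 * PI) * (1 - Phi M))).
  - rewrite Rabs_Ropp, Rabs_pos_eq by nra.
    apply Rle_lt_trans with (sqrt (2 * PI) * (eps / (2 * sqrt (2 * PI)))).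
    + apply Rmult_le_compat_l; lra.
    + replace (sqrt (2 * PI) * (eps / (2 * sqrt (2 * PI)))) with (eps / 2) by (field; lra). lra.
  - unfold Phi. field. lra.
Qed.

(** * Derivatives of the Gaussian *)

(* [herm s k x * exp (s * x ^ 2 / 2)] is the [k]-th derivative of [exp (s * x ^ 2 / 2)]:
   up to sign the Hermite polynomials for [s = -1], and their versions with nonnegative
   coefficients for [s = 1]. *)
Fixpoint herm (s : R) (k : nat) (x : R) : R :=
  match k with
  | O => 1
  | S k' => s * (x * herm s k' x +
                 match k' with O => 0 | S k'' => INR k' * herm s k'' x end)
  end.

Lemma herm_SS s k x :
  herm s (S (S k)) x = s * (x * herm s (S k) x + INR (S k) * herm s k x).
Proof. reflexivity. Qed.

(** The Appell property of Hermite polynomials. The recursion has order two, so the induction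
    carries two consecutive indices; [Hlin] differentiates one recursion step. *)
Lemma is_derive_herm s k x : is_derive (herm s (S k)) x (s * INR (S k) * herm s k x).
Proof.
  cut (is_derive (herm s (S k)) x (s * INR (S k) * herm s k x) /\
       is_derive (herm s (S (S k))) x (s * INR (S (S k)) * herm s (S k) x)); [tauto|].
  assert (Hlin : forall f g df dg c, is_derive f x df -> is_derive g x dg ->
    is_derive (fun x => s * (x * f x + c * g x)) x (s * (f x + x * df + c * dg))).
  { intros f g df dg c Hf Hg. evar_last.
    - apply (is_derive_scal (fun x => x * f x + c * g x)).
      apply (is_derive_plus (K:=R_AbsRing) (V:=R_NormedModule)
               (fun x => x * f x) (fun x => c * g x)).
      + apply (is_derive_mult (fun x => x) f); [apply is_derive_id|exact Hf|].
        intros; apply Rmult_comm.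
      + apply (is_derive_scal g). exact Hg.
    - unfold plus, mult, one; simpl. ring. }
  assert (H1 : is_derive (herm s 1) x (s * INR 1 * herm s 0 x)).
  { apply (is_derive_ext (fun x => s * (x * 1 + 0 * 1))).
    - intros t. cbn. eqR. ring.
    - evar_last. apply Hlin; apply is_derive_const. cbn. unfold zero; simpl. ring. }
  induction k as [|k [IH1 IH2]]; (split; [assumption|]).
  - evar_last; [apply (Hlin (herm s 1) (fun _ => 1)); [exact H1|apply is_derive_const]|].
    unfold zero; cbn. ring.
  - evar_last.
    + apply (Hlin (herm s (S (S k))) (herm s (S k))); [exact IH2|exact IH1].
    + rewrite (herm_SS s k). rewrite !S_INR. ring.
Qed.

Definition hexp (s : R) (k : nat) (x : R) : R := herm s k x * exp (s * x ^ 2 / 2).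

Lemma is_derive_hexp s k x : is_derive (hexp s k) x (hexp s (S k) x).
Proof.
  assert (He : is_derive (fun x => exp (s * x ^ 2 / 2)) x (s * x * exp (s * x ^ 2 / 2))).
  { auto_derive; [trivial|]. eqR. simpl. unfold Rdiv. field. }
  assert (Hh : is_derive (herm s k) x
    (match k with O => 0 | S k' => s * INR k * herm s k' x end)).
  { destruct k; [apply (is_derive_const (V:=R_NormedModule) 1)|apply is_derive_herm]. }
  unfold hexp at 1. evar_last.
  - apply (is_derive_mult (herm s k)); [exact Hh|exact He|]. intros; apply Rmult_comm.
  - unfold plus, mult, hexp; simpl. destruct k; cbn [herm]; [simpl; ring|]. ring.
Qed.

Lemma herm_nonneg k x : 0 <= x -> 0 <= herm 1 k x.
Proof.
  intros Hx. cut (0 <= herm 1 k x /\ 0 <= herm 1 (S k) x); [tauto|].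
  induction k as [|k [IH1 IH2]]; [cbn; lra|]. split; [assumption|].
  rewrite herm_SS. pose proof (pos_INR (S k)).
  pose proof (Rmult_le_pos _ _ Hx IH2). pose proof (Rmult_le_pos _ _ H IH1). lra.
Qed.

Lemma herm_abs k x : Rabs (herm (-1) k x) <= herm 1 k (Rabs x).
Proof.
  cut (Rabs (herm (-1) k x) <= herm 1 k (Rabs x) /\
       Rabs (herm (-1) (S k) x) <= herm 1 (S k) (Rabs x)); [tauto|].
  induction k as [|k [IH1 IH2]].
  - cbn. split; [rewrite Rabs_R1; lra|]. rewrite Rmult_1_r, Rplus_0_r.
    rewrite Rabs_mult, Rabs_left by lra. lra.
  - split; [assumption|]. rewrite !herm_SS, Rabs_mult, Rabs_left by lra.
    replace (- -1) with 1 by ring. apply Rmult_le_compat_l; [lra|].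
    eapply Rle_trans; [apply Rabs_triang|]. rewrite !Rabs_mult.
    rewrite (Rabs_pos_eq (INR (S k))) by apply pos_INR.
    apply Rplus_le_compat; apply Rmult_le_compat_l; try assumption; [apply Rabs_pos|apply pos_INR].
Qed.

(** With [r^2 = k + 1] and [A = x + r], the recursion step amounts to [x * A + r^2 <= A^2]. *)
Lemma herm_le_pow k x : 0 <= x -> herm 1 k x <= (x + sqrt (INR k)) ^ k.
Proof.
  intros Hx. cut (herm 1 k x <= (x + sqrt (INR k)) ^ k /\
                  herm 1 (S k) x <= (x + sqrt (INR (S k))) ^ S k); [tauto|].
  induction k as [|k [IH1 IH2]].
  - cbn. rewrite sqrt_1. lra.
  - split; [assumption|]. rewrite herm_SS, Rmult_1_l.
    assert (Hq : sqrt (INR (S k)) * sqrt (INR (S k)) = INR (S k)) by (apply sqrt_sqrt, pos_INR).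
    assert (H0 := sqrt_pos (INR k)).
    assert (H1 : sqrt (INR k) <= sqrt (INR (S k))) by (apply sqrt_le_1_alt, le_INR; lia).
    assert (H2 : sqrt (INR (S k)) <= sqrt (INR (S (S k)))) by (apply sqrt_le_1_alt, le_INR; lia).
    assert (Hn := pos_INR (S k)).
    set (r := sqrt (INR (S k))) in *. set (A := x + r) in *.
    assert (IH1' : herm 1 k x <= A ^ k).
    { eapply Rle_trans; [exact IH1|]. apply pow_incr. unfold A. lra. }
    assert (HA : 0 <= A ^ k) by (apply pow_le; unfold A; lra).
    apply Rle_trans with (A ^ S (S k)); [|apply pow_incr; unfold A; lra].
    replace (A ^ S (S k)) with (A * A * A ^ k) by (simpl; ring).
    apply Rle_trans with (x * A ^ S k + INR (S k) * A ^ k).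
    + apply Rplus_le_compat; apply Rmult_le_compat_l; assumption.
    + replace (x * A ^ S k + INR (S k) * A ^ k) with ((x * A + INR (S k)) * A ^ k) by (simpl; ring).
      apply Rmult_le_compat_r; [assumption|]. rewrite <- Hq. unfold A. nra.
Qed.

Lemma exp_INR_mult n x : exp (INR n * x) = exp x ^ n.
Proof.
  induction n as [|n IH]; [simpl; now rewrite Rmult_0_l, exp_0|].
  rewrite S_INR, Rmult_plus_distr_r, exp_plus, IH, Rmult_1_l. simpl. ring.
Qed.

(** The quotient [k^k / k!] is one term of the exponential series at [k]; the induction uses
    [(1 + 1/k)^k <= exp 1] instead of the series. *)
Lemma pow_self_le_exp_fact k : INR k ^ k <= exp (INR k) * INR (fact k).
Proof.
  induction k as [|k IH]; [simpl; rewrite exp_0; lra|].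
  assert (Hk := pos_INR k).
  assert (H : INR (S k) ^ k <= exp 1 * INR k ^ k).
  { destruct k as [|k']; [simpl; pose proof (exp_ineq1_le 1); lra|].
    set (k := S k') in *. assert (0 < INR k) by (apply lt_0_INR; unfold k; lia).
    replace (exp 1) with (exp (/ INR k) ^ k).
    - rewrite <- Rpow_mult_distr. apply pow_incr. split; [apply pos_INR|].
      rewrite S_INR. pose proof (exp_ineq1_le (/ INR k)).
      apply Rle_trans with ((1 + / INR k) * INR k); [right; field; lra|].
      apply Rmult_le_compat_r; lra.
    - rewrite <- exp_INR_mult. f_equal. field. lra. }
  replace (exp (INR (S k))) with (exp 1 * exp (INR k))
    by (rewrite <- exp_plus, S_INR; f_equal; ring).
  change (fact (S k)) with (S k * fact k)%nat. rewrite mult_INR.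
  cbn [pow]. assert (Hk1 := pos_INR (S k)).
  apply Rle_trans with (INR (S k) * (exp 1 * (exp (INR k) * INR (fact k)))); [|right; ring].
  apply Rmult_le_compat_l; [assumption|]. eapply Rle_trans; [exact H|].
  apply Rmult_le_compat_l; [left; apply exp_pos|assumption].
Qed.

(** The numbers [herm 1 k 1], namely 1, 1, 2, 4, 10, count the involutions of k letters. The
    induction on their recursion rests on [sqrt (k + 2) <= 1 + sqrt (k + 1)]. *)
Lemma sqrt_fact_le_herm k : sqrt (INR (fact k)) <= herm 1 k 1.
Proof.
  cut (sqrt (INR (fact k)) <= herm 1 k 1 /\ sqrt (INR (fact (S k))) <= herm 1 (S k) 1); [tauto|].
  induction k as [|k [IH1 IH2]]; [cbn; rewrite sqrt_1; lra|].
  split; [assumption|]. rewrite herm_SS.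
  change (fact (S (S k))) with (S (S k) * fact (S k))%nat. rewrite mult_INR.
  rewrite sqrt_mult_alt by apply pos_INR.
  assert (E : sqrt (INR (fact (S k))) = sqrt (INR (S k)) * sqrt (INR (fact k))).
  { change (fact (S k)) with (S k * fact k)%nat. rewrite mult_INR.
    apply sqrt_mult_alt, pos_INR. }
  assert (Hs := sqrt_sqrt (INR (S k)) (pos_INR _)).
  assert (Hp := sqrt_pos (INR (S k))). assert (Hp2 := sqrt_pos (INR (fact k))).
  assert (Hle : sqrt (INR (S (S k))) <= 1 + sqrt (INR (S k))).
  { rewrite <- (sqrt_Rsqr (1 + sqrt (INR (S k)))) by lra.
    apply sqrt_le_1_alt. unfold Rsqr. rewrite (S_INR (S k)). nra. }
  assert (H1 := pos_INR (S k)).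
  apply Rle_trans with ((1 + sqrt (INR (S k))) * sqrt (INR (fact (S k)))).
  { apply Rmult_le_compat_r; [apply sqrt_pos|assumption]. }
  replace ((1 + sqrt (INR (S k))) * sqrt (INR (fact (S k)))) with
    (sqrt (INR (fact (S k))) + INR (S k) * sqrt (INR (fact k))).
  - assert (INR (S k) * sqrt (INR (fact k)) <= INR (S k) * herm 1 k 1)
      by (apply Rmult_le_compat_l; assumption). lra.
  - rewrite E at 2. rewrite <- Hs at 1. rewrite Rmult_plus_distr_r, E. ring.
Qed.

(** With [r = sqrt k], [(y + r)^k <= r^k * exp (y * r)]. Completing the square in [y * r - y^2 / 2]
    leaves [r^k * exp (k / 2)], which is at most [exp k * sqrt (k!)]. *)
Lemma hexp_bound k x : Rabs (hexp (-1) k x) <= exp 1 ^ k * herm 1 k 1.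
Proof.
  unfold hexp. rewrite Rabs_mult, (Rabs_pos_eq (exp _)) by (left; apply exp_pos).
  rewrite <- (pow2_abs x). assert (Hx := Rabs_pos x).
  set (y := Rabs x) in *.
  apply Rle_trans with ((y + sqrt (INR k)) ^ k * exp (-1 * y ^ 2 / 2)).
  { apply Rmult_le_compat_r; [left; apply exp_pos|].
    eapply Rle_trans; [apply herm_abs|]. now apply herm_le_pow. }
  destruct k as [|k'].
  { simpl. rewrite !Rmult_1_l. rewrite <- exp_0 at 2. apply exp_le_mono. nra. }
  set (k := S k'). assert (Hk : 0 < INR k) by (apply lt_0_INR; unfold k; lia).
  assert (Hs : 0 < sqrt (INR k)) by now apply sqrt_lt_R0.
  assert (Hq := sqrt_sqrt (INR k) (pos_INR _)).
  set (r := sqrt (INR k)) in *.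
  assert (H1 : (y + r) ^ k <= r ^ k * exp (y * r)).
  { replace (exp (y * r)) with (exp (y / r) ^ k).
    - rewrite <- Rpow_mult_distr. apply pow_incr. split; [lra|].
      pose proof (exp_ineq1_le (y / r)).
      apply Rle_trans with (r * (1 + y / r)); [right; field; lra|].
      apply Rmult_le_compat_l; lra.
    - rewrite <- exp_INR_mult. f_equal. rewrite <- Hq. field. lra. }
  assert (H2 : r ^ k * exp (INR k / 2) <= exp 1 ^ k * herm 1 k 1).
  { apply Rle_trans with (exp 1 ^ k * sqrt (INR (fact k))).
    2:{ apply Rmult_le_compat_l; [apply pow_le; left; apply exp_pos|apply sqrt_fact_le_herm]. }
    assert (E : r ^ k = sqrt (INR k ^ k)).
    { symmetry. apply sqrt_lem_1; [apply pow_le; lra|apply pow_le; lra|].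
      now rewrite <- Rpow_mult_distr, Hq. }
    assert (E2 : exp 1 ^ k = exp (INR k / 2) * exp (INR k / 2)).
    { rewrite <- exp_plus, <- exp_INR_mult. f_equal. field. }
    rewrite E, E2.
    apply Rle_trans with (sqrt (exp (INR k) * INR (fact k)) * exp (INR k / 2)).
    { apply Rmult_le_compat_r; [left; apply exp_pos|].
      apply sqrt_le_1_alt, pow_self_le_exp_fact. }
    rewrite sqrt_mult_alt by (left; apply exp_pos).
    replace (sqrt (exp (INR k))) with (exp (INR k / 2)).
    - right; ring.
    - symmetry. apply sqrt_lem_1; [left; apply exp_pos|left; apply exp_pos|].
      rewrite <- exp_plus. f_equal. field. }
  eapply Rle_trans; [|exact H2].
  apply Rle_trans with (r ^ k * exp (y * r) * exp (-1 * y ^ 2 / 2)).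
  { apply Rmult_le_compat_r; [left; apply exp_pos|assumption]. }
  rewrite Rmult_assoc, <- exp_plus. apply Rmult_le_compat_l; [apply pow_le; lra|].
  apply exp_le_mono. pose proof (pow2_ge_0 (y - r)). simpl in *. lra.
Qed.

Definition Phi_deriv (k : nat) (x : R) : R :=
  match k with O => Phi x | S k' => / sqrt (2 * PI) * hexp (-1) k' x end.

Lemma is_derive_Phi_deriv k x : is_derive (Phi_deriv k) x (Phi_deriv (S k) x).
Proof.
  destruct k as [|k].
  - evar_last; [apply is_derive_Phi|]. cbn. unfold hexp, gauss. cbn [herm].
    rewrite Rmult_1_l. do 3 f_equal. ring.
  - apply (is_derive_scal (hexp (-1) k)). apply is_derive_hexp.
Qed.

Lemma inv_sqrt_2PI_bounds : 0 < / sqrt (2 * PI) <= 1.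
Proof.
  pose proof sqrt_2PI_ge1. split; [apply Rinv_0_lt_compat; lra|].
  rewrite <- Rinv_1. apply Rinv_le_contravar; lra.
Qed.

Lemma exp_1_ge_2 : 2 <= exp 1.
Proof. pose proof (exp_ineq1_le 1). lra. Qed.

Lemma Phi_deriv_bound k x : Rabs (Phi_deriv k x) <= exp 1 ^ k * herm 1 k 1.
Proof.
  destruct k as [|k].
  - cbn. pose proof (Phi_bounds x). rewrite Rabs_pos_eq; lra.
  - cbn [Phi_deriv]. rewrite Rabs_mult. pose proof inv_sqrt_2PI_bounds as [H1 H2].
    rewrite (Rabs_pos_eq (/ _)) by lra.
    apply Rle_trans with (1 * (exp 1 ^ k * herm 1 k 1)).
    + apply Rmult_le_compat; [lra|apply Rabs_pos|assumption|apply hexp_bound].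
    + rewrite Rmult_1_l. assert (H3 : herm 1 k 1 <= herm 1 (S k) 1).
      { destruct k as [|k]; [cbn; lra|]. rewrite (herm_SS 1 k).
        pose proof (pos_INR (S k)). pose proof (herm_nonneg k 1 ltac:(lra)). nra. }
      apply Rmult_le_compat; [apply pow_le; left; apply exp_pos|apply herm_nonneg; lra| |assumption].
      apply Rle_pow; [pose proof exp_1_ge_2; lra|lia].
Qed.

(** * Inclusion-exclusion with Rankin weights *)

(** Carrying all derivatives and their uniform bounds as data makes the class visibly closed under
    the differences taken at each prime. *)
Definition bounded_tower (F : nat -> R -> R) (D : nat -> R) : Prop :=
  forall k x, is_derive (F k) x (F (S k) x) /\ Rabs (F k x) <= D k.

(** A difference costs one derivative and gains a factor [a], by the mean value theorem. Iterated
    over k primes, this bounds the coefficient of their product. *)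
Lemma bounded_tower_diff F D a : 0 <= a -> bounded_tower F D ->
  bounded_tower (fun k x => F k (x + a) - F k x) (fun k => a * D (S k)).
Proof.
  intros Ha H k x. split.
  - apply (is_derive_minus (K:=R_AbsRing) (V:=R_NormedModule) (fun x => F k (x + a)) (F k)).
    + evar_last.
      * apply (is_derive_comp (F k) (fun x => x + a)); [apply H|].
        apply (is_derive_plus (K:=R_AbsRing) (V:=R_NormedModule) (fun x => x) (fun _ => a));
          [apply is_derive_id|apply is_derive_const].
      * unfold scal, plus, one, zero; simpl. unfold mult; simpl. ring.
    + apply H.
  - destruct (mean_value (F k) (F (S k)) x (x + a)) as [c [_ E]]; [intros; apply H|].
    rewrite E, Rabs_mult. replace (x + a - x) with a by ring.
    rewrite (Rabs_pos_eq a) by assumption. rewrite Rmult_comm.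
    apply Rmult_le_compat_l; [assumption|apply H].
Qed.

Definition csum (a : nat -> R) (ps : list nat) (f : R -> R) (n : nat) (w : R) : R :=
  sumf (fun m => f (w + addf a ps m)) (seq 1 n).

(* Expectation of [f (w + sum of a_p X_p)] for independent [X_p] of Bernoulli law [1/p]. *)
Fixpoint model (a : nat -> R) (ps : list nat) (f : R -> R) (w : R) : R :=
  match ps with
  | nil => f w
  | p :: ps => (1 - / INR p) * model a ps f w + / INR p * model a ps f (w + a p)
  end.

Lemma model_diff a ps f t w :
  model a ps (fun x => f (x + t) - f x) w = model a ps f (w + t) - model a ps f w.
Proof.
  revert w. induction ps as [|p ps IH]; intros w; [reflexivity|].
  cbn [model]. rewrite !IH. replace (w + t + a p) with (w + a p + t) by ring. ring.
Qed.

Lemma addf_mul_prime a ps p m : nprime p -> (forall q, In q ps -> nprime q) ->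
  ~ In p ps -> addf a ps (p * m) = addf a ps m.
Proof.
  intros Hp Hps Hn. apply sumf_ext. intros q Hq.
  rewrite dvb_mul_prime; [reflexivity|assumption|now apply Hps|]. intros ->. tauto.
Qed.

(** One step of inclusion-exclusion. A multiple [p * m] carries the extra increment [a p], and the
    other primes do not see the factor [p]; so the correction is a sum of the same kind, of length
    [n / p], for a difference of [f]. *)
Lemma csum_cons a p ps f n w : nprime p -> (forall q, In q ps -> nprime q) -> ~ In p ps ->
  csum a (p :: ps) f n w =
  csum a ps f n w + csum a ps (fun x => f (x + a p) - f x) (n / p) w.
Proof.
  intros Hp Hps Hn. unfold csum.
  transitivity (sumf (fun m => f (w + addf a ps m) +
    if dvb p m then f (w + addf a ps m + a p) - f (w + addf a ps m) else 0) (seq 1 n)).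
  - apply sumf_ext. intros m _. unfold addf at 1. rewrite sumf_cons. fold (addf a ps m).
    destruct (dvb p m).
    + replace (w + (a p + addf a ps m)) with (w + addf a ps m + a p) by ring. ring.
    + rewrite Rplus_0_l. ring.
  - rewrite sumf_plus. f_equal.
    rewrite (sumf_multiples p (fun m => f (w + addf a ps m + a p) - f (w + addf a ps m))).
    + apply sumf_ext. intros m _. now rewrite addf_mul_prime.
    + apply nprime_ge2 in Hp. lia.
Qed.

(** Expanded, this is the sum over the subsets of [ps] of the product of the [b p] in the subset
    times [D] of its cardinality. *)
Fixpoint tower_weight (b : nat -> R) (ps : list nat) (D : nat -> R) : R :=
  match ps with
  | nil => D O
  | p :: ps => tower_weight b ps D + b p * tower_weight b ps (fun k => D (S k))
  end.

Lemma tower_weight_scal b ps c D :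
  tower_weight b ps (fun k => c * D k) = c * tower_weight b ps D.
Proof.
  revert D. induction ps as [|p ps IH]; intros D; [reflexivity|].
  cbn [tower_weight]. rewrite IH, (IH (fun k => D (S k))). ring.
Qed.

Lemma Rpower_pos x y : 0 < Rpower x y.
Proof. apply exp_pos. Qed.

(* Rankin's trick: for [x >= 1] the fractional part is at most [1], while for
   [x < 1] it is [x] itself. *)
Lemma frac_le_Rpower N d eps : (1 <= N)%nat -> (1 <= d)%nat -> 0 <= eps <= 1 ->
  Rabs (INR (N / d) - INR N / INR d) <= Rpower (INR N / INR d) (1 - eps).
Proof.
  intros HN Hd He. pose proof (INR_div_le N d ltac:(lia)) as H1.
  pose proof (INR_div_gt N d ltac:(lia)) as H2.
  assert (Hx : 0 < INR N / INR d) by (apply Rdiv_lt_0_compat; apply lt_0_INR; lia).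
  pose proof (pos_INR (N / d)). set (x := INR N / INR d) in *.
  rewrite Rabs_left1 by lra. unfold Rpower. destruct (Rle_lt_dec 1 x) as [H3|H3].
  - apply Rle_trans with 1; [lra|]. rewrite <- exp_0 at 1. apply exp_le_mono.
    apply Rmult_le_pos; [lra|]. rewrite <- ln_1. apply Rcomplements.ln_le; lra.
  - apply Rle_trans with x; [lra|]. rewrite <- (exp_ln x) at 1 by assumption.
    apply exp_le_mono. assert (ln x <= 0) by (rewrite <- ln_1; apply Rcomplements.ln_le; lra). nra.
Qed.

(** The statement ranges over [d] and over all towers because removing [p] uses the induction
    hypothesis twice: at [d] for [F], and at [d * p] for its difference. Rankin's bound is
    multiplicative in [d], so each chosen prime contributes its own factor [p^(eps - 1)]. *)
Lemma csum_model_error a eps N : (1 <= N)%nat -> 0 <= eps <= 1 -> (forall p, 0 <= a p) ->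
  forall ps, NoDup ps -> (forall q, In q ps -> nprime q) ->
  forall F D, bounded_tower F D -> forall d w, (1 <= d)%nat ->
  Rabs (csum a ps (F O) (N / d) w - INR N / INR d * model a ps (F O) w) <=
  Rpower (INR N / INR d) (1 - eps) *
  tower_weight (fun p => a p * Rpower (INR p) (eps - 1)) ps D.
Proof.
  intros HN He Ha. induction ps as [|p ps IH]; intros Hnd Hps F D HF d w Hd.
  - unfold csum. cbn [model tower_weight]. rewrite (sumf_ext _ (fun _ => F O w)).
    2:{ intros; f_equal. unfold addf; simpl. ring. }
    rewrite sumf_const, length_seq.
    replace (F O w * INR (N / d) - INR N / INR d * F O w)
      with ((INR (N / d) - INR N / INR d) * F O w) by ring.
    rewrite Rabs_mult. apply Rmult_le_compat; try apply Rabs_pos; [now apply frac_le_Rpower|apply HF].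
  - inversion Hnd as [|? ? Hn Hnd']; subst.
    assert (Hp : nprime p) by (apply Hps; simpl; tauto).
    assert (Hps' : forall q, In q ps -> nprime q) by (intros; apply Hps; simpl; tauto).
    pose proof (nprime_ge2 p Hp) as Hp2.
    assert (Hp0 : 0 < INR p) by (apply lt_0_INR; lia).
    assert (Hd0 : 0 < INR d) by (apply lt_0_INR; lia).
    assert (HN0 : 0 < INR N) by (apply lt_0_INR; lia).
    rewrite csum_cons by assumption. cbn [model tower_weight].
    rewrite Nat.Div0.div_div.
    assert (Hdp : (1 <= d * p)%nat) by nia.
    pose proof (IH Hnd' Hps' F D HF d w Hd) as E1.
    pose proof (IH Hnd' Hps' _ _ (bounded_tower_diff F D (a p) (Ha p) HF) (d * p)%nat w
                  Hdp) as E2.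
    cbn beta in E2. rewrite model_diff, mult_INR, (tower_weight_scal _ _ (a p)) in E2.
    assert (E3 : Rpower (INR N / (INR d * INR p)) (1 - eps) =
                 Rpower (INR N / INR d) (1 - eps) * Rpower (INR p) (eps - 1)).
    { unfold Rpower. rewrite <- exp_plus. f_equal.
      replace (INR N / (INR d * INR p)) with (INR N / INR d * / INR p) by (field; lra).
      rewrite ln_mult, ln_Rinv; try assumption; [ring|apply Rdiv_lt_0_compat; assumption|].
      now apply Rinv_0_lt_compat. }
    rewrite E3 in E2.
    match goal with |- Rabs ?e <= _ => replace e with
      ((csum a ps (F O) (N / d) w - INR N / INR d * model a ps (F O) w) +
       (csum a ps (fun x => F O (x + a p) - F O x) (N / (d * p)) w -
        INR N / (INR d * INR p) * (model a ps (F O) (w + a p) - model a ps (F O) w)))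
      by (field; lra) end.
    eapply Rle_trans; [apply Rabs_triang|]. rewrite Rmult_plus_distr_l.
    apply Rplus_le_compat; [exact E1|]. eapply Rle_trans; [exact E2|]. right; ring.
Qed.

Lemma hexp_nonneg k x : 0 <= x -> 0 <= hexp 1 k x.
Proof.
  intros H. apply Rmult_le_pos; [now apply herm_nonneg|left; apply exp_pos].
Qed.

Lemma hexp_incr k x y : 0 <= x <= y -> hexp 1 k x <= hexp 1 k y.
Proof.
  intros H. destruct (mean_value (hexp 1 k) (hexp 1 (S k)) x y) as [c [Hc E]].
  { intros; apply is_derive_hexp. }
  rewrite Rmin_left, Rmax_right in Hc by lra.
  pose proof (hexp_nonneg (S k) c ltac:(lra)). nra.
Qed.

Lemma hexp_tangent k x h : 0 <= x -> 0 <= h ->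
  hexp 1 k x + h * hexp 1 (S k) x <= hexp 1 k (x + h).
Proof.
  intros Hx Hh. destruct (mean_value (hexp 1 k) (hexp 1 (S k)) x (x + h)) as [c [Hc E]].
  { intros; apply is_derive_hexp. }
  rewrite Rmin_left, Rmax_right in Hc by lra.
  pose proof (hexp_incr (S k) x c ltac:(lra)). nra.
Qed.

(* Since [hexp 1 j] is absolutely monotone, its tangent inequality at [t] absorbs
   the recursion of [tower_weight] one prime at a time. *)
Lemma tower_weight_bound b ps A lam t j D : (forall p, In p ps -> 0 <= b p) ->
  0 <= A -> 0 <= lam -> 0 <= t ->
  (forall k, D k <= A * lam ^ k * hexp 1 (k + j) t) ->
  tower_weight b ps D <= A * hexp 1 j (t + lam * sumf b ps).
Proof.
  intros Hb. revert A j D. induction ps as [|p ps IH]; intros A j D HA Hl Ht HD.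
  - cbn. rewrite Rmult_0_r, Rplus_0_r. specialize (HD O). simpl in HD. lra.
  - cbn [tower_weight]. rewrite sumf_cons.
    assert (Hb' : forall q, In q ps -> 0 <= b q) by (intros; apply Hb; simpl; tauto).
    pose proof (IH Hb' A j D HA Hl Ht HD) as E1.
    assert (E2 : tower_weight b ps (fun k => D (S k)) <=
                 (A * lam) * hexp 1 (S j) (t + lam * sumf b ps)).
    { apply IH; try assumption; [now apply Rmult_le_pos|]. intros k.
      eapply Rle_trans; [apply HD|]. replace (S k + j)%nat with (k + S j)%nat by lia.
      simpl. right; ring. }
    assert (Hs : 0 <= sumf b ps) by now apply sumf_nonneg.
    assert (Hbp : 0 <= b p) by (apply Hb; simpl; tauto).
    assert (Hx : 0 <= t + lam * sumf b ps).
    { apply Rplus_le_le_0_compat; [assumption|now apply Rmult_le_pos]. }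
    pose proof (hexp_tangent j _ (lam * b p) Hx ltac:(now apply Rmult_le_pos)) as E3.
    replace (t + lam * (b p + sumf b ps)) with (t + lam * sumf b ps + lam * b p) by ring.
    apply Rle_trans with (A * (hexp 1 j (t + lam * sumf b ps) +
                               lam * b p * hexp 1 (S j) (t + lam * sumf b ps))).
    + assert (E4 := Rmult_le_compat_l _ _ _ Hbp E2). lra.
    + apply Rmult_le_compat_l; assumption.
Qed.

Definition Phi_tower (c d : R) (k : nat) (w : R) : R := c ^ k * Phi_deriv k (c * w + d).

Lemma Phi_tower_bounded c d :
  bounded_tower (Phi_tower c d) (fun k => (Rabs c * exp 1) ^ k * herm 1 k 1).
Proof.
  intros k x. split.
  - unfold Phi_tower. evar_last.
    + apply (is_derive_scal (fun w => Phi_deriv k (c * w + d))).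
      apply (is_derive_comp (Phi_deriv k) (fun w => c * w + d)); [apply is_derive_Phi_deriv|].
      apply (is_derive_plus (K:=R_AbsRing) (V:=R_NormedModule) (fun w => c * w) (fun _ => d));
        [|apply is_derive_const].
      apply (is_derive_scal (fun w => w)). apply is_derive_id.
    + unfold scal, plus, one, zero; simpl. unfold mult; simpl. ring.
  - unfold Phi_tower. rewrite Rabs_mult, <- RPow_abs, Rpow_mult_distr, Rmult_assoc.
    apply Rmult_le_compat_l; [apply pow_le, Rabs_pos|apply Phi_deriv_bound].
Qed.

(** The bounds of the tower are dominated by the derivatives of [exp (x^2 / 2)] at 1, hence the
    square in the exponent: the sum over subsets moves the argument from 1 to 1 plus the weighted
    sum. *)
Lemma csum_Phi_error a c d eps N ps w : (1 <= N)%nat -> 0 <= eps <= 1 ->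
  (forall p, 0 <= a p) -> NoDup ps -> (forall q, In q ps -> nprime q) ->
  Rabs (csum a ps (Phi_tower c d O) N w - INR N * model a ps (Phi_tower c d O) w) <=
  Rpower (INR N) (1 - eps) *
  exp ((1 + Rabs c * exp 1 *
        sumf (fun p => a p * Rpower (INR p) (eps - 1)) ps) ^ 2 / 2).
Proof.
  intros HN He Ha Hnd Hps.
  pose proof (csum_model_error a eps N HN He Ha ps Hnd Hps _ _ (Phi_tower_bounded c d) 1%nat w
                (le_n _)) as H.
  rewrite Nat.div_1_r in H. simpl (INR 1) in H.
  replace (INR N / 1) with (INR N) in H by field.
  eapply Rle_trans; [exact H|]. apply Rmult_le_compat_l; [left; apply Rpower_pos|].
  eapply Rle_trans.
  - apply (tower_weight_bound _ ps 1 (Rabs c * exp 1) 1 0); try lra.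
    + intros p _. apply Rmult_le_pos; [apply Ha|left; apply Rpower_pos].
    + apply Rmult_le_pos; [apply Rabs_pos|left; apply exp_pos].
    + intros k. rewrite Rmult_1_l. apply Rmult_le_compat_l.
      * apply pow_le, Rmult_le_pos; [apply Rabs_pos|left; apply exp_pos].
      * rewrite Nat.add_0_r. unfold hexp. rewrite <- (Rmult_1_r (herm 1 k 1)) at 1.
        apply Rmult_le_compat_l; [apply herm_nonneg; lra|].
        rewrite <- exp_0 at 1. apply exp_le_mono. lra.
  - unfold hexp. cbn [herm]. rewrite !Rmult_1_l. apply Rle_refl.
Qed.

(** * The independent model and the heat flow *)

Lemma derive_bound_increment (r r' : R -> R) K h : r 0 = 0 ->
  (forall t, is_derive r t (r' t)) -> (forall t, Rabs t <= Rabs h -> Rabs (r' t) <= K) ->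
  forall t, Rabs t <= Rabs h -> Rabs (r t) <= K * Rabs h.
Proof.
  intros H0 Hd HK t Ht.
  destruct (mean_value r r' 0 t) as [c [Hc E]]; [intros; apply Hd|].
  rewrite H0, !Rminus_0_r in E. rewrite E, Rabs_mult.
  assert (Hc' : Rabs c <= Rabs t).
  { unfold Rmin, Rmax in Hc. destruct (Rle_dec 0 t).
    - rewrite !Rabs_pos_eq; lra.
    - rewrite !Rabs_left1; lra. }
  apply Rmult_le_compat; try apply Rabs_pos; [|assumption]. apply HK. lra.
Qed.

(** The bound on the third derivative is integrated three times; the factor 1/6 is given away. *)
Lemma taylor2_bound F D x h : bounded_tower F D ->
  Rabs (F O (x + h) - F O x - h * F 1%nat x - h ^ 2 / 2 * F 2%nat x) <= D 3%nat * Rabs h ^ 3.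
Proof.
  intros H.
  assert (Hsh : forall k t, is_derive (fun t => F k (x + t)) t (F (S k) (x + t))).
  { intros k t. evar_last.
    - apply (is_derive_comp (F k) (fun t => x + t)); [apply H|].
      apply (is_derive_plus (K:=R_AbsRing) (V:=R_NormedModule) (fun _ => x) (fun t => t));
        [apply is_derive_const|apply is_derive_id].
    - unfold scal, plus, one, zero; simpl. unfold mult; simpl. ring. }
  assert (Hr2 : forall t, Rabs t <= Rabs h ->
    Rabs (F 2%nat (x + t) - F 2%nat x) <= D 3%nat * Rabs h).
  { apply (derive_bound_increment (fun t => F 2%nat (x + t) - F 2%nat x)
             (fun t => F 3%nat (x + t))).
    - rewrite Rplus_0_r. ring.
    - intros t. evar_last.
      + apply (is_derive_minus (K:=R_AbsRing) (V:=R_NormedModule)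
                 (fun t => F 2%nat (x + t)) (fun _ => F 2%nat x)); [apply Hsh|apply is_derive_const].
      + unfold minus, plus, opp, zero; simpl. ring.
    - intros t _. apply H. }
  assert (Hr1 : forall t, Rabs t <= Rabs h ->
    Rabs (F 1%nat (x + t) - F 1%nat x - t * F 2%nat x) <= D 3%nat * Rabs h * Rabs h).
  { apply (derive_bound_increment (fun t => F 1%nat (x + t) - F 1%nat x - t * F 2%nat x)
             (fun t => F 2%nat (x + t) - F 2%nat x)); [rewrite Rplus_0_r; ring| |exact Hr2].
    intros t. evar_last.
    - apply (is_derive_minus (K:=R_AbsRing) (V:=R_NormedModule)
               (fun t => F 1%nat (x + t) - F 1%nat x) (fun t => t * F 2%nat x)).
      + apply (is_derive_minus (K:=R_AbsRing) (V:=R_NormedModule)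
                 (fun t => F 1%nat (x + t)) (fun _ => F 1%nat x)); [apply Hsh|apply is_derive_const].
      + apply (is_derive_scal_l (K:=R_AbsRing) (V:=R_NormedModule) (fun t => t)). apply is_derive_id.
    - unfold minus, plus, opp, zero, scal, one; simpl. unfold mult; simpl. ring. }
  replace (D 3%nat * Rabs h ^ 3) with (D 3%nat * Rabs h * Rabs h * Rabs h) by ring.
  refine (derive_bound_increment
    (fun t => F O (x + t) - F O x - t * F 1%nat x - t ^ 2 / 2 * F 2%nat x)
    (fun t => F 1%nat (x + t) - F 1%nat x - t * F 2%nat x) _ h _ _ Hr1 h (Rle_refl _)).
  - rewrite Rplus_0_r. field.
  - intros t. evar_last.
    + apply (is_derive_minus (K:=R_AbsRing) (V:=R_NormedModule)
               (fun t => F O (x + t) - F O x - t * F 1%nat x) (fun t => t ^ 2 / 2 * F 2%nat x)).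
      * apply (is_derive_minus (K:=R_AbsRing) (V:=R_NormedModule)
                 (fun t => F O (x + t) - F O x) (fun t => t * F 1%nat x)).
        -- apply (is_derive_minus (K:=R_AbsRing) (V:=R_NormedModule)
                    (fun t => F O (x + t)) (fun _ => F O x)); [apply Hsh|apply is_derive_const].
        -- apply (is_derive_scal_l (K:=R_AbsRing) (V:=R_NormedModule) (fun t => t)). apply is_derive_id.
      * apply (is_derive_scal_l (K:=R_AbsRing) (V:=R_NormedModule) (fun t => t ^ 2 / 2) t t).
        auto_derive; [trivial|]. eqR. field.
    + unfold minus, plus, opp, zero, scal, one; simpl. unfold mult; simpl. ring.
Qed.

(* [heat u v] is the solution of [d/dv = (1/2) d^2/dw^2] with initial value
   the indicator of [w < u]. *)
Definition heat (u v w : R) : R := Phi_tower (- / sqrt v) (u / sqrt v) O w.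

Lemma heat_eq u v w : 0 < v -> heat u v w = Phi ((u - w) / sqrt v).
Proof.
  intros Hv. apply sqrt_lt_R0 in Hv. unfold heat, Phi_tower, Phi_deriv.
  simpl. rewrite Rmult_1_l. f_equal. field. lra.
Qed.

Lemma is_derive_scaled_arg k y v : 0 < v ->
  is_derive (fun v => Phi_deriv k (y / sqrt v)) v
    (- (y / sqrt v) / (2 * v) * Phi_deriv (S k) (y / sqrt v)).
Proof.
  intros Hv. pose proof (sqrt_lt_R0 v Hv) as Hs. evar_last.
  - apply (is_derive_comp (Phi_deriv k) (fun v => y / sqrt v)); [apply is_derive_Phi_deriv|].
    auto_derive; [split; [lra|split; [lra|trivial]]|reflexivity].
  - unfold scal; simpl. unfold mult; simpl.
    match goal with |- ?a * ?b = ?c * ?b => cut (a = c); [intros ->; reflexivity|] end.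
    rewrite (sqrt_sqrt v) by lra. field. lra.
Qed.

Lemma Phi_deriv_2 z : Phi_deriv 2 z = - z * Phi_deriv 1 z.
Proof. cbn [Phi_deriv]. unfold hexp. cbn [herm]. ring. Qed.

Lemma Phi_deriv_4 z : Phi_deriv 4 z = - z * Phi_deriv 3 z - 2 * Phi_deriv 2 z.
Proof. cbn [Phi_deriv]. unfold hexp. cbn [herm]. simpl INR. ring. Qed.

Lemma is_derive_heat_var y v : 0 < v ->
  is_derive (fun v => Phi (y / sqrt v)) v (/ 2 * (Phi_deriv 2 (y / sqrt v) / v)).
Proof.
  intros Hv. evar_last; [apply (is_derive_scaled_arg O y v Hv)|].
  rewrite Phi_deriv_2. eqR. field. split; [|lra].
  pose proof (sqrt_lt_R0 v Hv). lra.
Qed.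

(** The function differentiated is the second space derivative of the heat solution, so this is the
    heat equation once more; the recursion [Phi_deriv_4] makes the terms match. *)
Lemma is_derive_heat_var2 y v : 0 < v ->
  is_derive (fun v => Phi_deriv 2 (y / sqrt v) / v) v (/ 2 * (Phi_deriv 4 (y / sqrt v) / v ^ 2)).
Proof.
  intros Hv. pose proof (sqrt_lt_R0 v Hv) as Hs. evar_last.
  - apply (is_derive_div (fun v => Phi_deriv 2 (y / sqrt v)) (fun v => v));
      [apply (is_derive_scaled_arg 2 y v Hv)|apply is_derive_id|lra].
  - rewrite Phi_deriv_4. unfold one; simpl. eqR. pose proof sqrt_2PI_ge1. field. repeat split; lra.
Qed.

Definition Phi_deriv_sup (k : nat) : R := exp 1 ^ k * herm 1 k 1.

Lemma Phi_deriv_sup_pos k : 0 < Phi_deriv_sup k.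
Proof.
  apply Rmult_lt_0_compat; [apply pow_lt, exp_pos|].
  eapply Rlt_le_trans; [|apply sqrt_fact_le_herm]. apply sqrt_lt_R0, INR_fact_lt_0.
Qed.

(** The heat equation turns the derivative in [v] into half the second derivative in [w]. Two uses
    of the mean value theorem in [v] leave a fourth derivative, bounded because the time stays above
    [v0]. *)
Lemma heat_expansion u v0 v h w : 0 < v0 -> v0 <= v -> 0 <= h ->
  Rabs (heat u (v + h) w - heat u v w - h / 2 * Phi_tower (- / sqrt v) (u / sqrt v) 2 w)
  <= Phi_deriv_sup 4 / v0 ^ 2 * h ^ 2.
Proof.
  intros Hv0 Hv Hh. rewrite !heat_eq by lra.
  pose proof (sqrt_lt_R0 v ltac:(lra)) as Hs.
  assert (E2 : Phi_tower (- / sqrt v) (u / sqrt v) 2 w = Phi_deriv 2 ((u - w) / sqrt v) / v).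
  { unfold Phi_tower. replace (- / sqrt v * w + u / sqrt v) with ((u - w) / sqrt v) by (field; lra).
    replace ((- / sqrt v) ^ 2) with (/ v); [unfold Rdiv; ring|].
    rewrite <- (sqrt_sqrt v) at 1 by lra. field. lra. }
  rewrite E2. set (y := u - w).
  destruct (mean_value (fun v => Phi (y / sqrt v))
    (fun v => / 2 * (Phi_deriv 2 (y / sqrt v) / v)) v (v + h)) as [c [Hc Ec]].
  { intros x Hx. rewrite Rmin_left in Hx by lra. apply is_derive_heat_var. lra. }
  rewrite Rmin_left, Rmax_right in Hc by lra.
  destruct (mean_value (fun v => Phi_deriv 2 (y / sqrt v) / v)
    (fun v => / 2 * (Phi_deriv 4 (y / sqrt v) / v ^ 2)) v c) as [d [Hd Ed]].
  { intros x Hx. rewrite Rmin_left in Hx by lra. apply is_derive_heat_var2. lra. }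
  rewrite Rmin_left, Rmax_right in Hd by lra.
  cbn beta in Ec, Ed. rewrite Ec.
  replace (/ 2 * (Phi_deriv 2 (y / sqrt c) / c) * (v + h - v) -
           h / 2 * (Phi_deriv 2 (y / sqrt v) / v))
    with (h / 2 * (Phi_deriv 2 (y / sqrt c) / c - Phi_deriv 2 (y / sqrt v) / v)) by lra.
  rewrite Ed.
  replace (h / 2 * (/ 2 * (Phi_deriv 4 (y / sqrt d) / d ^ 2) * (c - v)))
    with (Phi_deriv 4 (y / sqrt d) * (/ d ^ 2 * (h * (c - v) / 4))) by (field; lra).
  rewrite Rabs_mult.
  replace (Phi_deriv_sup 4 / v0 ^ 2 * h ^ 2) with (Phi_deriv_sup 4 * (/ v0 ^ 2 * h ^ 2))
    by (unfold Rdiv; ring).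
  assert (Hinv : 0 < / d ^ 2 <= / v0 ^ 2).
  { split; [apply Rinv_0_lt_compat; nra|]. apply Rinv_le_contravar; nra. }
  apply Rmult_le_compat; [apply Rabs_pos|apply Rabs_pos|apply Phi_deriv_bound|].
  assert (Hhc : 0 <= h * (c - v) / 4 <= h ^ 2) by nra.
  rewrite Rabs_pos_eq by (apply Rmult_le_pos; lra).
  apply Rmult_le_compat; lra.
Qed.

Lemma heat_lipschitz u v0 : 0 < v0 -> exists C, 0 < C /\
  forall v v' w w', v0 <= v -> v0 <= v' ->
  Rabs (heat u v w - heat u v' w') <= C * (Rabs (v - v') + Rabs (w - w')).
Proof.
  intros Hv0. pose proof (sqrt_lt_R0 v0 Hv0) as Hs0.
  pose proof (Phi_deriv_sup_pos 1) as B1. pose proof (Phi_deriv_sup_pos 2) as B2.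
  assert (Hi1 : 0 < / v0) by now apply Rinv_0_lt_compat.
  assert (Hi2 : 0 < / sqrt v0) by now apply Rinv_0_lt_compat.
  exists (Phi_deriv_sup 2 * / v0 + Phi_deriv_sup 1 * / sqrt v0).
  assert (P1 : 0 < Phi_deriv_sup 2 * / v0) by (apply Rmult_lt_0_compat; lra).
  assert (P2 : 0 < Phi_deriv_sup 1 * / sqrt v0) by (apply Rmult_lt_0_compat; lra).
  split; [lra|]. intros v v' w w' Hv Hv'.
  assert (E1 : Rabs (heat u v w - heat u v' w) <= Phi_deriv_sup 2 * / v0 * Rabs (v - v')).
  { rewrite !heat_eq by lra.
    destruct (mean_value (fun v => Phi ((u - w) / sqrt v))
      (fun v => / 2 * (Phi_deriv 2 ((u - w) / sqrt v) / v)) v' v) as [c [Hc Ec]].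
    { intros x Hx. apply is_derive_heat_var.
      pose proof (Rmin_glb v' v v0 Hv' Hv). lra. }
    cbn beta in Ec. rewrite Ec, Rabs_mult.
    apply Rmult_le_compat_r; [apply Rabs_pos|].
    assert (Hc0 : v0 <= c) by (pose proof (Rmin_glb v' v v0 Hv' Hv); lra).
    replace (/ 2 * (Phi_deriv 2 ((u - w) / sqrt c) / c))
      with (Phi_deriv 2 ((u - w) / sqrt c) * (/ 2 * / c)) by (unfold Rdiv; ring).
    rewrite Rabs_mult. apply Rmult_le_compat; try apply Rabs_pos; [apply Phi_deriv_bound|].
    assert (0 < / c <= / v0).
    { split; [apply Rinv_0_lt_compat; lra|apply Rinv_le_contravar; lra]. }
    rewrite Rabs_pos_eq; lra. }
  assert (E2 : Rabs (heat u v' w - heat u v' w') <= Phi_deriv_sup 1 * / sqrt v0 * Rabs (w - w')).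
  { destruct (mean_value (Phi_tower (- / sqrt v') (u / sqrt v') 0)
      (Phi_tower (- / sqrt v') (u / sqrt v') 1) w' w) as [c [Hc Ec]].
    { intros x _. apply (Phi_tower_bounded _ _ O x). }
    unfold heat. rewrite Ec, Rabs_mult. apply Rmult_le_compat_r; [apply Rabs_pos|].
    unfold Phi_tower. rewrite Rabs_mult, Rmult_comm.
    apply Rmult_le_compat; try apply Rabs_pos; [apply Phi_deriv_bound|].
    rewrite pow_1, Rabs_Ropp.
    assert (sqrt v0 <= sqrt v') by (apply sqrt_le_1_alt; lra).
    rewrite Rabs_pos_eq by (left; apply Rinv_0_lt_compat; lra).
    apply Rinv_le_contravar; lra. }
  replace (heat u v w - heat u v' w') with
    ((heat u v w - heat u v' w) + (heat u v' w - heat u v' w')) by ring.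
  eapply Rle_trans; [apply Rabs_triang|].
  pose proof (Rabs_pos (v - v')). pose proof (Rabs_pos (w - w')). nra.
Qed.

(** Expanded around the mean [w + a * q], the first-order terms cancel and the second-order terms
    give half the variance times the second derivative, as does the heat flow run for a time equal
    to the variance. The squared time step is of third order in [a] because [a <= 1]. *)
Lemma lindeberg_step u v0 : 0 < v0 -> exists C, 0 <= C /\
  forall v w a q, v0 <= v -> 0 <= a <= 1 -> 0 < q <= 1 ->
  Rabs ((1 - q) * heat u v w + q * heat u v (w + a) -
        heat u (v + a ^ 2 * q * (1 - q)) (w + a * q)) <= C * (a ^ 3 * q).
Proof.
  intros Hv0. pose proof (sqrt_lt_R0 v0 Hv0) as Hs0.
  set (D3 := (/ sqrt v0) ^ 3 * Phi_deriv_sup 3).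
  set (D4 := Phi_deriv_sup 4 / v0 ^ 2).
  assert (HD3 : 0 <= D3).
  { apply Rmult_le_pos; [|left; apply Phi_deriv_sup_pos]. apply pow_le. left.
    now apply Rinv_0_lt_compat. }
  assert (HD4 : 0 <= D4).
  { apply Rcomplements.Rdiv_le_0_compat; [left; apply Phi_deriv_sup_pos|nra]. }
  exists (2 * D3 + D4). split; [lra|]. intros v w a q Hv Ha Hq.
  pose proof (sqrt_lt_R0 v ltac:(lra)) as Hs.
  set (F := Phi_tower (- / sqrt v) (u / sqrt v)).
  set (w0 := w + a * q).
  assert (HF : forall t, Rabs (F O (w0 + t) - F O w0 - t * F 1%nat w0 - t ^ 2 / 2 * F 2%nat w0)
                         <= D3 * Rabs t ^ 3).
  { intros t. eapply Rle_trans; [apply (taylor2_bound F _ w0 t (Phi_tower_bounded _ _))|].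
    apply Rmult_le_compat_r; [apply pow_le, Rabs_pos|].
    rewrite Rpow_mult_distr, Rmult_assoc. unfold D3, Phi_deriv_sup.
    apply Rmult_le_compat_r; [left; apply (Phi_deriv_sup_pos 3)|].
    apply pow_incr. split; [apply Rabs_pos|]. rewrite Rabs_Ropp, Rabs_pos_eq.
    - apply Rinv_le_contravar; [assumption|]. apply sqrt_le_1_alt. lra.
    - left. now apply Rinv_0_lt_compat. }
  assert (T1 := HF (- (a * q))). assert (T2 := HF (a * (1 - q))).
  replace (w0 + - (a * q)) with w in T1 by (unfold w0; ring).
  replace (w0 + a * (1 - q)) with (w + a) in T2 by (unfold w0; ring).
  rewrite Rabs_Ropp, (Rabs_pos_eq (a * q)) in T1 by nra.
  rewrite (Rabs_pos_eq (a * (1 - q))) in T2 by nra.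
  set (h := a ^ 2 * q * (1 - q)).
  assert (Hh : 0 <= h) by (unfold h; apply Rmult_le_pos; [apply Rmult_le_pos|]; nra).
  assert (T3 := heat_expansion u v0 v h w0 Hv0 Hv Hh). fold D4 in T3. fold F in T3.
  change (heat u v) with (F O) in *.
  set (A := F O w) in *. set (B := F O (w + a)) in *. set (E := heat u (v + h) w0) in *.
  set (f0 := F O w0) in *. set (f1 := F 1%nat w0) in *. set (f2 := F 2%nat w0) in *.
  replace ((1 - q) * A + q * B - E) with
    ((1 - q) * (A - f0 - - (a * q) * f1 - (- (a * q)) ^ 2 / 2 * f2) +
     q * (B - f0 - a * (1 - q) * f1 - (a * (1 - q)) ^ 2 / 2 * f2) -
     (E - f0 - h / 2 * f2)) by (unfold h; field).
  assert (Ha3 : 0 <= a ^ 3) by (apply pow_le; lra).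
  assert (S1 : (1 - q) * (D3 * (a * q) ^ 3) <= D3 * (a ^ 3 * q)).
  { replace ((1 - q) * (D3 * (a * q) ^ 3)) with (D3 * (a ^ 3 * ((1 - q) * q ^ 3))) by ring.
    apply Rmult_le_compat_l; [assumption|]. apply Rmult_le_compat_l; [assumption|].
    assert (0 <= q * q <= 1) by nra. replace (q ^ 3) with (q * (q * q)) by ring. nra. }
  assert (S2 : q * (D3 * (a * (1 - q)) ^ 3) <= D3 * (a ^ 3 * q)).
  { replace (q * (D3 * (a * (1 - q)) ^ 3)) with (D3 * (a ^ 3 * (q * (1 - q) ^ 3))) by ring.
    apply Rmult_le_compat_l; [assumption|]. apply Rmult_le_compat_l; [assumption|].
    assert (0 <= (1 - q) ^ 3 <= 1).
    { split; [apply pow_le; lra|]. rewrite <- (pow1 3). apply pow_incr. lra. }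
    nra. }
  assert (S3 : D4 * h ^ 2 <= D4 * (a ^ 3 * q)).
  { apply Rmult_le_compat_l; [assumption|]. unfold h.
    replace ((a ^ 2 * q * (1 - q)) ^ 2) with (a ^ 3 * q * (a * (q * (1 - q) ^ 2))) by ring.
    rewrite <- (Rmult_1_r (a ^ 3 * q)) at 2.
    apply Rmult_le_compat_l; [apply Rmult_le_pos; lra|].
    assert (0 <= (1 - q) ^ 2 <= 1) by nra.
    assert (0 <= q * (1 - q) ^ 2 <= 1) by nra. nra. }
  set (X1 := A - f0 - - (a * q) * f1 - (- (a * q)) ^ 2 / 2 * f2) in *.
  set (X2 := B - f0 - a * (1 - q) * f1 - (a * (1 - q)) ^ 2 / 2 * f2) in *.
  set (X3 := E - f0 - h / 2 * f2) in *.
  assert (U : Rabs ((1 - q) * X1 + q * X2 - X3) <= (1 - q) * Rabs X1 + q * Rabs X2 + Rabs X3).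
  { unfold Rminus at 1. eapply Rle_trans; [apply Rabs_triang|]. rewrite Rabs_Ropp.
    apply Rplus_le_compat_r. eapply Rle_trans; [apply Rabs_triang|].
    rewrite !Rabs_mult, (Rabs_pos_eq (1 - q)), (Rabs_pos_eq q) by lra. lra. }
  assert (U1 : (1 - q) * Rabs X1 <= (1 - q) * (D3 * (a * q) ^ 3)) by (apply Rmult_le_compat_l; lra).
  assert (U2 : q * Rabs X2 <= q * (D3 * (a * (1 - q)) ^ 3)) by (apply Rmult_le_compat_l; lra).
  lra.
Qed.

Definition var_weight (a : nat -> R) (p : nat) : R := a p ^ 2 * / INR p * (1 - / INR p).

Lemma inv_prime_bounds p : nprime p -> 0 < / INR p <= / 2.
Proof.
  intros Hp. apply nprime_ge2 in Hp. apply le_INR in Hp. simpl in Hp.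
  split; [apply Rinv_0_lt_compat; lra|apply Rinv_le_contravar; lra].
Qed.

(** Averaging over one prime does not enlarge an error, so the errors of the single replacements add
    up. Their constant is uniform because the time never falls below [v0]. *)
Lemma model_heat u v0 : 0 < v0 -> exists C, 0 <= C /\
  forall a ps, (forall p, In p ps -> nprime p /\ 0 <= a p <= 1) ->
  forall v w, v0 <= v ->
  Rabs (model a ps (heat u v) w -
        heat u (v + sumf (var_weight a) ps) (w + sumf (fun p => a p * / INR p) ps))
  <= C * sumf (fun p => a p ^ 3 * / INR p) ps.
Proof.
  intros Hv0. destruct (lindeberg_step u v0 Hv0) as [C [HC Hst]]. exists C. split; [assumption|].
  intros a ps. induction ps as [|p ps IH]; intros Hps v w Hv.
  - cbn. rewrite !Rplus_0_r, Rminus_diag, Rabs_R0. lra.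
  - cbn [model]. rewrite !sumf_cons.
    assert (Hps' : forall q, In q ps -> nprime q /\ 0 <= a q <= 1) by (intros; apply Hps; simpl; tauto).
    destruct (Hps p) as [Hp Hap]; [simpl; tauto|].
    pose proof (inv_prime_bounds p Hp) as Hq. set (q := / INR p) in *.
    set (V := sumf (var_weight a) ps) in *. set (m := sumf (fun p => a p * / INR p) ps) in *.
    assert (HV : 0 <= V).
    { apply sumf_nonneg. intros r Hr. destruct (Hps' r Hr) as [Hr1 Hr2].
      pose proof (inv_prime_bounds r Hr1). unfold var_weight.
      apply Rmult_le_pos; [apply Rmult_le_pos|]; nra. }
    pose proof (IH Hps' v w Hv) as I1. pose proof (IH Hps' v (w + a p) Hv) as I2.
    pose proof (Hst (v + V) (w + m) (a p) q ltac:(lra) Hap ltac:(lra)) as I3.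
    replace (v + (var_weight a p + V)) with (v + V + a p ^ 2 * q * (1 - q))
      by (unfold var_weight; fold q; ring).
    replace (w + (a p * q + m)) with (w + m + a p * q) by ring.
    replace (w + a p + m) with (w + m + a p) in I2 by ring.
    set (M1 := model a ps (heat u v) w) in *. set (M2 := model a ps (heat u v) (w + a p)) in *.
    set (H1 := heat u (v + V) (w + m)) in *. set (H2 := heat u (v + V) (w + m + a p)) in *.
    set (H3 := heat u (v + V + a p ^ 2 * q * (1 - q)) (w + m + a p * q)) in *.
    replace ((1 - q) * M1 + q * M2 - H3) with
      ((1 - q) * (M1 - H1) + q * (M2 - H2) + ((1 - q) * H1 + q * H2 - H3)) by ring.
    eapply Rle_trans; [apply Rabs_triang|]. rewrite Rmult_plus_distr_l, Rplus_comm.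
    apply Rplus_le_compat; [exact I3|].
    eapply Rle_trans; [apply Rabs_triang|].
    rewrite !Rabs_mult, (Rabs_pos_eq (1 - q)), (Rabs_pos_eq q) by lra.
    set (T := C * sumf (fun p => a p ^ 3 * / INR p) ps) in *.
    assert ((1 - q) * Rabs (M1 - H1) <= (1 - q) * T) by (apply Rmult_le_compat_l; lra).
    assert (q * Rabs (M2 - H2) <= q * T) by (apply Rmult_le_compat_l; lra).
    lra.
Qed.

(** * The limit theorem for normalized additive functions *)

Lemma fl_spec x : 0 <= x -> INR (fl x) <= x < INR (fl x) + 1.
Proof.
  intros Hx. unfold fl. pose proof (base_Int_part x) as [H1 H2].
  assert (H0 : (0 <= Int_part x)%Z).
  { assert (-1 < Int_part x)%Z by (apply lt_IZR; lra). lia. }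
  rewrite INR_IZR_INZ, Z2Nat.id by assumption. lra.
Qed.

(** The primes in [qs] add a nonnegative amount, so its average is its mean absolute value and a
    first moment suffices. *)
Lemma csum_app_lipschitz a ps qs f N w K :
  (forall x y, Rabs (f x - f y) <= K * Rabs (x - y)) ->
  (forall p, In p qs -> (0 < p)%nat) -> (forall p, 0 <= a p) -> 0 <= K ->
  Rabs (csum a (ps ++ qs) f N w - csum a ps f N w) <=
  K * (INR N * sumf (fun p => a p / INR p) qs).
Proof.
  intros Hf Hq Ha HK. unfold csum.
  replace (sumf (fun m => f (w + addf a (ps ++ qs) m)) (seq 1 N) -
           sumf (fun m => f (w + addf a ps m)) (seq 1 N))
    with (sumf (fun m => f (w + addf a (ps ++ qs) m) + -1 * f (w + addf a ps m)) (seq 1 N)).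
  2:{ rewrite sumf_plus, sumf_scal. ring. }
  eapply Rle_trans; [apply sumf_abs|].
  apply Rle_trans with (K * sumf (addf a qs) (seq 1 N)).
  - rewrite <- sumf_scal. apply sumf_le. intros m _.
    replace (f (w + addf a (ps ++ qs) m) + -1 * f (w + addf a ps m))
      with (f (w + addf a (ps ++ qs) m) - f (w + addf a ps m)) by ring.
    eapply Rle_trans; [apply Hf|]. rewrite addf_app.
    replace (w + (addf a ps m + addf a qs m) - (w + addf a ps m)) with (addf a qs m) by ring.
    rewrite Rabs_pos_eq; [lra|]. apply addf_nonneg. intros; apply Ha.
  - apply Rmult_le_compat_l; [assumption|]. apply addf_avg_le. intros p Hp.
    split; [now apply Hq|apply Ha].
Qed.

(** From [2 >= exp (1/2)] and [exp (J/6) >= 1 + J/6], cubed. A third power is taken in order to beat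
    [1 / tau^2]. *)
Lemma pow2_lower z J : 0 <= z < INR J + 1 -> z ^ 3 / 216 <= 2 ^ J.
Proof.
  intros Hz. assert (H2 : exp (INR J * / 2) <= 2 ^ J).
  { rewrite exp_INR_mult. apply pow_incr. split; [left; apply exp_pos|].
    rewrite <- (exp_ln 2) at 2 by lra. apply exp_le_mono. left. apply ln_lt_2. }
  eapply Rle_trans; [|exact H2].
  replace (INR J * / 2) with (INR 3 * (INR J / 6)) by (simpl; field).
  rewrite exp_INR_mult. replace (z ^ 3 / 216) with ((z / 6) ^ 3) by field.
  apply pow_incr. split; [lra|]. pose proof (exp_ineq1_le (INR J / 6)). lra.
Qed.

(** For [eps = 1 / (2 * ln y)] and [p <= y] the factor [p^eps] is at most [exp (1/2)], so Rankin's
    weights cost only a factor 2. *)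
Lemma root_weight_le y p : (2 <= y)%nat -> nprime p -> (p <= y)%nat ->
  Rpower (INR p) (/ (2 * ln (INR y)) - 1) <= 2 * / INR p.
Proof.
  intros Hy Hp Hpy. pose proof (nprime_ge2 p Hp) as Hp2.
  assert (Hp0 : 0 < INR p) by (apply lt_0_INR; lia).
  assert (Hl : 0 < ln (INR y)) by (rewrite <- ln_1; apply ln_increasing; [lra|apply (lt_INR 1); lia]).
  assert (Hlp : ln (INR p) <= ln (INR y)) by (apply Rcomplements.ln_le; [assumption|now apply le_INR]).
  unfold Rpower.
  replace ((/ (2 * ln (INR y)) - 1) * ln (INR p))
    with (ln (INR p) / ln (INR y) / 2 + - ln (INR p)) by (field; lra).
  rewrite exp_plus, exp_Ropp, exp_ln by assumption.
  apply Rmult_le_compat_r; [left; now apply Rinv_0_lt_compat|].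
  apply Rle_trans with (exp (/ 2)).
  - apply exp_le_mono. assert (ln (INR p) / ln (INR y) <= 1).
    { apply Rcomplements.Rle_div_l; lra. } lra.
  - rewrite <- (exp_ln 2) at 2 by lra. apply exp_le_mono. left. apply ln_lt_2.
Qed.

(** With [eps = 1 / (2 * ln y)], the saving [N^(- eps)] is [exp (- ln N / (2 * ln y))], and
    [ln N >= 2^J * ln y]. *)
Lemma csum_heat_root_error u v0 K2 a N J S : (1 <= N)%nat -> (forall p, 0 <= a p) ->
  sumf (fun p => a p / INR p) (primes N) <= S ->
  (1 + Rabs (- / sqrt v0) * exp 1 * (2 * S)) ^ 2 / 2 <= K2 ->
  forall w, Rabs (csum a (primes (root_iter J N)) (heat u v0) N w -
        INR N * model a (primes (root_iter J N)) (heat u v0) w) <=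
  INR N * exp (K2 - 2 ^ J / 2).
Proof.
  intros HN Ha HS HK w. set (y := root_iter J N).
  assert (HN0 : 0 < INR N) by (apply lt_0_INR; lia).
  (* For [y <= 1] there are no primes and the error is zero; otherwise [ln y] is positive and [eps]
     makes sense. *)
  destruct (le_lt_dec y 1) as [Hy|Hy].
  - assert (E : primes y = nil).
    { destruct (primes y) as [|p ps] eqn:E; [reflexivity|].
      assert (Hin : In p (primes y)) by (rewrite E; simpl; tauto).
      apply in_primes in Hin. destruct Hin as [H1 H2]. apply nprime_ge2 in H1. lia. }
    rewrite E. unfold csum. cbn [model].
    rewrite (sumf_ext _ (fun _ => heat u v0 w)) by (intros; f_equal; unfold addf; simpl; ring).
    rewrite sumf_const, length_seq. replace (heat u v0 w * INR N - INR N * heat u v0 w) with 0 by ring.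
    rewrite Rabs_R0. apply Rmult_le_pos; [lra|left; apply exp_pos].
  - assert (Hl : 0 < ln (INR y))
      by (rewrite <- ln_1; apply ln_increasing; [lra|apply (lt_INR 1); lia]).
    pose proof (ln_root_iter J N) as HJ. fold y in HJ. specialize (HJ ltac:(lia)).
    set (eps := / (2 * ln (INR y))).
    assert (He0 : 0 < eps) by (apply Rinv_0_lt_compat; lra).
    assert (He1 : eps <= 1).
    { unfold eps. rewrite <- Rinv_1. apply Rinv_le_contravar; [lra|].
      assert (ln 2 <= ln (INR y)) by (apply Rcomplements.ln_le; [lra|apply (le_INR 2); lia]).
      pose proof ln_lt_2. lra. }
    eapply Rle_trans.
    { apply (csum_Phi_error a (- / sqrt v0) (u / sqrt v0) eps N (primes y) w HN); try lra.
      - exact Ha.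
      - apply nodup_primes.
      - intros q Hq. now apply in_primes in Hq. }
    assert (E1 : Rpower (INR N) (1 - eps) <= INR N * exp (- (2 ^ J / 2))).
    { unfold Rpower. replace ((1 - eps) * ln (INR N)) with (ln (INR N) + - (eps * ln (INR N))) by ring.
      rewrite exp_plus, exp_ln by assumption. apply Rmult_le_compat_l; [lra|].
      apply exp_le_mono. apply Ropp_le_contravar. unfold eps.
      replace (/ (2 * ln (INR y)) * ln (INR N)) with (ln (INR N) / ln (INR y) / 2) by (field; lra).
      assert (2 ^ J <= ln (INR N) / ln (INR y)) by (apply Rcomplements.Rle_div_r; lra). lra. }
    assert (Hb0 : 0 <= sumf (fun p => a p * Rpower (INR p) (eps - 1)) (primes y)).
    { apply sumf_nonneg. intros p _. apply Rmult_le_pos; [apply Ha|left; apply Rpower_pos]. }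
    assert (Hb : sumf (fun p => a p * Rpower (INR p) (eps - 1)) (primes y) <= 2 * S).
    { apply Rle_trans with (2 * sumf (fun p => a p / INR p) (primes y)).
      - rewrite <- sumf_scal. apply sumf_le. intros p Hp. apply in_primes in Hp.
        replace (2 * (a p / INR p)) with (a p * (2 * / INR p)) by (unfold Rdiv; ring).
        apply Rmult_le_compat_l; [apply Ha|]. now apply root_weight_le.
      - apply Rmult_le_compat_l; [lra|]. eapply Rle_trans; [|exact HS].
        apply sumf_primes_mono; [|apply root_iter_le].
        intros p Hp. apply Rcomplements.Rdiv_le_0_compat; [apply Ha|now apply nprime_pos]. }
    replace (K2 - 2 ^ J / 2) with (- (2 ^ J / 2) + K2) by ring.
    rewrite exp_plus, <- Rmult_assoc.
    apply Rmult_le_compat; [left; apply Rpower_pos|left; apply exp_pos|assumption|].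
    apply exp_le_mono. eapply Rle_trans; [|exact HK].
    assert (0 <= Rabs (- / sqrt v0) * exp 1).
    { apply Rmult_le_pos; [apply Rabs_pos|left; apply exp_pos]. }
    apply Rmult_le_compat_r; [lra|]. apply pow_incr. split.
    + pose proof (Rmult_le_pos _ _ H Hb0). lra.
    + apply Rplus_le_compat_l. now apply Rmult_le_compat_l.
Qed.

Definition mean_of (a : nat -> R) (N : nat) : R := sumf (fun p => a p / INR p) (primes N).

(* [tau] plays the role of the inverse standard deviation before normalization. *)
Definition normalized (C tau : R) (a : nat -> R) (N : nat) : Prop :=
  (forall p, 0 <= a p) /\ (forall p, nprime p -> a p <= C * tau) /\
  mean_of a N <= C / tau /\ sumf (var_weight a) (primes N) = 1.

(** Here [tau0] is chosen before [a] and [N], which admits weights varying with [N]. Starting at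
    [- mean_of a N] centres the sum; the flow ends at time [v0] plus the variance 1. *)
Lemma smooth_clt u v0 C eps : 0 < v0 -> 0 < C -> 0 < eps -> exists tau0, 0 < tau0 /\
  forall tau N a, 0 < tau <= tau0 -> (1 <= N)%nat -> normalized C tau a N ->
  Rabs (csum a (primes N) (heat u v0) N (- mean_of a N) - INR N * heat u (v0 + 1) 0)
  <= INR N * eps.
Proof.
  intros Hv0 HC Heps.
  destruct (heat_lipschitz u v0 Hv0) as [K [HK HLip]].
  destruct (model_heat u v0 Hv0) as [M [HM Hmodel]].
  set (lam := Rabs (- / sqrt v0) * exp 1).
  assert (Hlam : 0 <= lam) by (apply Rmult_le_pos; [apply Rabs_pos|left; apply exp_pos]).
  set (K2 := (1 + lam * (2 * C)) ^ 2 / 2).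
  assert (HK2 : 0 <= K2) by (unfold K2; pose proof (pow2_ge_0 (1 + lam * (2 * C))); lra).
  (* The discarded primes are charged three times [K * t]: for their removal, for their variance and
     for their mean. With [t <= 4 * C * eta], the constant 36 makes this [eps / 3]. *)
  set (eta := eps / (36 * K * C)).
  assert (HKC : 0 < K * C) by now apply Rmult_lt_0_compat.
  assert (Heta : 0 < eta) by (apply Rdiv_lt_0_compat; lra).
  (* [t1] brings the weights below 1, as [model_heat] requires; [t2] lets the cubic bound for [2^J]
     beat [K2 / tau^2]; [t3] and [t4] keep the Lindeberg and inclusion-exclusion errors below
     [eps / 3] each. *)
  set (t1 := / C). set (t2 := eta ^ 3 / (432 * (K2 + 1))). set (t3 := eps / (6 * (M * C + 1))).
  set (t4 := eps / 3).
  assert (HMC : 0 <= M * C) by (apply Rmult_le_pos; lra).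
  assert (Ht1 : 0 < t1) by now apply Rinv_0_lt_compat.
  assert (Ht2 : 0 < t2) by (apply Rdiv_lt_0_compat; [now apply pow_lt|lra]).
  assert (Ht3 : 0 < t3) by (apply Rdiv_lt_0_compat; lra).
  assert (Ht4 : 0 < t4) by (unfold t4; lra).
  exists (Rmin 1 (Rmin t1 (Rmin t2 (Rmin t3 t4)))). split.
  { repeat apply Rmin_glb_lt; lra. }
  intros tau N a [Htau Htau0] HN (Ha0 & Ha & Hmean & Hvar).
  assert (Hs1 : tau <= 1) by (eapply Rle_trans; [exact Htau0|apply Rmin_l]).
  pose proof (Rle_trans _ _ _ Htau0 (Rmin_r _ _)) as Hr1.
  assert (Hs2 : tau <= t1) by (eapply Rle_trans; [exact Hr1|apply Rmin_l]).
  pose proof (Rle_trans _ _ _ Hr1 (Rmin_r _ _)) as Hr2.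
  assert (Hs3 : tau <= t2) by (eapply Rle_trans; [exact Hr2|apply Rmin_l]).
  pose proof (Rle_trans _ _ _ Hr2 (Rmin_r _ _)) as Hr3.
  assert (Hs4 : tau <= t3) by (eapply Rle_trans; [exact Hr3|apply Rmin_l]).
  assert (Hs5 : tau <= t4) by (eapply Rle_trans; [exact Hr3|apply Rmin_r]).
  clear Htau0 Hr1 Hr2 Hr3.
  assert (HN0 : 0 < INR N) by (apply lt_0_INR; lia).
  assert (HCt : C * tau <= 1).
  { apply Rle_trans with (C * / C); [apply Rmult_le_compat_l; [lra|exact Hs2]|right; field; lra]. }
  assert (HCt0 : 0 < C * tau) by now apply Rmult_lt_0_compat.
  assert (Hz : 0 <= eta / tau) by (apply Rcomplements.Rdiv_le_0_compat; lra).
  set (J := fl (eta / tau)). pose proof (fl_spec _ Hz) as [HJ1 HJ2]. fold J in HJ1, HJ2.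
  set (y := root_iter J N). set (ps := primes y).
  set (qs := filter isprime (seq (S y) (N - y))).
  assert (Hsplit : primes N = ps ++ qs) by (apply primes_split, root_iter_le).
  assert (Hqs : forall p, In p qs -> nprime p).
  { intros p Hp. apply filter_In in Hp. now apply isprime_spec. }
  assert (Hps : forall p, In p ps -> nprime p).
  { intros p Hp. now apply in_primes in Hp. }
  set (t := sumf (fun p => a p / INR p) qs).
  assert (Ht0 : 0 <= t).
  { apply sumf_nonneg. intros p Hp. apply Rcomplements.Rdiv_le_0_compat;
      [apply Ha0|now apply nprime_pos, Hqs]. }
  assert (Ht : t <= 4 * C * eta).
  { apply Rle_trans with (C * tau * sumf (fun p => / INR p) qs).
    - unfold t. rewrite <- sumf_scal. apply sumf_le. intros p Hp. unfold Rdiv.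
      apply Rmult_le_compat_r; [|now apply Ha, Hqs].
      left. apply Rinv_0_lt_compat. now apply nprime_pos, Hqs.
    - pose proof (sum_inv_root_iter J N) as HJ. fold y in HJ. rewrite Hsplit, sumf_app in HJ.
      fold ps in HJ.
      apply Rle_trans with (C * tau * (4 * (eta / tau))).
      + apply Rmult_le_compat_l; lra.
      + right. field. lra. }
  (* The factor 2 comes from [1 - 1/p >= 1/2]. It allows the Lindeberg sum of cubes to be measured
     by the variance. *)
  assert (Hvq0 : forall p, nprime p -> 0 <= var_weight a p <= C * tau * (a p / INR p) /\
                 a p ^ 3 * / INR p <= 2 * (C * tau) * var_weight a p).
  { intros p Hp. pose proof (inv_prime_bounds p Hp) as Hi. unfold var_weight, Rdiv.
    pose proof (Ha p Hp) as H1. pose proof (Ha0 p) as H0. set (q := / INR p) in *.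
    assert (Hq : 0 <= a p * q) by (apply Rmult_le_pos; lra).
    assert (Hq2 : 0 <= a p * (a p * q)) by (apply Rmult_le_pos; lra).
    split; [split|].
    - replace (a p ^ 2 * q * (1 - q)) with (a p * (a p * q) * (1 - q)) by ring.
      apply Rmult_le_pos; lra.
    - replace (a p ^ 2 * q * (1 - q)) with (a p * (a p * q) - a p * (a p * q) * q) by ring.
      assert (0 <= a p * (a p * q) * q) by (apply Rmult_le_pos; lra).
      assert (a p * (a p * q) <= C * tau * (a p * q)) by (apply Rmult_le_compat_r; lra). lra.
    - replace (a p ^ 3 * q) with (a p * (a p * (a p * q))) by ring.
      replace (2 * (C * tau) * (a p ^ 2 * q * (1 - q)))
        with (C * tau * (a p * (a p * q) * (2 * (1 - q)))) by ring.
      apply Rmult_le_compat; [lra|lra|lra|].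
      rewrite <- (Rmult_1_r (a p * (a p * q))) at 1. apply Rmult_le_compat_l; lra. }
  set (V := sumf (var_weight a) ps).
  assert (HV : 0 <= 1 - V <= t).
  { rewrite Hsplit, sumf_app in Hvar. fold V in Hvar.
    replace (1 - V) with (sumf (var_weight a) qs) by lra. split.
    - apply sumf_nonneg. intros p Hp. apply Hvq0, Hqs, Hp.
    - apply sumf_le. intros p Hp. destruct (Hvq0 p (Hqs p Hp)) as [[_ H1] _].
      eapply Rle_trans; [exact H1|]. rewrite <- (Rmult_1_l (a p / INR p)) at 2.
      apply Rmult_le_compat_r; [|assumption]. apply Rcomplements.Rdiv_le_0_compat;
        [apply Ha0|now apply nprime_pos, Hqs]. }
  assert (HV0 : 0 <= V) by (apply sumf_nonneg; intros p Hp; apply Hvq0, Hps, Hp).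
  set (m := mean_of a N).
  set (my := sumf (fun p => a p * / INR p) ps).
  assert (Hm : m = my + t) by (unfold m, mean_of; rewrite Hsplit, sumf_app; reflexivity).
  assert (E1 : Rabs (csum a (primes N) (heat u v0) N (- m) - csum a ps (heat u v0) N (- m))
               <= K * (INR N * t)).
  { rewrite Hsplit. apply csum_app_lipschitz.
    - intros w w'. eapply Rle_trans; [apply HLip; lra|].
      rewrite Rminus_diag, Rabs_R0, Rplus_0_l. lra.
    - intros p Hp. apply Hqs, nprime_ge2 in Hp. lia.
    - exact Ha0.
    - lra. }
  assert (E2 : Rabs (csum a ps (heat u v0) N (- m) - INR N * model a ps (heat u v0) (- m))
               <= INR N * tau).
  { eapply Rle_trans; [apply (csum_heat_root_error u v0 (K2 / tau ^ 2) a N J (C / tau) HN Ha0 Hmean)|].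
    - fold lam. unfold K2.
      replace ((1 + lam * (2 * C)) ^ 2 / 2 / tau ^ 2)
        with ((/ tau + lam * (2 * (C / tau))) ^ 2 / 2) by (field; lra).
      assert (1 <= / tau) by (rewrite <- Rinv_1; apply Rinv_le_contravar; lra).
      assert (0 <= lam * (2 * (C / tau))).
      { apply Rmult_le_pos; [assumption|]. assert (0 < C / tau) by (apply Rdiv_lt_0_compat; lra). lra. }
      apply Rmult_le_compat_r; [lra|]. apply pow_incr. lra.
    - apply Rmult_le_compat_l; [lra|].
      pose proof (pow2_lower (eta / tau) J ltac:(lra)) as HP.
      (* By the choice of [t2], [2^J / 2] is at least [(K2 + 1) / tau^2]. The spare [1 / tau^2]
         exceeds [1 / tau], and [exp (- 1 / tau) <= tau]. *)
      assert (H1 : K2 / tau ^ 2 - 2 ^ J / 2 <= - / tau).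
      { replace ((eta / tau) ^ 3 / 216) with (2 * ((eta ^ 3 / 432) / tau) / tau ^ 2) in HP by (field; lra).
        assert (H2 : K2 + 1 <= (eta ^ 3 / 432) / tau).
        { apply Rcomplements.Rle_div_r; [lra|].
          apply Rle_trans with ((K2 + 1) * t2); [apply Rmult_le_compat_l; lra|].
          unfold t2. right. field. lra. }
        assert (Hit : 1 <= / tau) by (rewrite <- Rinv_1; apply Rinv_le_contravar; lra).
        assert (Hit2 : / tau <= / tau ^ 2).
        { replace (/ tau ^ 2) with (/ tau * / tau) by (field; lra). nra. }
        apply Rle_trans with (K2 / tau ^ 2 - (K2 + 1) / tau ^ 2).
        - assert ((K2 + 1) / tau ^ 2 <= eta ^ 3 / 432 / tau / tau ^ 2).
          { apply Rmult_le_compat_r; [lra|assumption]. }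
          lra.
        - unfold Rdiv. lra. }
      apply Rle_trans with (exp (- / tau)); [now apply exp_le_mono|].
      rewrite exp_Ropp. rewrite <- (Rinv_inv tau) at 2. apply Rinv_le_contravar.
      + now apply Rinv_0_lt_compat.
      + pose proof (exp_ineq1_le (/ tau)). lra. }
  assert (E3 : Rabs (model a ps (heat u v0) (- m) - heat u (v0 + V) (- m + my)) <= 2 * M * C * tau).
  { eapply Rle_trans; [apply Hmodel; [|lra]|].
    - intros p Hp. split; [now apply Hps|]. split; [apply Ha0|].
      pose proof (Ha p (Hps p Hp)). lra.
    - apply Rle_trans with (M * (2 * (C * tau) * V)).
      + apply Rmult_le_compat_l; [assumption|]. unfold V. rewrite <- sumf_scal.
        apply sumf_le. intros p Hp. apply Hvq0, Hps, Hp.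
      + assert (0 <= M * (2 * (C * tau))) by (apply Rmult_le_pos; lra). nra. }
  assert (E4 : Rabs (heat u (v0 + V) (- m + my) - heat u (v0 + 1) 0) <= K * (t + t)).
  { eapply Rle_trans; [apply HLip; lra|]. apply Rmult_le_compat_l; [lra|].
    apply Rplus_le_compat.
    - rewrite Rabs_left1; lra.
    - replace (- m + my - 0) with (- t) by lra. rewrite Rabs_Ropp, Rabs_pos_eq; lra. }
  assert (F1 : 3 * (K * t) <= eps / 3).
  { apply Rle_trans with (3 * (K * (4 * C * eta))).
    - apply Rmult_le_compat_l; [lra|]. apply Rmult_le_compat_l; lra.
    - unfold eta. right. field. lra. }
  assert (F3 : 2 * M * C * tau <= eps / 3).
  { apply Rle_trans with (2 * (M * C + 1) * t3); [|unfold t3; right; field; lra].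
    replace (2 * M * C * tau) with (2 * (M * C) * tau) by ring.
    apply Rmult_le_compat; lra. }
  unfold t4 in Hs5.
  set (S1 := csum a (primes N) (heat u v0) N (- m)) in *.
  set (S2 := csum a ps (heat u v0) N (- m)) in *.
  set (S3 := model a ps (heat u v0) (- m)) in *.
  set (S4 := heat u (v0 + V) (- m + my)) in *. set (S5 := heat u (v0 + 1) 0) in *.
  replace (S1 - INR N * S5) with
    ((S1 - S2) + (S2 - INR N * S3) + INR N * ((S3 - S4) + (S4 - S5))) by ring.
  eapply Rle_trans; [apply Rabs_triang|].
  assert (T1 : Rabs ((S1 - S2) + (S2 - INR N * S3)) <= K * (INR N * t) + INR N * tau).
  { eapply Rle_trans; [apply Rabs_triang|]. lra. }
  assert (T2 : Rabs (INR N * ((S3 - S4) + (S4 - S5))) <= INR N * (2 * M * C * tau + K * (t + t))).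
  { rewrite Rabs_mult, (Rabs_pos_eq (INR N)) by lra. apply Rmult_le_compat_l; [lra|].
    eapply Rle_trans; [apply Rabs_triang|]. lra. }
  apply Rle_trans with (INR N * (3 * (K * t) + tau + 2 * M * C * tau)); [lra|].
  apply Rmult_le_compat_l; lra.
Qed.

Lemma Phi_lipschitz x y : Rabs (Phi x - Phi y) <= Rabs (x - y).
Proof.
  destruct (mean_value Phi _ y x (fun z _ => is_derive_Phi z)) as [c [_ Hc]].
  rewrite Hc, Rabs_mult. rewrite <- (Rmult_1_l (Rabs (x - y))) at 2.
  apply Rmult_le_compat_r; [apply Rabs_pos|].
  pose proof inv_sqrt_2PI_bounds. pose proof (gauss_pos c).
  assert (gauss c <= 1).
  { unfold gauss. rewrite <- exp_0. apply exp_le_mono. pose proof (pow2_ge_0 c). lra. }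
  rewrite Rabs_pos_eq by nra. nra.
Qed.

(** This measures what the smoothing variance [v] and a shift [d] of the threshold do to the
    argument of [Phi], as the flow ends at time [v + 1] instead of 1. *)
Lemma Rabs_div_sqrt_sub u d v : 0 <= v ->
  Rabs ((u + d) / sqrt (v + 1) - u) <= Rabs d + Rabs u * v.
Proof.
  intros Hv. assert (H1 : 1 <= sqrt (v + 1)) by (rewrite <- sqrt_1 at 1; apply sqrt_le_1_alt; lra).
  assert (H2 : sqrt (v + 1) <= 1 + v).
  { rewrite <- (sqrt_Rsqr (1 + v)) by lra. apply sqrt_le_1_alt. unfold Rsqr. nra. }
  assert (H3 : 0 < / sqrt (v + 1) <= 1).
  { split; [apply Rinv_0_lt_compat; lra|]. rewrite <- Rinv_1 at 2. apply Rinv_le_contravar; lra. }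
  replace ((u + d) / sqrt (v + 1) - u)
    with (d * / sqrt (v + 1) + u * (/ sqrt (v + 1) * (1 - sqrt (v + 1)))) by (field; lra).
  eapply Rle_trans; [apply Rabs_triang|]. rewrite !Rabs_mult.
  rewrite (Rabs_pos_eq (/ sqrt (v + 1))) by lra. rewrite (Rabs_left1 (1 - sqrt (v + 1))) by lra.
  pose proof (Rabs_pos d). pose proof (Rabs_pos u).
  apply Rplus_le_compat; [nra|]. apply Rmult_le_compat_l; [assumption|]. nra.
Qed.

(** The indicator of [Y < u] is enclosed between smoothed ones with thresholds [u - 2 * rho] and
    [u + 2 * rho]: one [rho] absorbs the distance from [Y] to the centred additive function, the
    other lets the smoothing come within [eps] of 0 or 1. The four [eps] are the smooth limit
    theorem, the bad set, the smoothing and the displacement of [Phi]. *)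
Lemma clt_perturbed u C eps : 0 < C -> 0 < eps ->
  exists tau0 rho, 0 < tau0 /\ 0 < rho /\
  forall tau N a, 0 < tau <= tau0 -> (1 <= N)%nat -> normalized C tau a N ->
  forall (below bad : nat -> bool) (Y : nat -> R),
  (forall n, below n = true <-> Y n < u) ->
  sumf (fun n => if bad n then 1 else 0) (seq 1 N) <= INR N * eps ->
  (forall n, (1 <= n <= N)%nat -> bad n = false ->
     Rabs (Y n - (addf a (primes N) n - mean_of a N)) <= rho) ->
  Rabs (INR (length (filter below (seq 1 N))) - INR N * Phi u) <= INR N * (4 * eps).
Proof.
  intros HC Heps. set (rho := eps / 4). assert (Hrho : 0 < rho) by (unfold rho; lra).
  destruct (Phi_lim eps Heps) as [X [HX HPhi]].
  assert (Hu : 0 <= Rabs u) by apply Rabs_pos.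
  (* [r] is the standard deviation of the smoothing: [rho / r] has to reach the Gaussian tail beyond
     [X], and [Rabs u * r^2] has to stay below [eps / 2]. *)
  set (r := Rmin 1 (Rmin (rho / X) (eps / (2 * (Rabs u + 1))))).
  assert (Hr : 0 < r).
  { repeat apply Rmin_glb_lt; [lra|now apply Rdiv_lt_0_compat|apply Rdiv_lt_0_compat; lra]. }
  assert (Hr1 : r <= 1) by apply Rmin_l.
  assert (Hr2 : r <= rho / X) by (eapply Rle_trans; [apply Rmin_r|apply Rmin_l]).
  assert (Hr3 : r <= eps / (2 * (Rabs u + 1))) by (eapply Rle_trans; [apply Rmin_r|apply Rmin_r]).
  set (v := r ^ 2). assert (Hv : 0 < v) by (unfold v; nra).
  assert (Hsv : sqrt v = r) by (unfold v; apply sqrt_pow2; lra).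
  assert (Hgap : 0 <= 1 - Phi (rho / r) <= eps).
  { apply HPhi. apply Rcomplements.Rle_div_r; [lra|]. apply Rcomplements.Rle_div_r in Hr2; lra. }
  assert (Hclose : forall d, Rabs d <= 2 * rho ->
            Rabs (heat (u + d) (v + 1) 0 - Phi u) <= eps).
  { intros d Hd. rewrite heat_eq by lra. rewrite Rminus_0_r.
    eapply Rle_trans; [apply Phi_lipschitz|].
    eapply Rle_trans; [apply Rabs_div_sqrt_sub; lra|].
    assert (Rabs u * v <= eps / 2).
    { apply Rle_trans with ((Rabs u + 1) * (eps / (2 * (Rabs u + 1)))).
      - apply Rmult_le_compat; [lra|lra|lra|]. unfold v. nra.
      - right. field. lra. }
    unfold rho in *. lra. }
  destruct (smooth_clt (u + 2 * rho) v C eps Hv HC Heps) as [tp [Htp HU]].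
  destruct (smooth_clt (u + - (2 * rho)) v C eps Hv HC Heps) as [tm [Htm HL]].
  exists (Rmin tp tm), rho. split; [now apply Rmin_glb_lt|]. split; [assumption|].
  intros tau N a [Htau Htau0] HN Hnorm below bad Y Hbelow Hbad HY.
  pose proof (Rmin_l tp tm). pose proof (Rmin_r tp tm).
  specialize (HU tau N a ltac:(lra) HN Hnorm). specialize (HL tau N a ltac:(lra) HN Hnorm).
  assert (HN0 : 0 < INR N) by (apply lt_0_INR; lia).
  set (m := mean_of a N) in *. set (W := addf a (primes N)) in *.
  rewrite length_filter_sumf.
  set (B := sumf (fun n => if bad n then 1 else 0) (seq 1 N)) in *.
  set (L := sumf (fun n => if below n then 1 else 0) (seq 1 N)) in *.
  pose proof (Hclose (2 * rho) ltac:(rewrite Rabs_pos_eq; lra)) as Hcp.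
  pose proof (Hclose (- (2 * rho)) ltac:(rewrite Rabs_Ropp, Rabs_pos_eq; lra)) as Hcm.
  assert (Hconst : sumf (fun _ => eps) (seq 1 N) = INR N * eps)
    by (rewrite sumf_const, length_seq; ring).
  assert (Upper : L <= csum a (primes N) (heat (u + 2 * rho) v) N (- m) + B + INR N * eps).
  { unfold L, B, csum. rewrite <- Hconst, <- !sumf_plus. apply sumf_le. intros n Hn.
    apply in_seq in Hn. rewrite heat_eq, Hsv by assumption. fold (W n).
    pose proof (Phi_bounds ((u + 2 * rho - (- m + W n)) / r)) as Hb.
    destruct (below n) eqn:E; destruct (bad n) eqn:E2; try lra.
    apply Hbelow in E. specialize (HY n ltac:(lia) E2). apply Rcomplements.Rabs_le_between in HY.
    assert (Phi (rho / r) <= Phi ((u + 2 * rho - (- m + W n)) / r)).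
    { apply Phi_incr. apply Rmult_le_compat_r; [left; now apply Rinv_0_lt_compat|lra]. }
    lra. }
  assert (Lower : csum a (primes N) (heat (u + - (2 * rho)) v) N (- m) <= L + B + INR N * eps).
  { unfold L, B, csum. rewrite <- Hconst, <- !sumf_plus. apply sumf_le. intros n Hn.
    apply in_seq in Hn. rewrite heat_eq, Hsv by assumption. fold (W n).
    pose proof (Phi_bounds ((u + - (2 * rho) - (- m + W n)) / r)) as Hb.
    destruct (below n) eqn:E; destruct (bad n) eqn:E2; try lra.
    specialize (HY n ltac:(lia) E2). apply Rcomplements.Rabs_le_between in HY.
    assert (Hge : u <= Y n).
    { destruct (Rle_lt_dec u (Y n)); [assumption|]. apply Hbelow in r0. congruence. }
    assert (Phi ((u + - (2 * rho) - (- m + W n)) / r) <= Phi (- (rho / r))).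
    { apply Phi_incr. replace (- (rho / r)) with (- rho / r) by (field; lra).
      apply Rmult_le_compat_r; [left; now apply Rinv_0_lt_compat|lra]. }
    rewrite Phi_opp in *. lra. }
  apply Rcomplements.Rabs_le_between in HU. apply Rcomplements.Rabs_le_between in HL.
  apply Rcomplements.Rabs_le_between in Hcp. apply Rcomplements.Rabs_le_between in Hcm.
  assert (G1 : INR N * heat (u + 2 * rho) (v + 1) 0 <= INR N * (Phi u + eps))
    by (apply Rmult_le_compat_l; lra).
  assert (G2 : INR N * (Phi u - eps) <= INR N * heat (u + - (2 * rho)) (v + 1) 0)
    by (apply Rmult_le_compat_l; lra).
  apply Rabs_le. lra.
Qed.

(** * The Turan-Kubilius inequality and polynomial linearization *)

Lemma addf_mul_prime_le g N p m : (forall q, nprime q -> 0 <= g q) -> In p (primes N) ->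
  addf g (primes N) (p * m) <= g p + addf g (primes N) m.
Proof.
  intros Hg Hp. unfold addf.
  rewrite <- (sumf_pick g p (primes N)) by (assumption || apply nodup_primes).
  rewrite <- sumf_plus. apply sumf_le. intros q Hq. apply in_primes in Hq as [Hq _].
  apply in_primes in Hp as [Hp _]. pose proof (Hg q Hq).
  destruct (Nat.eq_dec q p) as [->|Hne].
  - destruct (dvb p (p * m)), (dvb p m); lra.
  - rewrite dvb_mul_prime by assumption. destruct (dvb q m); lra.
Qed.

(** Opening one factor of [f n ^ 2] as a sum over primes and using [f (p * k) <= G + f k] bounds the
    second moment by [N * m * (G + m)]. In the first moment, rounding costs [G] for each of at most
    [N] primes. The terms in [m^2] cancel and [G + 2 * G] remains. *)
Lemma turan_kubilius g N G : (1 <= N)%nat -> (forall p, nprime p -> 0 <= g p <= G) ->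
  sumf (fun n => (addf g (primes N) n - mean_of g N) ^ 2) (seq 1 N)
  <= 3 * G * INR N * mean_of g N.
Proof.
  intros HN Hg. set (m := mean_of g N). set (f := addf g (primes N)).
  assert (HN0 : 0 < INR N) by (apply lt_0_INR; lia).
  assert (Hpos : forall p, In p (primes N) -> (0 < p)%nat /\ 0 <= g p).
  { intros p Hp. apply in_primes in Hp as [Hp _]. split; [apply nprime_ge2 in Hp; lia|apply Hg, Hp]. }
  assert (Hm : 0 <= m).
  { apply sumf_nonneg. intros p Hp. apply Rcomplements.Rdiv_le_0_compat; [apply Hpos, Hp|].
    apply lt_0_INR. apply Hpos, Hp. }
  assert (HG : 0 <= G) by (pose proof (Hg 2%nat prime_2); lra).
  assert (First : INR N * m - G * INR N <= sumf f (seq 1 N)).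
  { unfold f. rewrite sumf_addf by (intros; now apply Hpos).
    apply Rle_trans with (sumf (fun p => INR N * (g p / INR p) + -1 * g p) (primes N)).
    - rewrite sumf_plus, !sumf_scal. fold (mean_of g N). fold m.
      assert (sumf g (primes N) <= G * INR N).
      { apply Rle_trans with (sumf (fun _ => G) (primes N)).
        - apply sumf_le. intros p Hp. apply in_primes in Hp as [Hp _]. apply Hg, Hp.
        - rewrite sumf_const. apply Rmult_le_compat_l; [assumption|]. apply le_INR, length_primes_le. }
      lra.
    - apply sumf_le. intros p Hp. destruct (Hpos p Hp) as [H1 H2].
      pose proof (INR_div_gt N p H1).
      replace (INR N * (g p / INR p) + -1 * g p) with (g p * (INR N / INR p - 1))
        by (unfold Rdiv; ring).
      apply Rmult_le_compat_l; lra. }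
  assert (Second : sumf (fun n => f n ^ 2) (seq 1 N) <= INR N * m * (G + m)).
  { assert (E : sumf (fun n => f n ^ 2) (seq 1 N) =
      sumf (fun p => g p * sumf (fun k => f (p * k)%nat) (seq 1 (N / p))) (primes N)).
    { transitivity (sumf (fun n => sumf (fun p => if dvb p n then g p * f n else 0) (primes N)) (seq 1 N)).
      - apply sumf_ext. intros n _. replace (f n ^ 2) with (f n * f n) by ring.
        unfold f at 2, addf. rewrite <- sumf_scal. apply sumf_ext. intros p _.
        destruct (dvb p n); ring.
      - rewrite sumf_swap. apply sumf_ext. intros p Hp.
        rewrite (sumf_multiples p (fun n => g p * f n)) by now apply Hpos.
        apply sumf_scal. }
    rewrite E. replace (INR N * m * (G + m)) with (INR N * (G + m) * m) by ring.
    unfold m at 2, mean_of. rewrite <- sumf_scal. apply sumf_le. intros p Hp.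
    destruct (Hpos p Hp) as [H1 H2].
    replace (INR N * (G + m) * (g p / INR p)) with (g p * (INR N / INR p * (G + m)))
      by (unfold Rdiv; ring).
    apply Rmult_le_compat_l; [assumption|].
    apply Rle_trans with (sumf (fun k => G + f k) (seq 1 (N / p))).
    - apply sumf_le. intros k _. unfold f.
      eapply Rle_trans; [apply addf_mul_prime_le; [intros; now apply Hg|assumption]|].
      apply Rplus_le_compat_r. apply in_primes in Hp as [Hp _]. apply Hg, Hp.
    - rewrite sumf_plus, sumf_const, length_seq.
      pose proof (addf_avg_le g (primes N) (N / p) Hpos) as H3. fold f in H3.
      fold (mean_of g N) in H3. fold m in H3.
      apply Rle_trans with (INR (N / p) * (G + m)); [lra|].
      apply Rmult_le_compat_r; [lra|]. now apply INR_div_le. }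
  rewrite (sumf_ext _ (fun n => f n ^ 2 + (-2 * m) * f n + m ^ 2)) by (intros; ring).
  rewrite !sumf_plus, sumf_scal, sumf_const, length_seq.
  assert (H1 : -2 * m * sumf f (seq 1 N) <= -2 * m * (INR N * m - G * INR N)).
  { replace (-2 * m * sumf f (seq 1 N)) with (- (2 * m * sumf f (seq 1 N))) by ring.
    replace (-2 * m * (INR N * m - G * INR N)) with (- (2 * m * (INR N * m - G * INR N))) by ring.
    apply Ropp_le_contravar, Rmult_le_compat_l; lra. }
  lra.
Qed.

Definition far (g : nat -> R) (N : nat) (eta : R) (n : nat) : bool :=
  if Rle_dec (Rabs (addf g (primes N) n - mean_of g N)) (eta * mean_of g N) then false else true.

(** Chebyshev's inequality. The relative deviation [eta] may thus be as small as a large multiple of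
    [mean_of g N] to the power -1/2. *)
Lemma far_count g N G eta : (1 <= N)%nat -> (forall p, nprime p -> 0 <= g p <= G) ->
  0 < mean_of g N -> 0 < eta ->
  sumf (fun n => if far g N eta n then 1 else 0) (seq 1 N)
  <= INR N * (3 * G / (eta ^ 2 * mean_of g N)).
Proof.
  intros HN Hg Hm He. set (m := mean_of g N) in *.
  assert (Hem : 0 < eta * m) by now apply Rmult_lt_0_compat.
  apply Rmult_le_reg_l with ((eta * m) ^ 2); [nra|].
  rewrite <- sumf_scal.
  eapply Rle_trans; [|eapply Rle_trans; [apply (turan_kubilius g N G HN Hg)|]].
  - apply sumf_le. intros n _. unfold far. fold m.
    rewrite <- (pow2_abs (addf g (primes N) n - m)).
    destruct (Rle_dec _ _) as [H|H].
    + rewrite Rmult_0_r. apply pow2_ge_0.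
    + rewrite Rmult_1_r. apply pow_incr. lra.
  - fold m. right. field. lra.
Qed.

Lemma sumR_ext l f h : (forall i, (i < l)%nat -> f i = h i) -> sumR l f = sumR l h.
Proof.
  induction l as [|l IH]; intros H; [reflexivity|].
  cbn [sumR]. rewrite H by lia. rewrite IH; [reflexivity|]. intros; apply H; lia.
Qed.

Lemma sumR_le l f h : (forall i, (i < l)%nat -> f i <= h i) -> sumR l f <= sumR l h.
Proof.
  induction l as [|l IH]; intros H; cbn [sumR]; [lra|].
  apply Rplus_le_compat; [apply IH; intros; apply H; lia|apply H; lia].
Qed.

Lemma sumR_plus l f h : sumR l (fun i => f i + h i) = sumR l f + sumR l h.
Proof. induction l as [|l IH]; cbn [sumR]; [ring|]. rewrite IH. ring. Qed.

Lemma sumR_scal l c f : sumR l (fun i => c * f i) = c * sumR l f.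
Proof. induction l as [|l IH]; cbn [sumR]; [ring|]. rewrite IH. ring. Qed.

Lemma sumR_const l c : sumR l (fun _ => c) = INR l * c.
Proof. induction l as [|l IH]; [simpl; ring|]. cbn [sumR]. rewrite IH, S_INR. ring. Qed.

Lemma sumR_nonneg l f : (forall i, (i < l)%nat -> 0 <= f i) -> 0 <= sumR l f.
Proof.
  intros H. replace 0 with (sumR l (fun _ => 0)) by (rewrite sumR_const; ring). now apply sumR_le.
Qed.

Lemma sumR_ge_term l f i : (forall i, (i < l)%nat -> 0 <= f i) -> (i < l)%nat -> f i <= sumR l f.
Proof.
  induction l as [|l IH]; intros H Hi; [lia|]. cbn [sumR].
  destruct (Nat.eq_dec i l) as [->|Hne].
  - assert (0 <= sumR l f) by (apply sumR_nonneg; intros; apply H; lia). lra.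
  - assert (f i <= sumR l f) by (apply IH; [intros; apply H; lia|lia]).
    specialize (H l ltac:(lia)). lra.
Qed.

Lemma sumR_mult l f h : sumR l f * sumR l h = sumR l (fun i => sumR l (fun j => f i * h j)).
Proof.
  rewrite (sumR_ext l (fun i => sumR l (fun j => f i * h j)) (fun i => sumR l h * f i)).
  - rewrite sumR_scal. ring.
  - intros i _. rewrite sumR_scal. ring.
Qed.

Lemma prodR_ext l f h : (forall i, (i < l)%nat -> f i = h i) -> prodR l f = prodR l h.
Proof.
  induction l as [|l IH]; intros H; [reflexivity|].
  cbn [prodR]. rewrite H by lia. rewrite IH; [reflexivity|]. intros; apply H; lia.
Qed.

Lemma prodR_mult l f h : prodR l (fun i => f i * h i) = prodR l f * prodR l h.
Proof. induction l as [|l IH]; cbn [prodR]; [ring|]. rewrite IH. ring. Qed.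

Lemma prodR_pos l f : (forall i, (i < l)%nat -> 0 < f i) -> 0 < prodR l f.
Proof.
  induction l as [|l IH]; intros H; cbn [prodR]; [lra|].
  apply Rmult_lt_0_compat; [apply IH; intros; apply H; lia|apply H; lia].
Qed.

Lemma prodR_extract l f i : (i < l)%nat ->
  prodR l f = f i * prodR l (fun k => if Nat.eq_dec k i then 1 else f k).
Proof.
  induction l as [|l IH]; intros Hi; [lia|]. cbn [prodR].
  destruct (Nat.eq_dec l i) as [->|Hne].
  - rewrite (prodR_ext i (fun k => if Nat.eq_dec k i then 1 else f k) f); [ring|].
    intros k Hk. destruct (Nat.eq_dec k i); [lia|reflexivity].
  - rewrite IH by lia. ring.
Qed.

Fixpoint mono_deg (l : nat) (alpha : nat -> nat) : nat :=
  match l with O => O | S l' => (mono_deg l' alpha + alpha l')%nat end.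

Lemma INR_mono_deg l alpha : INR (mono_deg l alpha) = sumR l (fun i => INR (alpha i)).
Proof. induction l as [|l IH]; [reflexivity|]. cbn [mono_deg sumR]. now rewrite plus_INR, IH. Qed.

(** The coefficient [4^D - 1] closes the induction: the factor [1 + h] at most doubles the old
    error, the cross term [h * S] adds [D * eta^2], and [2 * (4^D - 1) + D <= 4^(D + 1) - 1]. *)
Lemma product_linearization_step P S D eta h : 0 <= eta <= 1 -> Rabs h <= eta ->
  Rabs (P - 1 - S) <= (4 ^ D - 1) * eta ^ 2 -> Rabs S <= INR D * eta ->
  Rabs (P * (1 + h) - 1 - (S + h)) <= (4 ^ Datatypes.S D - 1) * eta ^ 2 /\
  Rabs (S + h) <= INR (Datatypes.S D) * eta.
Proof.
  intros He Hh HP HS. split.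
  - replace (P * (1 + h) - 1 - (S + h)) with ((P - 1 - S) * (1 + h) + h * S) by ring.
    eapply Rle_trans; [apply Rabs_triang|]. rewrite !Rabs_mult.
    assert (H1 : Rabs (1 + h) <= 2).
    { eapply Rle_trans; [apply Rabs_triang|]. rewrite Rabs_R1. lra. }
    assert (H2 : Rabs (P - 1 - S) * Rabs (1 + h) <= (4 ^ D - 1) * eta ^ 2 * 2)
      by (apply Rmult_le_compat; try apply Rabs_pos; assumption).
    assert (H3 : Rabs h * Rabs S <= eta * (INR D * eta))
      by (apply Rmult_le_compat; try apply Rabs_pos; assumption).
    assert (H4 : INR D <= 4 ^ D).
    { clear. induction D as [|D IH]; [simpl; lra|]. rewrite S_INR. cbn [pow].
      assert (1 <= 4 ^ D) by (apply pow_R1_Rle; lra). lra. }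
    assert (1 <= 4 ^ D) by (apply pow_R1_Rle; lra).
    cbn [pow]. rewrite Rmult_1_r in *. assert (0 <= eta * eta) by nra.
    apply Rle_trans with ((2 * (4 ^ D - 1) + INR D) * (eta * eta)); [lra|].
    apply Rmult_le_compat_r; lra.
  - eapply Rle_trans; [apply Rabs_triang|]. rewrite S_INR. lra.
Qed.

Lemma product_linearization l alpha h eta : 0 <= eta <= 1 ->
  (forall k, (k < l)%nat -> Rabs (h k) <= eta) ->
  Rabs (prodR l (fun k => (1 + h k) ^ alpha k) - 1 - sumR l (fun k => INR (alpha k) * h k))
  <= (4 ^ mono_deg l alpha - 1) * eta ^ 2.
Proof.
  intros He Hh.
  cut (Rabs (prodR l (fun k => (1 + h k) ^ alpha k) - 1 - sumR l (fun k => INR (alpha k) * h k))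
       <= (4 ^ mono_deg l alpha - 1) * eta ^ 2 /\
       Rabs (sumR l (fun k => INR (alpha k) * h k)) <= INR (mono_deg l alpha) * eta); [tauto|].
  induction l as [|l IH].
  - cbn. rewrite !Rminus_diag, Rabs_R0. lra.
  - specialize (IH ltac:(intros; apply Hh; lia)). cbn [prodR sumR mono_deg].
    set (P := prodR l (fun k => (1 + h k) ^ alpha k)) in *.
    set (S0 := sumR l (fun k => INR (alpha k) * h k)) in *.
    set (D := mono_deg l alpha) in *. specialize (Hh l ltac:(lia)).
    (* A power counts as repeated single factors, each raising the degree by one. *)
    induction (alpha l) as [|n IHn].
    + simpl. rewrite Rmult_0_l, Rmult_1_r, Rplus_0_r, Nat.add_0_r. exact IH.
    + destruct IHn as [I1 I2].
      replace (P * (1 + h l) ^ S n) with (P * (1 + h l) ^ n * (1 + h l)) by (simpl; ring).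
      replace (S0 + INR (S n) * h l) with (S0 + INR n * h l + h l) by (rewrite S_INR; ring).
      replace (D + S n)%nat with (S (D + n)) by lia.
      now apply product_linearization_step.
Qed.

Definition mono_deriv (l : nat) (m : R * (nat -> nat)) (i : nat) (t : nat -> R) : R :=
  fst m * INR (snd m i) * t i ^ (snd m i - 1) *
  prodR l (fun k => if Nat.eq_dec k i then 1 else t k ^ (snd m k)).

Lemma pderiv_eval_cons l m Q i t :
  pderiv_eval l (m :: Q) i t = mono_deriv l m i t + pderiv_eval l Q i t.
Proof. reflexivity. Qed.

(** Multiplying by [t i] restores the monomial and disposes of the truncated exponent [snd m i - 1]
    at 0, where the factor [INR 0] vanishes. *)
Lemma mono_deriv_euler l m i t : (i < l)%nat ->
  t i * mono_deriv l m i t = fst m * mono_eval l (snd m) t * INR (snd m i).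
Proof.
  intros Hi. unfold mono_deriv, mono_eval. rewrite (prodR_extract l (fun k => t k ^ snd m k) i Hi).
  destruct (snd m i) as [|n]; [simpl; ring|].
  replace (S n - 1)%nat with n by lia. cbn [pow]. ring.
Qed.

Lemma mono_eval_pos l alpha t : (forall k, (k < l)%nat -> 0 < t k) -> 0 < mono_eval l alpha t.
Proof. intros H. apply prodR_pos. intros i Hi. apply pow_lt. now apply H. Qed.

Lemma mono_deriv_nonneg l m i t : 0 <= fst m -> (forall k, (k < l)%nat -> 0 < t k) ->
  (i < l)%nat -> 0 <= mono_deriv l m i t.
Proof.
  intros Hm Ht Hi. apply Rmult_le_reg_l with (t i); [now apply Ht|].
  rewrite Rmult_0_r, mono_deriv_euler by assumption.
  apply Rmult_le_pos; [|apply pos_INR].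
  apply Rmult_le_pos; [assumption|left; now apply mono_eval_pos].
Qed.

Lemma pderiv_eval_nonneg l Q i t : nonneg_coeffs Q -> (forall k, (k < l)%nat -> 0 < t k) ->
  (i < l)%nat -> 0 <= pderiv_eval l Q i t.
Proof.
  intros HQ Ht Hi. induction Q as [|m Q IH]; [simpl; lra|].
  inversion HQ; subst. rewrite pderiv_eval_cons.
  apply Rplus_le_le_0_compat; [now apply mono_deriv_nonneg|now apply IH].
Qed.

(** The index depends on [Q] alone, not on the point [t], so a single mean can set the scale for all
    [x]. *)
Lemma pderiv_eval_pos l Q : nonneg_coeffs Q -> nonconstant l Q ->
  exists i, (i < l)%nat /\
    forall t, (forall k, (k < l)%nat -> 0 < t k) -> 0 < pderiv_eval l Q i t.
Proof.
  intros HQ (m & Hin & Hc & i & Hi & Ha). exists i. split; [assumption|]. intros t Ht.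
  induction Q as [|m' Q IH]; [destruct Hin|]. inversion HQ as [|? ? Hm' HQ']; subst.
  rewrite pderiv_eval_cons. destruct Hin as [->|Hin].
  - apply Rplus_lt_le_0_compat; [|now apply pderiv_eval_nonneg].
    apply Rmult_lt_reg_l with (t i); [now apply Ht|].
    rewrite Rmult_0_r, mono_deriv_euler by assumption.
    apply Rmult_lt_0_compat; [|now apply lt_0_INR].
    apply Rmult_lt_0_compat; [lra|now apply mono_eval_pos].
  - apply Rplus_le_lt_0_compat; [now apply mono_deriv_nonneg|now apply IH].
Qed.

(** Under relative perturbations each monomial factors out of its own remainder, which is [eta^2]
    times the monomial up to a constant. By Euler's identity a nonconstant monomial is at most its
    share of the first-order sum, and a constant one has no remainder. Nonnegative coefficients
    prevent the shares from cancelling. *)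
Lemma polynomial_linearization l Q : nonneg_coeffs Q -> exists K, 0 <= K /\
  forall t h eta, (forall k, (k < l)%nat -> 0 < t k) -> 0 <= eta <= 1 ->
  (forall k, (k < l)%nat -> Rabs (h k) <= eta) ->
  Rabs (peval l Q (fun k => t k * (1 + h k)) - peval l Q t -
        sumR l (fun k => t k * pderiv_eval l Q k t * h k))
  <= K * eta ^ 2 * sumR l (fun k => t k * pderiv_eval l Q k t).
Proof.
  intros HQ. induction Q as [|m Q IH].
  - exists 0. split; [lra|]. intros t h eta _ _ _. unfold peval, pderiv_eval. simpl.
    rewrite (sumR_ext _ _ (fun _ => 0)) by (intros; ring).
    rewrite sumR_const, Rmult_0_r, !Rminus_0_r, Rabs_R0. lra.
  - inversion HQ as [|? ? Hm HQ']; subst. destruct (IH HQ') as [K [HK IHK]].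
    set (D := mono_deg l (snd m)).
    assert (HD : 1 <= 4 ^ D) by (apply pow_R1_Rle; lra).
    exists (K + 4 ^ D). split; [lra|]. intros t h eta Ht He Hh.
    specialize (IHK t h eta Ht He Hh).
    set (S1 := sumR l (fun k => t k * pderiv_eval l Q k t)) in *.
    assert (HS1 : 0 <= S1).
    { apply sumR_nonneg. intros i Hi. apply Rmult_le_pos; [left; now apply Ht|].
      now apply pderiv_eval_nonneg. }
    set (cM := fst m * mono_eval l (snd m) t).
    assert (HcM : 0 <= cM) by (apply Rmult_le_pos; [assumption|left; now apply mono_eval_pos]).
    assert (E1 : sumR l (fun k => t k * pderiv_eval l (m :: Q) k t) = cM * INR D + S1).
    { unfold S1, D. rewrite INR_mono_deg, <- sumR_scal, <- sumR_plus. apply sumR_ext.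
      intros i Hi. rewrite pderiv_eval_cons, Rmult_plus_distr_l, mono_deriv_euler by assumption.
      reflexivity. }
    assert (E2 : sumR l (fun k => t k * pderiv_eval l (m :: Q) k t * h k) =
      cM * sumR l (fun k => INR (snd m k) * h k) + sumR l (fun k => t k * pderiv_eval l Q k t * h k)).
    { rewrite <- sumR_scal, <- sumR_plus. apply sumR_ext.
      intros i Hi. rewrite pderiv_eval_cons, Rmult_plus_distr_l, mono_deriv_euler by assumption.
      fold cM. ring. }
    assert (E3 : fst m * mono_eval l (snd m) (fun k => t k * (1 + h k)) =
                 cM * prodR l (fun k => (1 + h k) ^ snd m k)).
    { unfold cM, mono_eval. rewrite Rmult_assoc, <- prodR_mult. f_equal.
      apply prodR_ext. intros i _. apply Rpow_mult_distr. }
    pose proof (product_linearization l (snd m) h eta He Hh) as HP. fold D in HP.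
    rewrite E1, E2.
    change (peval l (m :: Q) (fun k => t k * (1 + h k))) with
      (fst m * mono_eval l (snd m) (fun k => t k * (1 + h k)) + peval l Q (fun k => t k * (1 + h k))).
    change (peval l (m :: Q) t) with (cM + peval l Q t). rewrite E3.
    set (P := prodR l (fun k => (1 + h k) ^ snd m k)) in *.
    set (S0 := sumR l (fun k => INR (snd m k) * h k)) in *.
    set (Q1 := peval l Q (fun k => t k * (1 + h k))) in *. set (Q0 := peval l Q t) in *.
    set (L := sumR l (fun k => t k * pderiv_eval l Q k t * h k)) in *.
    replace (cM * P + Q1 - (cM + Q0) - (cM * S0 + L))
      with (cM * (P - 1 - S0) + (Q1 - Q0 - L)) by ring.
    eapply Rle_trans; [apply Rabs_triang|]. rewrite Rabs_mult, (Rabs_pos_eq cM) by assumption.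
    assert (H1 : cM * Rabs (P - 1 - S0) <= 4 ^ D * eta ^ 2 * (cM * INR D)).
    { apply Rle_trans with (cM * ((4 ^ D - 1) * eta ^ 2)); [now apply Rmult_le_compat_l|].
      replace (4 ^ D * eta ^ 2 * (cM * INR D)) with (cM * (4 ^ D * INR D * eta ^ 2)) by ring.
      apply Rmult_le_compat_l; [assumption|]. apply Rmult_le_compat_r; [apply pow2_ge_0|].
      destruct D as [|D']; [simpl; lra|]. rewrite S_INR. pose proof (pos_INR D'). nra. }
    assert (H2 : 0 <= K * eta ^ 2 * (cM * INR D)).
    { apply Rmult_le_pos; [apply Rmult_le_pos; [assumption|apply pow2_ge_0]|].
      apply Rmult_le_pos; [assumption|apply pos_INR]. }
    assert (H3 : 0 <= 4 ^ D * eta ^ 2 * S1).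
    { apply Rmult_le_pos; [|assumption]. apply Rmult_le_pos; [lra|apply pow2_ge_0]. }
    lra.
Qed.

(** * The polynomial limit theorem *)

Lemma fl_mono x y : x <= y -> (fl x <= fl y)%nat.
Proof.
  intros H. unfold fl.
  pose proof (base_Int_part x) as [H1 H2]. pose proof (base_Int_part y) as [H3 H4].
  assert (Int_part x < Int_part y + 1)%Z by (apply lt_IZR; rewrite plus_IZR; lra).
  lia.
Qed.

(** Stated for any monotone predicate, so that one number can serve both as a constant and as a
    threshold for [x]. *)
Lemma finite_common_bound l (P : nat -> R -> Prop) :
  (forall i K K', K <= K' -> P i K -> P i K') ->
  (forall i, (i < l)%nat -> exists K, P i K) ->
  exists K, forall i, (i < l)%nat -> P i K.
Proof.
  intros Hmono H. induction l as [|l IH].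
  - exists 0. intros; lia.
  - destruct IH as [K1 HK1]; [intros; apply H; lia|].
    destruct (H l) as [K2 HK2]; [lia|]. exists (Rmax K1 K2). intros i Hi.
    destruct (Nat.eq_dec i l) as [->|Hne].
    + eapply Hmono; [apply Rmax_r|exact HK2].
    + eapply Hmono; [apply Rmax_l|]. apply HK1. lia.
Qed.

Lemma mu_mean_of g x : mu g x = mean_of g (fl x).
Proof. unfold mu, mean_of. apply psum_primes. Qed.

Lemma kappa_sumf gi gj x : kappa gi gj x =
  sumf (fun p => gi p * gj p / INR p * (1 - / INR p)) (primes (fl x)).
Proof. unfold kappa. apply psum_primes. Qed.

Lemma kappa_nonneg gi gj x : (forall p, nprime p -> 0 <= gi p) ->
  (forall p, nprime p -> 0 <= gj p) -> 0 <= kappa gi gj x.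
Proof.
  intros Hi Hj. rewrite kappa_sumf. apply sumf_nonneg. intros p Hp.
  apply in_primes in Hp as [Hp _]. pose proof (inv_prime_bounds p Hp).
  apply Rmult_le_pos; [|lra]. apply Rmult_le_pos; [|lra].
  apply Rmult_le_pos; [now apply Hi|now apply Hj].
Qed.

Lemma sigma2_le_mu g G x : (forall p, nprime p -> 0 <= g p <= G) ->
  sigma2 g x <= G * mu g x.
Proof.
  intros Hg. unfold sigma2. rewrite kappa_sumf, mu_mean_of. unfold mean_of.
  rewrite <- sumf_scal. apply sumf_le. intros p Hp.
  apply in_primes in Hp as [Hp _]. pose proof (inv_prime_bounds p Hp) as Hq.
  specialize (Hg p Hp). unfold Rdiv. set (q := / INR p) in *.
  assert (0 <= g p * q) by (apply Rmult_le_pos; lra).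
  replace (g p * g p * q * (1 - q)) with (g p * (1 - q) * (g p * q)) by ring.
  apply Rmult_le_compat_r; [assumption|]. nra.
Qed.

Lemma mu_unbounded g G : (forall p, nprime p -> 0 <= g p <= G) -> 0 < G ->
  (forall M, exists x, M < psum x (fun p => g p ^ 2 / INR p)) ->
  forall T, exists X, forall x, X <= x -> T <= mu g x.
Proof.
  intros Hg HG Hdiv T. destruct (Hdiv (G * T)) as [X HX]. exists X. intros x Hx.
  rewrite psum_primes in HX. rewrite mu_mean_of. apply Rmult_le_reg_l with G; [assumption|].
  left. eapply Rlt_le_trans; [exact HX|]. unfold mean_of. rewrite <- sumf_scal.
  eapply Rle_trans; [apply sumf_primes_mono; [|apply (fl_mono _ _ Hx)]|].
  - intros p Hp. pose proof (inv_prime_bounds p Hp). apply Rmult_le_pos; [apply pow2_ge_0|lra].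
  - apply sumf_le. intros p Hp. apply in_primes in Hp as [Hp _].
    pose proof (inv_prime_bounds p Hp). specialize (Hg p Hp). unfold Rdiv.
    replace (G * (g p * / INR p)) with (G * g p * / INR p) by ring.
    apply Rmult_le_compat_r; [lra|]. nra.
Qed.

Lemma peval_ext l Q t s : (forall k, (k < l)%nat -> t k = s k) -> peval l Q t = peval l Q s.
Proof.
  intros H. induction Q as [|m Q IH]; [reflexivity|].
  unfold peval in *. cbn [fold_right]. rewrite IH. do 2 f_equal.
  apply prodR_ext. intros k Hk. now rewrite H.
Qed.

Lemma existsb_count (b : nat -> nat -> bool) l s :
  sumf (fun n => if existsb (fun i => b i n) (seq 0 l) then 1 else 0) s <=
  sumR l (fun i => sumf (fun n => if b i n then 1 else 0) s).
Proof.
  rewrite <- sumf_sumR. apply sumf_le. intros n _.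
  induction l as [|l IH]; [simpl; lra|].
  rewrite seq_S, existsb_app. cbn [existsb sumR Nat.add]. rewrite Bool.orb_false_r.
  assert (0 <= (if b l n then 1 else 0)) by (destruct (b l n); lra).
  destruct (existsb (fun i => b i n) (seq 0 l)), (b l n); simpl; lra.
Qed.

Lemma existsb_seq_false (b : nat -> bool) l : existsb b (seq 0 l) = false ->
  forall i, (i < l)%nat -> b i = false.
Proof.
  intros H i Hi. destruct (b i) eqn:E; [|reflexivity].
  rewrite <- H. symmetry. apply existsb_exists. exists i. split; [|assumption].
  apply in_seq. lia.
Qed.

(* Cut off at the primes: [normalized] asks for nonnegativity everywhere, while
   nothing is known about [g i 0]. *)
Definition lin_form (l : nat) (w : nat -> R) (g : nat -> nat -> R) (p : nat) : R :=
  if isprime p then sumR l (fun i => w i * g i p) else 0.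

Lemma lin_form_prime l w g p : nprime p -> lin_form l w g p = sumR l (fun i => w i * g i p).
Proof. intros H. apply isprime_spec in H. unfold lin_form. now rewrite H. Qed.

Lemma mean_of_lin_form l w g N :
  mean_of (lin_form l w g) N = sumR l (fun i => w i * mean_of (g i) N).
Proof.
  unfold mean_of. rewrite (sumR_ext l _ (fun i => sumf (fun p => w i * (g i p / INR p)) (primes N))).
  2:{ intros i _. symmetry. apply sumf_scal. }
  rewrite <- sumf_sumR. apply sumf_ext. intros p Hp. apply in_primes in Hp as [Hp _].
  rewrite lin_form_prime by assumption. unfold Rdiv. rewrite Rmult_comm, <- sumR_scal.
  apply sumR_ext. intros; ring.
Qed.

Lemma addf_lin_form l w g N n :
  addf (lin_form l w g) (primes N) n = sumR l (fun i => w i * addf (g i) (primes N) n).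
Proof.
  unfold addf.
  rewrite (sumR_ext l _ (fun i => sumf (fun p => w i * (if dvb p n then g i p else 0)) (primes N))).
  2:{ intros i _. symmetry. apply sumf_scal. }
  rewrite <- sumf_sumR. apply sumf_ext. intros p Hp. apply in_primes in Hp as [Hp _].
  destruct (dvb p n); [now rewrite lin_form_prime|].
  rewrite (sumR_ext l _ (fun _ => 0)) by (intros; ring). rewrite sumR_const. ring.
Qed.

(** Squaring the linear form produces the double sum of [BQ]; with the partial derivatives divided
    by [BQ] as weights, the variance becomes 1. *)
Lemma variance_lin_form l w g x :
  sumf (var_weight (lin_form l w g)) (primes (fl x)) =
  sumR l (fun i => sumR l (fun j => w i * w j * kappa (g i) (g j) x)).
Proof.
  rewrite (sumR_ext l _ (fun i => sumf (fun p => sumR l (fun j =>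
    w i * w j * (g i p * g j p / INR p * (1 - / INR p)))) (primes (fl x)))).
  2:{ intros i _. rewrite sumf_sumR. apply sumR_ext. intros j _.
      rewrite kappa_sumf. symmetry. apply sumf_scal. }
  rewrite <- sumf_sumR. apply sumf_ext. intros p Hp. apply in_primes in Hp as [Hp _].
  unfold var_weight. rewrite lin_form_prime by assumption. simpl (_ ^ 2).
  rewrite Rmult_1_r, sumR_mult. unfold Rdiv.
  rewrite Rmult_assoc, Rmult_comm, <- sumR_scal. apply sumR_ext. intros i _.
  rewrite <- sumR_scal. apply sumR_ext. intros; ring.
Qed.

Theorem mainTheorem1 (l : nat) (Q : mpoly) (g : nat -> nat -> R) :
  nonneg_coeffs Q ->
  nonconstant l Q ->
  (forall j, (j < l)%nat -> strongly_additive (g j)) ->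
  (forall j n, (j < l)%nat -> (1 <= n)%nat -> 0 <= g j n) ->
  (* (a) *)
  (forall j, (j < l)%nat -> exists G, forall p, nprime p -> g j p <= G) ->
  (* (b) *)
  (forall j, (j < l)%nat -> forall M, exists x,
      M < psum x (fun p => g j p ^ 2 / INR p)) ->
  (* (c) *)
  (forall i j, (i < l)%nat -> (j < l)%nat ->
      exists c, 0 < c /\ exists X, forall x, X <= x ->
        c * mu (g j) x <= sigma2 (g i) x) ->
  forall u : R, exists L,
    improper_lower_int gauss u L /\
    lim_infty
      (fun x => INR (count_le x (fun n =>
          if Rlt_dec (peval l Q (fun j => g j n)) (AQ l Q g x + u * BQ l Q g x)
          then true else false)) / x)
      (L / sqrt (2 * PI)).
Proof.
  intros HQ Hnc Hsa Hnn Ha Hb Hc u.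
  exists (sqrt (2 * PI) * Phi u). split; [apply improper_lower_int_gauss|].
  replace (sqrt (2 * PI) * Phi u / sqrt (2 * PI)) with (Phi u)
    by (field; pose proof sqrt_2PI_ge1; lra).

  (* Constants uniform in the indices, from conditions (a) and (c) *)
  destruct (pderiv_eval_pos l Q HQ Hnc) as [i0 [Hi0 Hpos]].
  assert (Hgp : forall j p, (j < l)%nat -> nprime p -> 0 <= g j p).
  { intros j p Hj Hp. apply Hnn; [assumption|]. apply nprime_ge2 in Hp. lia. }
  destruct (finite_common_bound l (fun j G => forall p, nprime p -> g j p <= G)) as [G0 HG0].
  { intros i K K' HK H p Hp. eapply Rle_trans; [now apply H|assumption]. }
  { exact Ha. }
  set (G := Rmax 1 G0).
  assert (HG1 : 1 <= G) by apply Rmax_l.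
  assert (HG : forall j, (j < l)%nat -> forall p, nprime p -> 0 <= g j p <= G).
  { intros j Hj p Hp. split; [now apply Hgp|].
    eapply Rle_trans; [now apply (HG0 j Hj p Hp)|apply Rmax_r]. }
  clear HG0 Ha.
  assert (Hsig : forall i x, (i < l)%nat -> 0 <= sigma2 (g i) x).
  { intros i x Hi. apply kappa_nonneg; intros; now apply Hgp. }
  (* The alternative [l <= i] makes the predicate monotone in [K] for every [i], while [sigma2 >= 0]
     is known only for [i < l]. *)
  destruct (finite_common_bound l (fun i K => forall j, (j < l)%nat -> forall x, K <= x ->
              mu (g j) x <= K * sigma2 (g i) x \/ (l <= i)%nat)) as [K0 HK0].
  { intros i K K' HK H j Hj x Hx. destruct (le_lt_dec l i) as [Hi|Hi]; [tauto|].
    destruct (H j Hj x ltac:(lra)) as [H1|H1]; [|lia]. left.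
    eapply Rle_trans; [exact H1|]. apply Rmult_le_compat_r; [now apply Hsig|assumption]. }
  { intros i Hi.
    destruct (finite_common_bound l (fun j K => forall x, K <= x ->
                mu (g j) x <= K * sigma2 (g i) x)) as [K HK].
    - intros j K K' HK H x Hx. eapply Rle_trans; [apply H; lra|].
      apply Rmult_le_compat_r; [now apply Hsig|assumption].
    - intros j Hj. destruct (Hc i j Hi Hj) as [c [Hc0 [X HX]]].
      exists (Rmax (/ c) X). intros x Hx.
      specialize (HX x ltac:(eapply Rle_trans; [apply Rmax_r|exact Hx])).
      apply Rle_trans with (/ c * sigma2 (g i) x).
      + apply Rmult_le_reg_l with c; [assumption|].
        rewrite <- Rmult_assoc, Rinv_r, Rmult_1_l by lra. assumption.
      + apply Rmult_le_compat_r; [now apply Hsig|apply Rmax_l].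
    - exists K. intros j Hj x Hx. left. now apply HK. }
  set (K := Rmax 1 K0).
  assert (HK1 : 1 <= K) by apply Rmax_l.
  assert (HK : forall i j x, (i < l)%nat -> (j < l)%nat -> K <= x ->
                 mu (g j) x <= K * sigma2 (g i) x).
  { intros i j x Hi Hj Hx.
    destruct (HK0 i Hi j Hj x) as [H|H]; [eapply Rle_trans; [apply Rmax_r|exact Hx]| |lia].
    eapply Rle_trans; [exact H|]. apply Rmult_le_compat_r; [now apply Hsig|apply Rmax_r]. }
  clear HK0 Hc.
  set (H := K * G). assert (HH1 : 1 <= H) by (unfold H; nra).
  assert (HGH : G <= H) by (unfold H; nra).
  (* Any two means are comparable, through [sigma2 (g i) <= G * mu (g i)], so [mu (g i0)] can
     represent them all. *)
  assert (Hcomp : forall i j x, (i < l)%nat -> (j < l)%nat -> K <= x ->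
                    mu (g j) x <= H * mu (g i) x).
  { intros i j x Hi Hj Hx. eapply Rle_trans; [now apply (HK i j x)|].
    unfold H. rewrite Rmult_assoc. apply Rmult_le_compat_l; [lra|].
    apply sigma2_le_mu. now apply HG. }

  (* Choice of the parameters *)
  destruct (polynomial_linearization l Q HQ) as [KQ [HKQ Hlin]].
  assert (Hl1 : 1 <= INR l) by (apply (le_INR 1); lia).
  set (C := INR l * K * H).
  assert (HC : 0 < C) by (unfold C; repeat apply Rmult_lt_0_compat; lra).
  (* Four sixths go to [clt_perturbed], one to replacing [x] by its integer part, and one to
     strictness. *)
  intros eps Heps. set (e := eps / 6). assert (He : 0 < e) by (unfold e; lra).
  destruct (clt_perturbed u C e HC He) as (tau0 & rho & Htau0 & Hrho & Hclt).
  (* With relative deviation [E * tau] allowed, the exceptional proportion is at most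
     [3 * l * G * H / E^2], which this choice brings below [e]. *)
  set (E := 1 + 3 * INR l * G * H / e).
  assert (HlGH : 0 < 3 * INR l * G * H) by (repeat apply Rmult_lt_0_compat; lra).
  assert (HE1 : 1 <= E).
  { assert (0 < 3 * INR l * G * H / e) by (now apply Rdiv_lt_0_compat). unfold E. lra. }
  (* The linearization error will be [KQ * E^2 * C * tau], to be kept below [rho]. *)
  set (R0 := KQ * E ^ 2 * C + 1).
  assert (HR0 : 1 <= R0).
  { unfold R0. assert (0 <= KQ * E ^ 2 * C); [|lra].
    apply Rmult_le_pos; [apply Rmult_le_pos; [assumption|apply pow2_ge_0]|lra]. }
  set (ts := Rmin tau0 (Rmin (/ E) (rho / R0))).
  assert (Hts : 0 < ts).
  { repeat apply Rmin_glb_lt; [assumption|apply Rinv_0_lt_compat; lra|apply Rdiv_lt_0_compat; lra]. }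
  destruct (mu_unbounded (g i0) G (HG i0 Hi0) ltac:(lra) (Hb i0 Hi0) (/ ts ^ 2)) as [X1 HX1].
  exists (Rmax X1 (Rmax K (Rmax 1 (/ e)))). intros x Hx.
  assert (Hx1 : X1 <= x) by (eapply Rle_trans; [apply Rmax_l|exact Hx]).
  pose proof (Rle_trans _ _ _ (Rmax_r _ _) Hx) as Hx'.
  assert (Hx2 : K <= x) by (eapply Rle_trans; [apply Rmax_l|exact Hx']).
  pose proof (Rle_trans _ _ _ (Rmax_r _ _) Hx') as Hx''.
  assert (Hx3 : 1 <= x) by (eapply Rle_trans; [apply Rmax_l|exact Hx'']).
  assert (Hx4 : / e <= x) by (eapply Rle_trans; [apply Rmax_r|exact Hx'']).
  clear Hx Hx' Hx''.

  (* The scale [tau] and the sizes of the means *)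
  set (N := fl x). pose proof (fl_spec x ltac:(lra)) as HNx. fold N in HNx.
  assert (HN : (1 <= N)%nat).
  { destruct N; [simpl in HNx; lra|lia]. }
  set (t := fun k => mu (g k) x). set (T := t i0).
  assert (HT : / ts ^ 2 <= T) by now apply HX1.
  assert (HT0 : 0 < T).
  { eapply Rlt_le_trans; [|exact HT]. apply Rinv_0_lt_compat, pow_lt, Hts. }
  set (tau := / sqrt T).
  assert (HsT : 0 < sqrt T) by now apply sqrt_lt_R0.
  assert (Htau : 0 < tau) by now apply Rinv_0_lt_compat.
  assert (HtauT : tau ^ 2 * T = 1).
  { unfold tau. rewrite <- (sqrt_sqrt T) at 2 by lra. field. lra. }
  assert (Htau_ts : tau <= ts).
  { unfold tau. rewrite <- (Rinv_inv ts). apply Rinv_le_contravar; [now apply Rinv_0_lt_compat|].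
    rewrite <- (sqrt_pow2 (/ ts)) by (left; now apply Rinv_0_lt_compat).
    apply sqrt_le_1_alt. now rewrite pow_inv. }
  assert (Htau1 : tau <= tau0) by (eapply Rle_trans; [exact Htau_ts|apply Rmin_l]).
  assert (Htau2 : tau <= / E)
    by (eapply Rle_trans; [exact Htau_ts|eapply Rle_trans; [apply Rmin_r|apply Rmin_l]]).
  assert (Htau3 : tau <= rho / R0)
    by (eapply Rle_trans; [exact Htau_ts|eapply Rle_trans; [apply Rmin_r|apply Rmin_r]]).
  assert (Htlow : forall k, (k < l)%nat -> T <= H * t k).
  { intros k Hk. now apply Hcomp. }
  assert (Htup : forall k, (k < l)%nat -> t k <= H * T).
  { intros k Hk. now apply Hcomp. }
  assert (Htpos : forall k, (k < l)%nat -> 0 < t k).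
  { intros k Hk. specialize (Htlow k Hk). nra. }

  (* The gradient of [Q] and the normalizing factor [B] *)
  set (d := fun i => pderiv_eval l Q i t).
  assert (Hd : forall i, (i < l)%nat -> 0 <= d i).
  { intros i Hi. now apply pderiv_eval_nonneg. }
  set (B := BQ l Q g x).
  set (V := sumR l (fun i => sumR l (fun j => d i * d j * kappa (g i) (g j) x))).
  assert (HB : B = sqrt V) by reflexivity.
  assert (Hterm : forall i j, (i < l)%nat -> (j < l)%nat -> 0 <= d i * d j * kappa (g i) (g j) x).
  { intros i j Hi Hj. apply Rmult_le_pos; [apply Rmult_le_pos; now apply Hd|].
    apply kappa_nonneg; intros; now apply Hgp. }
  assert (HVge : forall i, (i < l)%nat -> d i ^ 2 * sigma2 (g i) x <= V).
  { intros i Hi. replace (d i ^ 2 * sigma2 (g i) x) with (d i * d i * kappa (g i) (g i) x)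
      by (unfold sigma2; ring).
    eapply Rle_trans; [|apply (sumR_ge_term l (fun i => sumR l (fun j =>
      d i * d j * kappa (g i) (g j) x)) i); [|assumption]].
    - apply (sumR_ge_term l (fun j => d i * d j * kappa (g i) (g j) x) i); [|assumption].
      intros; now apply Hterm.
    - intros k Hk. apply sumR_nonneg. intros; now apply Hterm. }
  (* All terms of [V] are nonnegative, so a diagonal one bounds it from below, and (c) compares
     [sigma2 (g i)] with the common scale [T]. Hence every weight [d i / B] is [O(tau)], and [V] is
     positive since [d i0] is. *)
  assert (HdT : forall i, (i < l)%nat -> d i ^ 2 * T <= K * V).
  { intros i Hi. apply Rle_trans with (K * (d i ^ 2 * sigma2 (g i) x)).
    - replace (K * (d i ^ 2 * sigma2 (g i) x)) with (d i ^ 2 * (K * sigma2 (g i) x)) by ring.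
      apply Rmult_le_compat_l; [apply pow2_ge_0|]. now apply HK.
    - apply Rmult_le_compat_l; [lra|]. now apply HVge. }
  assert (HV : 0 < V).
  { assert (0 < d i0 ^ 2 * T).
    { apply Rmult_lt_0_compat; [|assumption]. apply pow_lt. now apply Hpos. }
    pose proof (HdT i0 Hi0). nra. }
  assert (HB0 : 0 < B) by (rewrite HB; now apply sqrt_lt_R0).
  assert (HBV : B ^ 2 = V) by (rewrite HB; apply pow2_sqrt; lra).
  set (w := fun i => d i / B).
  assert (Hw0 : forall i, (i < l)%nat -> 0 <= w i).
  { intros i Hi. apply Rcomplements.Rdiv_le_0_compat; [now apply Hd|assumption]. }
  assert (Hw : forall i, (i < l)%nat -> w i <= K * tau).
  { intros i Hi. apply Rsqr_incr_0_var; [|apply Rmult_le_pos; lra].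
    rewrite !Rsqr_pow2. unfold w.
    apply Rmult_le_reg_r with (V * T); [now apply Rmult_lt_0_compat|].
    replace ((K * tau) ^ 2 * (V * T)) with (K * (K * V) * (tau ^ 2 * T)) by ring.
    rewrite HtauT, Rmult_1_r.
    replace ((d i / B) ^ 2 * (V * T)) with (d i ^ 2 * T) by (rewrite <- HBV; field; lra).
    eapply Rle_trans; [now apply HdT|].
    rewrite <- (Rmult_1_l (K * V)) at 1. apply Rmult_le_compat_r; [|assumption].
    apply Rmult_le_pos; lra. }

  (* The normalized linear form *)
  set (a := lin_form l w g).
  assert (Hmean : mean_of a N = sumR l (fun i => w i * t i)).
  { unfold a. rewrite mean_of_lin_form. apply sumR_ext. intros i _. unfold t.
    now rewrite mu_mean_of. }
  assert (HmeanC : mean_of a N <= C / tau).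
  { rewrite Hmean. apply Rle_trans with (sumR l (fun _ => K * tau * (H * T))).
    - apply sumR_le. intros i Hi. apply Rmult_le_compat;
        [now apply Hw0|left; now apply Htpos|now apply Hw|now apply Htup].
    - rewrite sumR_const. right. unfold C. apply Rmult_eq_reg_r with tau; [|lra].
      replace (INR l * (K * tau * (H * T)) * tau) with (INR l * K * H * (tau ^ 2 * T)) by ring.
      rewrite HtauT. field. lra. }
  assert (Hnorm : normalized C tau a N).
  { split; [|split; [|split; [exact HmeanC|]]].
    - intros p. unfold a, lin_form. destruct (isprime p) eqn:Ep; [|lra].
      apply isprime_spec in Ep. apply sumR_nonneg. intros i Hi.
      apply Rmult_le_pos; [now apply Hw0|now apply Hgp].
    - intros p Hp. unfold a. rewrite lin_form_prime by assumption.
      apply Rle_trans with (sumR l (fun _ => K * tau * H)).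
      + apply sumR_le. intros i Hi. destruct (HG i Hi p Hp).
        apply Rmult_le_compat; [now apply Hw0|assumption|now apply Hw|lra].
      + rewrite sumR_const. unfold C. right. ring.
    - unfold a, N. rewrite variance_lin_form.
      apply Rmult_eq_reg_l with V; [|lra]. rewrite Rmult_1_r. unfold V at 2.
      rewrite <- sumR_scal. apply sumR_ext. intros i _. rewrite <- sumR_scal.
      apply sumR_ext. intros j _. unfold w. rewrite <- HBV. field. lra. }

  (* The exceptional set *)
  set (eta := E * tau).
  assert (Heta : 0 < eta) by (apply Rmult_lt_0_compat; lra).
  assert (Heta1 : eta <= 1).
  { unfold eta. apply Rle_trans with (E * / E); [apply Rmult_le_compat_l; lra|right; field; lra]. }
  set (bad := fun n => existsb (fun i => far (g i) N eta n) (seq 0 l)).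
  set (Y := fun n => (peval l Q (fun j => g j n) - AQ l Q g x) / B).
  set (below := fun n => if Rlt_dec (peval l Q (fun j => g j n)) (AQ l Q g x + u * BQ l Q g x)
                         then true else false).
  assert (Hbelow : forall n, below n = true <-> Y n < u).
  { intros n. unfold below, Y. fold B.
    rewrite (Rcomplements.Rlt_div_l _ u B) by assumption.
    destruct (Rlt_dec _ _); split; intros; try discriminate; try reflexivity; lra. }
  assert (Hbad : sumf (fun n => if bad n then 1 else 0) (seq 1 N) <= INR N * e).
  { eapply Rle_trans; [apply existsb_count|].
    apply Rle_trans with (sumR l (fun _ => INR N * (3 * G * H / E ^ 2))).
    - apply sumR_le. intros i Hi. pose proof (Htpos i Hi) as Hti.
      assert (Hmi : mean_of (g i) N = t i) by (symmetry; apply mu_mean_of).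
      eapply Rle_trans; [apply (far_count (g i) N G eta HN (HG i Hi)); [rewrite Hmi|]; assumption|].
      rewrite Hmi. apply Rmult_le_compat_l; [apply pos_INR|].
      apply Rcomplements.Rle_div_l; [apply Rmult_lt_0_compat; [now apply pow_lt|assumption]|].
      replace (3 * G * H / E ^ 2 * (eta ^ 2 * t i)) with (3 * G * (tau ^ 2 * (H * t i)))
        by (unfold eta; field; lra).
      rewrite <- (Rmult_1_r (3 * G)) at 1. apply Rmult_le_compat_l; [lra|].
      rewrite <- HtauT. apply Rmult_le_compat_l; [apply pow2_ge_0|]. now apply Htlow.
    - rewrite sumR_const. replace (INR l * (INR N * (3 * G * H / E ^ 2)))
        with (INR N * (3 * INR l * G * H / E ^ 2)) by (field; lra).
      apply Rmult_le_compat_l; [apply pos_INR|].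
      apply Rcomplements.Rle_div_l; [now apply pow_lt; lra|].
      apply Rle_trans with (e * E).
      + unfold E. replace (e * (1 + 3 * INR l * G * H / e)) with (e + 3 * INR l * G * H)
          by (field; lra). lra.
      + apply Rmult_le_compat_l; [lra|]. nra. }

  (* The linearization error off the exceptional set *)
  assert (HY : forall n, (1 <= n <= N)%nat -> bad n = false ->
     Rabs (Y n - (addf a (primes N) n - mean_of a N)) <= rho).
  { intros n Hn Hbn. set (h := fun k => g k n / t k - 1).
    assert (Hh : forall k, (k < l)%nat -> Rabs (h k) <= eta).
    { intros k Hk. pose proof (Htpos k Hk) as Htk.
      pose proof (existsb_seq_false _ _ Hbn k Hk) as Hfar. unfold far in Hfar.
      destruct (Rle_dec _ _) as [Hle|Hle]; [|discriminate].
      rewrite <- (strongly_additive_addf (g k) N n) in Hle by (auto; lia).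
      assert (Hmk : mean_of (g k) N = t k) by (symmetry; apply mu_mean_of).
      rewrite Hmk in Hle. apply Rmult_le_reg_r with (t k); [assumption|].
      rewrite <- (Rabs_pos_eq (t k)) at 1 by lra. rewrite <- Rabs_mult.
      replace (h k * t k) with (g k n - t k) by (unfold h; field; lra). exact Hle. }
    pose proof (Hlin t h eta Htpos ltac:(lra) Hh) as HL.
    rewrite (peval_ext l Q (fun k => t k * (1 + h k)) (fun j => g j n)) in HL.
    2:{ intros k Hk. unfold h. field. specialize (Htpos k Hk). lra. }
    assert (Hadd : addf a (primes N) n - mean_of a N =
                   sumR l (fun k => t k * d k * h k) / B).
    { unfold a at 1. rewrite addf_lin_form, Hmean. unfold Rdiv. rewrite Rmult_comm, <- sumR_scal.
      unfold Rminus. replace (- sumR l (fun i => w i * t i)) with (-1 * sumR l (fun i => w i * t i)) by ring.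
      rewrite <- sumR_scal, <- sumR_plus. apply sumR_ext. intros k Hk.
      rewrite <- (strongly_additive_addf (g k) N n) by (auto; lia).
      unfold w, h. field. specialize (Htpos k Hk). lra. }
    assert (Hmean' : sumR l (fun k => t k * d k) = B * mean_of a N).
    { rewrite Hmean, <- sumR_scal. apply sumR_ext. intros k _. unfold w. field. lra. }
    rewrite Hadd. unfold Y. fold (d) in HL.
    change (AQ l Q g x) with (peval l Q t).
    change (sumR l (fun k => t k * pderiv_eval l Q k t * h k))
      with (sumR l (fun k => t k * d k * h k)) in HL.
    change (sumR l (fun k => t k * pderiv_eval l Q k t)) with (sumR l (fun k => t k * d k)) in HL.
    rewrite Hmean' in HL.
    set (Z := peval l Q (fun j => g j n) - peval l Q t) in *.
    set (S := sumR l (fun k => t k * d k * h k)) in *.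
    replace (Z / B - S / B) with ((Z - S) / B) by (field; lra).
    unfold Rdiv. rewrite Rabs_mult, (Rabs_pos_eq (/ B)) by (left; now apply Rinv_0_lt_compat).
    apply Rcomplements.Rle_div_l; [assumption|]. eapply Rle_trans; [exact HL|].
    (* The squared relative deviation is [E^2 * tau^2], while the first-order sum is only
       [O(1 / tau)] in units of [B]; one factor [tau] survives. *)
    apply Rle_trans with (KQ * eta ^ 2 * (B * (C / tau))).
    - apply Rmult_le_compat_l; [apply Rmult_le_pos; [assumption|apply pow2_ge_0]|].
      apply Rmult_le_compat_l; lra.
    - replace (KQ * eta ^ 2 * (B * (C / tau))) with (KQ * E ^ 2 * C * tau * B)
        by (unfold eta; field; lra).
      apply Rmult_le_compat_r; [lra|].
      apply Rle_trans with (R0 * (rho / R0)); [|right; field; lra].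
      apply Rmult_le_compat; [unfold R0 in HR0; lra|lra|unfold R0; lra|assumption]. }

  (* From the integer [N] back to [x] *)
  pose proof (Hclt tau N a (conj Htau Htau1) HN Hnorm below bad Y Hbelow Hbad HY) as Hfin.
  set (cnt := INR (length (filter below (seq 1 N)))) in *.
  change (Rabs (cnt / x - Phi u) < eps).
  replace (cnt / x - Phi u) with ((cnt - x * Phi u) / x) by (field; lra).
  unfold Rdiv. rewrite Rabs_mult, (Rabs_pos_eq (/ x)) by (left; apply Rinv_0_lt_compat; lra).
  apply Rcomplements.Rlt_div_l; [lra|].
  replace (cnt - x * Phi u) with ((cnt - INR N * Phi u) + - ((x - INR N) * Phi u)) by ring.
  eapply Rle_lt_trans; [apply Rabs_triang|]. rewrite Rabs_Ropp.
  pose proof (Phi_bounds u) as HPb.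
  assert (Hr : Rabs ((x - INR N) * Phi u) <= 1).
  { rewrite Rabs_pos_eq by (apply Rmult_le_pos; lra). nra. }
  assert (Hex : 1 <= e * x).
  { apply Rle_trans with (e * / e); [right; field; lra|apply Rmult_le_compat_l; lra]. }
  assert (HNe : INR N * (4 * e) <= x * (4 * e)) by (apply Rmult_le_compat_r; lra).
  replace eps with (6 * e) by (unfold e; field).
  nra.
Qed.
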